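(* Suppose there exist positive constants $C, L_f, K_1, K_2, L_g, L_F$ with $L_F>C$ such that (i) $\|f(t,x,u)\|\le K_1(1+\|x\|+\|u\|)$; (ii) $\|g(t,x,u)\|_{\mathbb{R}^{n\times l}}\le K_2(1+\|x\|+\|u\|)$; (iii) $\|f(t_1,x_1,u_1)-f(t_2,x_2,u_2)\|\le L_f(|t_1-t_2|+\|x_1-x_2\|+\|u_1-u_2\|)$; (iv) $\|g(t_1,x_1,u_1)-g(t_2,x_2,u_2)\|_{\mathbb{R}^{n\times l}}\le L_g(|t_1-t_2|+\|x_1-x_2\|+\|u_1-u_2\|)$; (v) $\|\tilde F(x_1',u_1')-\tilde F(x_2',u_2')\|_{H_{[0,t]}}\le L_F(\|x_1'-x_2'\|_{H_{[0,t]}}+\|u_1'-u_2'\|_{H_{[0,t]}})$; (vi) $\langle \tilde F(x',u_1')-\tilde F(x',u_2'),u_1'-u_2'\rangle_{H_{[0,t]}}\ge C\|u_1'-u_2'\|_{H_{[0,t]}}^2$, for all $t,t_1,t_2\in[0,T]$, $x,x_1,x_2\in\mathbb{R}^n$, $u,u_1,u_2\in\mathbb{R}^m$, $x',x_1',x_2'\in L^2_{ad}([0,t]\times\Omega,\mathbb{R}^n)$ and $u_1',u_2'\in U[0,t]$. Then the stochastic differential variational inequality $$dx(t)=f(t,x(t),u(t))\,dt+g(t,x(t),u(t))\,dB_t,\quad t\in[0,T],\quad x(0)=x_0,$$ $$\langle F(t,\omega,x(t,\omega),u(t,\omega)),v-u(t,\omega)\rangle\ge 0,\quad \forall v\in K,\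 \text{a.e. } t\in[0,T],\ \text{a.s. }\omega\in\Omega,$$ admits a unique Carathéodory solution $(x,u)$.
   Context: $T>0$; $B_t$ is an $l$-dimensional standard Brownian motion on a probability space $(\Omega,\mathcal{F},\mathbb{P})$, and $\mathcal{F}_t=\sigma\{B_s:0\le s\le t\}$. $K\subset\mathbb{R}^m$ is nonempty, closed and convex; $x_0\in\mathbb{R}^n$. The functions $f:[0,T]\times\mathbb{R}^n\times\mathbb{R}^m\to\mathbb{R}^n$, $g:[0,T]\times\mathbb{R}^n\times\mathbb{R}^m\to\mathbb{R}^{n\times l}$, $F:[0,T]\times\Omega\times\mathbb{R}^n\times K\to\mathbb{R}^m$ are measurable. For $0\le a\le b\le T$, $L^2_{ad}([a,b]\times\Omega,\mathbb{R}^d)$ is the Hilbert space of $\mathbb{R}^d$-valued stochastic processes $\phi(t,\omega)$, $t\in[a,b]$, adapted to $\{\mathcal{F}_t\}$ with $\int_a^b\mathbb{E}\|\phi(t)\|^2dt<\infty$, with inner product $\langle\phi,\psi\rangle_{H_{[a,b]}}=\int_a^b\mathbb{E}\langle\phi(t),\psi(t)\rangle dt$ and norm $\|\phi\|_{H_{[a,b]}}=(\int_a^b\mathbb{E}\|\phi(t)\|^2dt)^{1/2}$. Set $$U[a,b]=\{u\in L^2_{ad}([a,b]\times\Omega,\mathbb{R}^m): u(s,\omega)\in K\text{ for a.e. } s\in[a,b],\text{ a.s. }\omega\in\Omega\}.$$ The map $\tilde F: L^2_{ad}([a,b]\times\Omega,\mathbb{R}^n)\times U[a,b]\to L^2_{ad}([a,b]\times\Omega,\mathbb{R}^m)$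 is $\tilde F(x,u)(s,\omega)=F(s,\omega,x(s,\omega),u(s,\omega))$; it is a standing assumption that it is well defined (i.e. takes values in the stated space). A pair $(x,u)$ is a Carathéodory solution if $x\in L^2_{ad}([0,T]\times\Omega,\mathbb{R}^n)$, the stochastic differential equation with $x(0)=x_0$ holds, i.e. for all $t\in[0,T]$, $x(t)=x_0+\int_0^tf(s,x(s),u(s))ds+\int_0^tg(s,x(s),u(s))dB_s$ (Itô integral), and $u\in U[0,T]$ satisfies the stochastic variational inequality. Uniqueness is as elements of $L^2_{ad}([0,T]\times\Omega,\mathbb{R}^n)\times U[0,T]$. *)

(* Defs.v *)
From HB Require Import structures.
From mathcomp Require Import all_boot all_order all_algebra.
From mathcomp Require Import all_classical all_reals all_analysis.

Set Implicit Arguments.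
Unset Strict Implicit.
Unset Printing Implicit Defensive.

Import Order.TTheory GRing.Theory Num.Theory.
Import numFieldNormedType.Exports.

Local Open Scope classical_set_scope.
Local Open Scope ring_scope.

(* As for n.-tuple in the library, matrices carry the product sigma-algebra,
   generated by the coordinate maps; over R this is the Borel sigma-algebra. *)
Definition mx_coord {T : Type} {m n : nat} (ij : 'I_m * 'I_n)
  (A : 'M[T]_(m, n)) : T := A ij.1 ij.2.

Definition mx_measurable {d : measure_display} {T : measurableType d}
    (m n : nat) : set (set 'M[T]_(m, n)) :=
  <<s \bigcup_(ij in [set: 'I_m * 'I_n])
        preimage_set_system setT (mx_coord ij) (@measurable d T) >>.

Definition measure_matrix_display : measure_display -> measure_display.
Proof. exact. Qed.

Section measurable_matrix.
Context {d : measure_display} {T : measurableType d} (m n : nat).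

Let matrix_set0 : @mx_measurable d T m n set0.
Proof. exact: sigma_algebra0. Qed.

Let matrix_setC A : @mx_measurable d T m n A -> @mx_measurable d T m n (~` A).
Proof. exact: sigma_algebraC. Qed.

Let matrix_bigcup (F : nat -> set 'M[T]_(m, n)) :
  (forall i, @mx_measurable d T m n (F i)) ->
  @mx_measurable d T m n (\bigcup_i (F i)).
Proof. exact: sigma_algebra_bigcup. Qed.

HB.instance Definition _ := @isMeasurable.Build (measure_matrix_display d)
  'M[T]_(m, n) (@mx_measurable d T m n) matrix_set0 matrix_setC matrix_bigcup.

End measurable_matrix.

(* Euclidean structure on column vectors, Frobenius structure on matrices; the
   library's norm on matrices is the max norm. *)
Definition mxdot {R : realType} {m n : nat} (A B : 'M[R]_(m, n)) : R :=
  \sum_(i < m) \sum_(j < n) A i j * B i j.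

Definition mxnorm2 {R : realType} {m n : nat} (A : 'M[R]_(m, n)) : R :=
  Num.sqrt (mxdot A A).

Section stochastic.
Context {d : measure_display} {Omega : measurableType d} {R : realType}.
Variable P : probability Omega R.

Local Notation mu := (@lebesgue_measure R).

(* Only the values at times of the interval under consideration matter. *)
Definition process (m n : nat) := R -> Omega -> 'M[R]_(m, n).

Definition psub {m n} (phi psi : process m n) : process m n :=
  fun t w => phi t w - psi t w.

Definition measurable_wrt {m n} (G : set (set Omega))
    (X : Omega -> 'M[R]_(m, n)) : Prop :=
  forall A, measurable A -> G (X @^-1` A).

Definition natural_filtration {l} (B : process l 1) (t : R) :
    set (set Omega) :=
  <<s \bigcup_(s in `[0, t]%classic)
        preimage_set_system setT (B s) measurable >>.

Record is_brownian_motion {l} (B : process l 1) : Prop := {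
  bm_measurable : forall t, 0 <= t -> measurable_fun setT (B t);
  bm_start : {ae P, forall w, B 0 w = 0};
  bm_indep : forall s t, 0 <= s -> s <= t -> forall A D,
    natural_filtration B s A -> measurable D ->
    (P (A `&` [set w | D (B t w - B s w)%R]) =
     P A * P [set w | D (B t w - B s w)%R])%E;
  bm_gauss : forall s t, 0 <= s -> s < t -> forall D : 'I_l -> set R,
    (forall i, measurable (D i)) ->
    P [set w | forall i, D i ((B t w - B s w)%R i ord0)] =
    (\prod_(i < l) normal_prob 0 (Num.sqrt (t - s)) (D i))%E;
  bm_continuous : {ae P, forall w,
    {within `[0, +oo[%classic, continuous (fun t => B t w)}}
}.

Definition inner_H (a b : R) {m n} (phi psi : process m n) : R :=
  fine (\int[mu]_(t in `[a, b]) 'E_P[fun w => mxdot (phi t w) (psi t w)])%E.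

Definition norm_H (a b : R) {m n} (phi : process m n) : R :=
  Num.sqrt
    (fine (\int[mu]_(t in `[a, b]) 'E_P[fun w => (mxnorm2 (phi t w) ^+ 2)%R])%E).

(* Elements of L^2_ad([a,b] x Omega) are handled through representatives,
   which are identified by eq_L2. *)
Definition eq_L2 (a b : R) {m n} (phi psi : process m n) : Prop :=
  {ae mu, forall t, t \in `[a, b] -> {ae P, forall w, phi t w = psi t w}}.

Section adapted.
Context {l : nat}.
Variable B : process l 1.

Definition L2ad (a b : R) {m n} (phi : process m n) : Prop :=
  [/\ measurable_fun (`[a, b]%classic `*` [set: Omega])
        (fun p : R * Omega => phi p.1 p.2),
      forall t, t \in `[a, b] -> measurable_wrt (natural_filtration B t) (phi t)
    & (\int[mu]_(t in `[a, b]) 'E_P[fun w => (mxnorm2 (phi t w) ^+ 2)%R]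
        < +oo)%E].

Definition Uad (a b : R) {m} (K : set 'cV[R]_m) (u : process m 1) : Prop :=
  L2ad a b u /\
  {ae mu, forall s, s \in `[a, b] -> {ae P, forall w, K (u s w)}}.

(* The step process sum_{i < N} xi_i 1_{[t_i, t_{i+1})}. *)
Record step_process (m n : nat) := StepProcess {
  sp_size : nat;
  sp_time : nat -> R;
  sp_coef : nat -> Omega -> 'M[R]_(m, n)
}.

Definition is_step_process (t : R) {m n} (S : step_process m n) : Prop :=
  [/\ sp_time S 0 = 0, sp_time S (sp_size S) = t,
      forall i, (i < sp_size S)%N -> sp_time S i <= sp_time S i.+1,
      forall i, (i < sp_size S)%N ->
        measurable_wrt (natural_filtration B (sp_time S i)) (sp_coef S i)
    & forall i, (i < sp_size S)%N ->
        ('E_P[fun w => (mxnorm2 (sp_coef S i w) ^+ 2)%R] < +oo)%E].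

Definition step_eval {m n} (S : step_process m n) : process m n :=
  fun s w => \sum_(i < sp_size S)
    (\1_(`[sp_time S i, sp_time S i.+1[%classic) s : R) *: sp_coef S i w.

Definition step_integral {m} (S : step_process m l) (w : Omega) : 'cV[R]_m :=
  \sum_(i < sp_size S)
    sp_coef S i w *m (B (sp_time S i.+1) w - B (sp_time S i) w).

(* I is a version of the Ito integral of phi over [0,t]: the L^2 limit of the
   integrals of step processes approximating phi. *)
Definition is_ito_integral (t : R) {m} (phi : process m l)
    (I : Omega -> 'cV[R]_m) : Prop :=
  [/\ L2ad 0 t phi, measurable_fun setT I &
    exists S : nat -> step_process m l,
    [/\ forall k, is_step_process t (S k),
        (\int[mu]_(s in `[0%R, t])
          'E_P[fun w => (mxnorm2 (phi s w - step_eval (S k) s w) ^+ 2)%R])%E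
          @[k --> \oo] --> 0%E
      & 'E_P[fun w => (mxnorm2 (I w - step_integral (S k) w) ^+ 2)%R]%E
          @[k --> \oo] --> 0%E]].

End adapted.

Definition time_integral (t : R) {n} (phi : process n 1) (w : Omega) :
    'cV[R]_n :=
  \col_i (\int[mu]_(s in `[0, t]) (phi s w i ord0)).

(* F is only meaningful on K; processes in Uad leave K only on a null set, on
   which the value 0 is used so that the composition is always measurable. *)
Definition Ftilde {n m} (K : set 'cV[R]_m)
    (F : R -> Omega -> 'cV[R]_n -> 'cV[R]_m -> 'cV[R]_m)
    (x : process n 1) (u : process m 1) : process m 1 :=
  fun s w => if `[< K (u s w) >] then F s w (x s w) (u s w) else 0.

Definition Ftilde_well_defined {l n m} (T : R) (B : process l 1)
    (K : set 'cV[R]_m)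
    (F : R -> Omega -> 'cV[R]_n -> 'cV[R]_m -> 'cV[R]_m) : Prop :=
  forall (a b : R) (x : process n 1) (u : process m 1),
    0 <= a -> a <= b -> b <= T -> L2ad B a b x -> Uad B a b K u ->
    exists2 phi : process m 1,
      L2ad B a b phi & eq_L2 a b (Ftilde K F x u) phi.

Definition solves_SDE {l n m} (T : R) (B : process l 1)
    (f : R -> 'cV[R]_n -> 'cV[R]_m -> 'cV[R]_n)
    (g : R -> 'cV[R]_n -> 'cV[R]_m -> 'M[R]_(n, l)) (x0 : 'cV[R]_n)
    (x : process n 1) (u : process m 1) : Prop :=
  forall t, t \in `[0, T] ->
  exists2 I : Omega -> 'cV[R]_n,
    is_ito_integral B t (fun s w => g s (x s w) (u s w)) I &
    {ae P, forall w,
      x t w = x0 + time_integral t (fun s w => f s (x s w) (u s w)) w + I w}.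

Definition solves_SVI {n m} (T : R) (K : set 'cV[R]_m)
    (F : R -> Omega -> 'cV[R]_n -> 'cV[R]_m -> 'cV[R]_m)
    (x : process n 1) (u : process m 1) : Prop :=
  forall v, K v ->
  {ae mu, forall t, t \in `[0, T] ->
    {ae P, forall w, 0 <= mxdot (F t w (x t w) (u t w)) (v - u t w)}}.

Record caratheodory_solution {l n m} (T : R) (B : process l 1)
    (K : set 'cV[R]_m)
    (f : R -> 'cV[R]_n -> 'cV[R]_m -> 'cV[R]_n)
    (g : R -> 'cV[R]_n -> 'cV[R]_m -> 'M[R]_(n, l))
    (F : R -> Omega -> 'cV[R]_n -> 'cV[R]_m -> 'cV[R]_m) (x0 : 'cV[R]_n)
    (x : process n 1) (u : process m 1) : Prop := {
  cs_state : L2ad B 0 T x;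
  cs_sde : solves_SDE T B f g x0 x u;
  cs_control : Uad B 0 T K u;
  cs_svi : solves_SVI T K F x u
}.

End stochastic.

(* Main.v *)
Require Import Defs.
From HB Require Import structures.
From mathcomp Require Import all_boot all_order all_algebra.
From mathcomp Require Import all_classical all_reals all_analysis.
From mathcomp Require Import measurable_realfun.
From mathcomp Require Import ring lra.

(** The solution is the limit of an iteration on pairs (x, u). From such a pair a
    new state is obtained by integrating f(x, u) ds + g(x, u) dB, and a new
    control by u' = p(u - rho F(x, u)), where p is the projection onto K. Since p
    is characterised by a variational inequality, u solves the stochastic
    variational inequality for x exactly when u = p(u - rho F(x, u)) almost
    everywhere ([fixed_point_svi], [svi_fixed_point]), so solutions are the fixed
    points of the iteration.

    The iteration contracts. For a fixed state, expanding
    |du - rho dF|^2 and using strong monotonicity and the Lipschitz bound of F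
    gives the factor 1 - C^2 / L_F^2 for rho = C / L_F^2
    ([explicit_step_contracts]); this is less than 1 because C < L_F. A change of
    the state changes the new control by a bounded multiple only
    ([update_contraction]). The new states satisfy
    E |y(t) - y'(t)|^2 <= c int_0^t E (|x - x'|^2 + |u - u'|^2) ds, and after
    weighting the control and the state suitably and allowing growth exp(beta t)
    in time with beta large, the map on pairs is a strict contraction
    ([iteration_contracts]). Uniqueness follows at once ([solution_unique]);
    existence follows by completeness ([solution_exists]), where the property
    that u takes values in K survives in the limit because p is nonexpansive.

    Everything else constructs the new state. The Ito integral is the mean square
    limit of integrals of step processes, so what has to be shown is: increments
    of B are orthogonal to the past, whence the Ito estimate for step processes
    ([grid_isometry], [steps_isometry]); step processes are dense
    ([step_approx]), which is proved by sampling a bounded process at times of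
    small mean oscillation, found by Lebesgue differentiation; hence the integral exists at
    each time and depends continuously on the integrand and on the time
    ([ito_integral_exists], [ito_estimate], [state_estimate]). The states at the
    single times are finally put together to a jointly measurable adapted process
    as a limit along finer and finer time grids ([state_process]). Limits are
    taken as coordinatewise upper limits ([plim]), which are adapted without
    completing the filtration. *)

Set Implicit Arguments.
Unset Strict Implicit.
Unset Printing Implicit Defensive.

Import Order.TTheory GRing.Theory Num.Theory.
Import numFieldNormedType.Exports.

Local Open Scope classical_set_scope.
Local Open Scope ring_scope.

(** * Euclidean geometry of matrices *)

Lemma cvg_sqr_dominated {R : realType} {T : Type} {F : set_system T}
    {FF : Filter F} (f g : T -> R) (l : R) :
  (forall x, (f x - l) ^+ 2 <= g x) -> g x @[x --> F] --> (0 : R) ->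
  f x @[x --> F] --> l.
Proof.
move=> fg g0; apply/cvgrPdist_lt => e e0.
have e20 : 0 < e ^+ 2 by rewrite exprn_gt0.
have /cvgrPdist_lt /(_ _ e20) := g0.
apply: filterS => k; rewrite sub0r normrN => h.
rewrite distrC -ltr_sqr ?nnegrE ?normr_ge0 ?(ltW e0) // real_normK ?num_real //.
exact: le_lt_trans (fg k) (le_lt_trans (ler_norm _) h).
Qed.

Section euclid.
Context {R : realType}.

Lemma mxdotC m n (A B : 'M[R]_(m, n)) : mxdot A B = mxdot B A.
Proof. by apply: eq_bigr => i _; apply: eq_bigr => j _; rewrite mulrC. Qed.

Lemma mxdotDl m n (A B D : 'M[R]_(m, n)) :
  mxdot (A + B) D = mxdot A D + mxdot B D.
Proof.
rewrite /mxdot -big_split; apply: eq_bigr => i _ /=.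
by rewrite -big_split; apply: eq_bigr => j _ /=; rewrite !mxE mulrDl.
Qed.

Lemma mxdotZl m n a (A B : 'M[R]_(m, n)) : mxdot (a *: A) B = a * mxdot A B.
Proof.
rewrite /mxdot mulr_sumr; apply: eq_bigr => i _ /=.
by rewrite mulr_sumr; apply: eq_bigr => j _ /=; rewrite !mxE mulrA.
Qed.

Lemma mxdotNl m n (A B : 'M[R]_(m, n)) : mxdot (- A) B = - mxdot A B.
Proof. by rewrite -scaleN1r mxdotZl mulN1r. Qed.

Lemma mxdotBl m n (A B D : 'M[R]_(m, n)) :
  mxdot (A - B) D = mxdot A D - mxdot B D.
Proof. by rewrite mxdotDl mxdotNl. Qed.

Lemma mxdotDr m n (A B D : 'M[R]_(m, n)) :
  mxdot D (A + B) = mxdot D A + mxdot D B.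
Proof. by rewrite mxdotC mxdotDl !(mxdotC D). Qed.

Lemma mxdotZr m n a (A B : 'M[R]_(m, n)) : mxdot A (a *: B) = a * mxdot A B.
Proof. by rewrite mxdotC mxdotZl mxdotC. Qed.

Lemma mxdotNr m n (A B : 'M[R]_(m, n)) : mxdot A (- B) = - mxdot A B.
Proof. by rewrite mxdotC mxdotNl mxdotC. Qed.

Lemma mxdotBr m n (A B D : 'M[R]_(m, n)) :
  mxdot D (A - B) = mxdot D A - mxdot D B.
Proof. by rewrite mxdotDr mxdotNr. Qed.

Definition sqnorm {m n} (A : 'M[R]_(m, n)) : R := mxdot A A.

Lemma sqnormE m n (A : 'M[R]_(m, n)) :
  sqnorm A = \sum_i \sum_j A i j ^+ 2.
Proof. by apply: eq_bigr => i _; apply: eq_bigr => j _; rewrite expr2. Qed.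

Lemma sqnorm_ge0 m n (A : 'M[R]_(m, n)) : 0 <= sqnorm A.
Proof.
by rewrite sqnormE; apply: sumr_ge0 => i _; apply: sumr_ge0 => j _; apply: sqr_ge0.
Qed.
#[local] Hint Extern 0 (is_true (0 <= sqnorm _)%R) => solve [exact: sqnorm_ge0] : core.

Lemma mxnorm2_sqr m n (A : 'M[R]_(m, n)) : mxnorm2 A ^+ 2 = sqnorm A.
Proof. by rewrite /mxnorm2 sqr_sqrtr //; exact: sqnorm_ge0. Qed.

Lemma mxnorm2_ge0 m n (A : 'M[R]_(m, n)) : 0 <= mxnorm2 A.
Proof. exact: sqrtr_ge0. Qed.

Lemma coord_sqr_le m n (A : 'M[R]_(m, n)) i j : A i j ^+ 2 <= sqnorm A.
Proof.
rewrite sqnormE (bigD1 i) //= (bigD1 j) //= -addrA lerDl.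
apply: addr_ge0; first by apply: sumr_ge0 => k _; exact: sqr_ge0.
by apply: sumr_ge0 => k _; apply: sumr_ge0 => k' _; exact: sqr_ge0.
Qed.

Lemma sqnorm_eq0 m n (A : 'M[R]_(m, n)) : sqnorm A = 0 -> A = 0.
Proof.
move=> A0; apply/matrixP => i j; rewrite mxE; apply/eqP.
by rewrite -sqrf_eq0 eq_le sqr_ge0 andbT -A0 coord_sqr_le.
Qed.

Lemma sqnorm0 m n : sqnorm (0 : 'M[R]_(m, n)) = 0.
Proof. by rewrite /sqnorm -[X in mxdot X _](scale0r 0) mxdotZl mul0r. Qed.

Lemma sqnormZ m n a (A : 'M[R]_(m, n)) : sqnorm (a *: A) = a ^+ 2 * sqnorm A.
Proof. by rewrite /sqnorm mxdotZl mxdotZr mulrA expr2. Qed.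

Lemma sqnormN m n (A : 'M[R]_(m, n)) : sqnorm (- A) = sqnorm A.
Proof. by rewrite /sqnorm mxdotNl mxdotNr opprK. Qed.

Lemma sqnormBC m n (A B : 'M[R]_(m, n)) : sqnorm (A - B) = sqnorm (B - A).
Proof. by rewrite -sqnormN opprB. Qed.

Lemma sqnormD m n (A B : 'M[R]_(m, n)) :
  sqnorm (A + B) = sqnorm A + 2 * mxdot A B + sqnorm B.
Proof. by rewrite /sqnorm !(mxdotDl, mxdotDr) (mxdotC B A); ring. Qed.

Lemma sqnormB m n (A B : 'M[R]_(m, n)) :
  sqnorm (A - B) = sqnorm A - 2 * mxdot A B + sqnorm B.
Proof. by rewrite sqnormD sqnormN mxdotNr mulrN. Qed.

Lemma mxdot_le m n (A B : 'M[R]_(m, n)) :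
  2 * `|mxdot A B| <= sqnorm A + sqnorm B.
Proof.
have := sqnorm_ge0 (A - B); have := sqnorm_ge0 (A + B).
rewrite sqnormB sqnormD => h1 h2.
have : `|mxdot A B| <= (sqnorm A + sqnorm B) / 2.
  by rewrite ler_norml; apply/andP; split; lra.
lra.
Qed.

(** Young's inequality. *)
Lemma sqnormD_young m n e (A B : 'M[R]_(m, n)) : 0 < e ->
  sqnorm (A + B) <= (1 + e) * sqnorm A + (1 + e^-1) * sqnorm B.
Proof.
move=> e0; have := sqnorm_ge0 (e *: A - B); rewrite sqnormB sqnormZ mxdotZl.
move=> /(mulr_ge0 (ltW (eqbRL (invr_gt0 e) e0))).
have -> : e^-1 * (e ^+ 2 * sqnorm A - 2 * (e * mxdot A B) + sqnorm B) =
  e * sqnorm A - 2 * mxdot A B + e^-1 * sqnorm B by field; rewrite gt_eqF.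
rewrite sqnormD; lra.
Qed.

Lemma sqnormD_le2 m n (A B : 'M[R]_(m, n)) :
  sqnorm (A + B) <= 2 * sqnorm A + 2 * sqnorm B.
Proof. by have := sqnormD_young A B (ltr01 : 0 < 1 :> R); rewrite invr1. Qed.

Lemma sqnormB_le2 m n (A B : 'M[R]_(m, n)) :
  sqnorm (A - B) <= 2 * sqnorm A + 2 * sqnorm B.
Proof. by rewrite -(sqnormN B) sqnormD_le2. Qed.

Lemma sqnorm_triangle2 m n (B A D : 'M[R]_(m, n)) :
  sqnorm (A - D) <= 2 * sqnorm (A - B) + 2 * sqnorm (B - D).
Proof. by rewrite -(subrKA B A (-D)) sqnormD_le2. Qed.

Lemma sqr_sum_le n (a : 'I_n -> R) : (\sum_i a i) ^+ 2 <= n%:R * \sum_i a i ^+ 2.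
Proof.
rewrite expr2 mulr_suml.
under eq_bigr do rewrite mulr_sumr.
apply: (@le_trans _ _ (\sum_(i < n) \sum_(j < n) (a i ^+ 2 + a j ^+ 2) / 2)).
  apply: ler_sum => i _; apply: ler_sum => j _.
  by have := sqr_ge0 (a i - a j); rewrite sqrrB; lra.
under eq_bigr do rewrite -mulr_suml big_split /= sumr_const card_ord.
by rewrite -mulr_suml big_split /= sumr_const card_ord sumrMnl -mulr_natl; lra.
Qed.

End euclid.
#[export] Hint Extern 0 (is_true (0 <= sqnorm _)%R) => solve [exact: sqnorm_ge0] : core.

Section matrix_measurability.
Context {R : realType} {d : measure_display} {T : measurableType d}.

Lemma measurable_coord m n i j :
  measurable_fun setT (fun A : 'M[R]_(m, n) => A i j).
Proof.
move=> _ Y mY; apply: sub_sigma_algebra; exists (i, j) => //.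
by exists Y.
Qed.

Lemma measurable_mxP m n (D : set T) (X : T -> 'M[R]_(m, n)) : measurable D ->
  measurable_fun D X <-> forall i j, measurable_fun D (fun x => X x i j).
Proof.
move=> mD; split=> [mX i j|mX].
  exact: (measurableT_comp (@measurable_coord m n i j) mX).
apply: (measurability (\bigcup_(ij in [set: 'I_m * 'I_n])
        preimage_set_system setT (mx_coord ij) (@measurable _ R))) => //.
move=> _ [_ [[i j] _ [Y mY <-]] <-]; rewrite setTI.
exact: mX.
Qed.

Lemma measurable_mxdot m n (D : set T) (X Y : T -> 'M[R]_(m, n)) :
  measurable D -> measurable_fun D X -> measurable_fun D Y ->
  measurable_fun D (fun x => mxdot (X x) (Y x)).
Proof.
move=> mD /(measurable_mxP _ mD) mX /(measurable_mxP _ mD) mY.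
apply: measurable_sum => i; apply: measurable_sum => j.
exact: measurable_funM.
Qed.

Lemma measurable_sqnorm m n (D : set T) (X : T -> 'M[R]_(m, n)) :
  measurable D -> measurable_fun D X -> measurable_fun D (fun x => sqnorm (X x)).
Proof. by move=> mD mX; exact: measurable_mxdot. Qed.

Lemma measurable_mxD m n (D : set T) (X Y : T -> 'M[R]_(m, n)) :
  measurable D -> measurable_fun D X -> measurable_fun D Y ->
  measurable_fun D (fun x => X x + Y x).
Proof.
move=> mD /(measurable_mxP _ mD) mX /(measurable_mxP _ mD) mY.
apply/(measurable_mxP _ mD) => i j; under eq_fun do rewrite mxE.
exact: measurable_funD.
Qed.

Lemma measurable_mxZ m n (D : set T) (a : T -> R) (X : T -> 'M[R]_(m, n)) :
  measurable D -> measurable_fun D a -> measurable_fun D X ->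
  measurable_fun D (fun x => a x *: X x).
Proof.
move=> mD ma /(measurable_mxP _ mD) mX.
apply/(measurable_mxP _ mD) => i j; under eq_fun do rewrite mxE.
exact: measurable_funM.
Qed.

Lemma measurable_mxB m n (D : set T) (X Y : T -> 'M[R]_(m, n)) :
  measurable D -> measurable_fun D X -> measurable_fun D Y ->
  measurable_fun D (fun x => X x - Y x).
Proof.
move=> mD mX mY; apply: measurable_mxD => //.
by under eq_fun do rewrite -scaleN1r; apply: measurable_mxZ.
Qed.

Lemma measurable_mxM m n p (D : set T) (X : T -> 'M[R]_(m, n))
    (Y : T -> 'M[R]_(n, p)) :
  measurable D -> measurable_fun D X -> measurable_fun D Y ->
  measurable_fun D (fun x => X x *m Y x).
Proof.
move=> mD /(measurable_mxP _ mD) mX /(measurable_mxP _ mD) mY.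
apply/(measurable_mxP _ mD) => i j; under eq_fun do rewrite mxE.
by apply: measurable_sum => k; exact: measurable_funM.
Qed.

Lemma measurable_mx_sum m n (D : set T) (I : Type) (s : seq I)
    (X : I -> T -> 'M[R]_(m, n)) :
  measurable D -> (forall i, measurable_fun D (X i)) ->
  measurable_fun D (fun x => \sum_(i <- s) X i x).
Proof.
move=> mD mX; elim: s => [|i s ih].
  by under eq_fun do rewrite big_nil; exact: measurable_cst.
by under eq_fun do rewrite big_cons; apply: measurable_mxD.
Qed.

End matrix_measurability.

Lemma rat_mx_approx {R : realType} m n (A : 'M[R]_(m, n)) (e : R) : 0 < e ->
  exists q : 'M[rat]_(m, n), forall i j, `|ratr (q i j) - A i j| < e.
Proof.
move=> e0.
have /choice[q hq] : forall ij : 'I_m * 'I_n,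
    exists r : rat, `|ratr r - A ij.1 ij.2| < e.
  move=> ij; have [r] : exists r : rat, ratr r \in `]A ij.1 ij.2 - e, A ij.1 ij.2 + e[.
    by apply: rat_in_itvoo; rewrite ltrBlDr -addrA ltrDl addr_gt0.
  by rewrite in_itv /= => hr; exists r; rewrite ltr_distl.
by exists (\matrix_(i, j) q (i, j)) => i j; rewrite mxE; exact: (hq (i, j)).
Qed.

(** Rational boxes form a countable base, so the product sigma-algebra contains
    the topology. *)
Lemma open_mx_measurable {R : realType} m n (U : set 'M[R]_(m, n)) :
  open U -> measurable U.
Proof.
move=> oU.
pose q2R (q : 'M[rat]_(m, n)) : 'M[R]_(m, n) := map_mx ratr q.
pose box (q : 'M[rat]_(m, n) * nat) : set 'M[R]_(m, n) :=
  [set A | forall i j, `|q2R q.1 i j - A i j| < q.2.+1%:R^-1].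
have mbox q : measurable (box q).
  have -> : box q = \bigcap_(ij in [set: 'I_m * 'I_n])
      [set A : 'M[R]_(m, n) | `|q2R q.1 ij.1 ij.2 - A ij.1 ij.2| < q.2.+1%:R^-1].
    apply/seteqP; split=> A /= hA; first by move=> ij _; exact: hA.
    by move=> i j; exact: (hA (i, j)).
  apply: fin_bigcap_measurable; first exact: finite_finset.
  move=> [i j] _ /=.
  have : measurable_fun setT (fun A : 'M[R]_(m, n) => `|q2R q.1 i j - A i j|).
    apply: measurableT_comp => //.
    by apply: measurable_funB => //; exact: measurable_coord.
  move=> /(_ measurableT `]-oo, q.2.+1%:R^-1[%classic (measurable_itv _)).
  by rewrite setTI; congr measurable; apply/seteqP; split=> A /=; rewrite in_itv.
pose V (k : nat) := if unpickle k is Some q then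
  (if `[< box q `<=` U >] then box q else set0) else set0.
suff -> : U = \bigcup_k V k.
  apply: bigcup_measurable => k _; rewrite /V; case: unpickle => // q.
  by case: ifP.
apply/seteqP; split=> [A UA|A [k _]]; last first.
  by rewrite /V; case: unpickle => // q; case: asboolP => // qU; exact: qU.
have /nbhs_ballP[e /= e0 eU] : nbhs A U by move: oU; rewrite openE; exact.
have [k ke] : exists k : nat, k.+1%:R^-1 < e / 2.
  have e2 : 0 < e / 2 by rewrite divr_gt0.
  have [k _ /(_ k (leqnn k)) hk] := near_infty_natSinv_lt (PosNum e2).
  by exists k.
have k0 : (0 : R) < k.+1%:R^-1 by [].
have [Q hQ] := rat_mx_approx A k0.
exists (pickle (Q, k)) => //; rewrite /V pickleK.
have QA : box (Q, k) A.
  by move=> i j /=; rewrite mxE; exact: hQ.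
case: asboolP => // qU; exfalso; apply: qU => C hC; apply: eU.
split=> // i j /=.
rewrite /ball /=; have := hC i j; have := QA i j => /= h1 h2.
rewrite -(subrKA (q2R Q i j)).
apply: le_lt_trans (ler_normD _ _) _.
by rewrite distrC (splitr e) ltrD // (lt_trans _ ke).
Qed.

Lemma continuous_mx_measurable {R : realType} m n (h : 'M[R]_(m, n) -> R) :
  continuous h -> measurable_fun setT h.
Proof.
move=> /continuousP ch.
apply: (measurability _ (RGenOpens.measurableE R)).
move=> _ [_ [x [y ->]] <-]; rewrite setTI; apply: open_mx_measurable.
by apply: ch; exact: interval_open.
Qed.

(** * Convergence in mean square *)

Lemma cvg_bigsum {R : realType} {T : Type} {F : set_system T} {FF : Filter F}
    {I : Type} (s : seq I) (f : I -> T -> R) (l : I -> R) :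
  (forall i, f i x @[x --> F] --> l i) ->
  (\sum_(i <- s) f i x) @[x --> F] --> \sum_(i <- s) l i.
Proof.
move=> fl; elim: s => [|i s ih].
  by under eq_fun do rewrite big_nil; rewrite big_nil; exact: cvg_cst.
by under eq_fun do rewrite big_cons; rewrite big_cons; apply: cvgD.
Qed.

Section mean_square.
Context {d : measure_display} {T : measurableType d} {R : realType}.
Variable mu : {measure set T -> \bar R}.
Variable D : set T.
Hypothesis mD : measurable D.
Implicit Types m n : nat.

Definition intsq {m n} (X : T -> 'M[R]_(m, n)) : \bar R :=
  (\int[mu]_(x in D) (sqnorm (X x))%:E)%E.

Lemma measurable_EFin_sqnorm m n (X : T -> 'M[R]_(m, n)) :
  measurable_fun D X -> measurable_fun D (fun x => (sqnorm (X x))%:E).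
Proof. by move=> mX; apply/measurable_EFinP; exact: measurable_sqnorm. Qed.

Lemma intsq_ge0 m n (X : T -> 'M[R]_(m, n)) : (0 <= intsq X)%E.
Proof. by apply: integral_ge0 => x _; rewrite lee_fin. Qed.
#[local] Hint Extern 0 (is_true (0 <= intsq _)%E) => solve [exact: intsq_ge0] : core.

Lemma intsq_lin m n p q s t (X : T -> 'M[R]_(m, n)) (Y : T -> 'M[R]_(p, q))
    (Z : T -> 'M[R]_(s, t)) (a b : R) : 0 <= a -> 0 <= b ->
  measurable_fun D X -> measurable_fun D Y -> measurable_fun D Z ->
  {ae mu, forall x, D x ->
    sqnorm (Z x) <= a * sqnorm (X x) + b * sqnorm (Y x)} ->
  (intsq Z <= a%:E * intsq X + b%:E * intsq Y)%E.
Proof.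
move=> a0 b0 mX mY mZ le_Z.
have h p' q' (c : R) (W : T -> 'M[R]_(p', q')) : 0 <= c -> measurable_fun D W ->
    measurable_fun D (fun x => (c * sqnorm (W x))%:E).
  move=> c0 mW; apply/measurable_EFinP.
  by apply: measurable_funM => //; exact: measurable_sqnorm.
have h2 p' q' (c : R) (W : T -> 'M[R]_(p', q')) : 0 <= c -> measurable_fun D W ->
    (c%:E * intsq W = \int[mu]_(x in D) (c * sqnorm (W x))%:E)%E.
  move=> c0 mW; rewrite /intsq -ge0_integralZl_EFin//.
  - by move=> x _; rewrite lee_fin.
  - exact: measurable_EFin_sqnorm.
rewrite !h2 // -ge0_integralD //; first last.
- exact: h.
- by move=> x _; rewrite lee_fin mulr_ge0.
- exact: h.
- by move=> x _; rewrite lee_fin mulr_ge0.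
apply: ae_ge0_le_integral => //.
- by move=> x _; rewrite lee_fin.
- exact: measurable_EFin_sqnorm.
- by move=> x _; rewrite adde_ge0 // lee_fin mulr_ge0.
- by apply: emeasurable_funD; exact: h.
Qed.

Lemma intsqD_young m n (X Y : T -> 'M[R]_(m, n)) e : 0 < e ->
  measurable_fun D X -> measurable_fun D Y ->
  (intsq (fun x => (X x + Y x)%R) <=
   (1 + e)%:E * intsq X + (1 + e^-1)%:E * intsq Y)%E.
Proof.
move=> e0 mX mY; apply: intsq_lin => //.
- by rewrite addr_ge0 // ltW.
- by rewrite addr_ge0 // invr_ge0 ltW.
- exact: measurable_mxD.
- by apply: aeW => x _; exact: sqnormD_young.
Qed.

Lemma intsqD_le2 m n (X Y : T -> 'M[R]_(m, n)) :
  measurable_fun D X -> measurable_fun D Y ->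
  (intsq (fun x => (X x + Y x)%R) <= 2%:E * intsq X + 2%:E * intsq Y)%E.
Proof.
by move=> mX mY; have := intsqD_young ltr01 mX mY; rewrite invr1.
Qed.

Lemma intsq_eq0 m n (X : T -> 'M[R]_(m, n)) : measurable_fun D X ->
  intsq X = 0%E <-> {ae mu, forall x, D x -> X x = 0}.
Proof.
move=> mX; rewrite /intsq.
have -> : (\int[mu]_(x in D) (sqnorm (X x))%:E =
    \int[mu]_(x in D) `|(sqnorm (X x))%:E|)%E.
  by apply: eq_integral => x _; rewrite gee0_abs // lee_fin.
rewrite ae_eq_integral_abs //; last exact: measurable_EFin_sqnorm.
split; apply: filterS => x + Dx => /(_ Dx) h.
  by apply: sqnorm_eq0; case: h.
by rewrite h sqnorm0.
Qed.

(** Almost everywhere summability from geometrically decaying integrals, by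
    monotone convergence. *)
Lemma ae_cvg_series_geometric (f : nat -> T -> R) (A r : R) :
  0 < r < 1 -> 0 <= A ->
  (forall k, measurable_fun D (f k)) -> (forall k x, D x -> 0 <= f k x) ->
  (forall k, \int[mu]_(x in D) (f k x)%:E <= (A * r ^+ k)%:E)%E ->
  {ae mu, forall x, D x -> cvgn (series (fun k => f k x))}.
Proof.
move=> /andP[r0 r1] A0 mf f0 fA.
pose g x := (\sum_(0 <= k <oo) (f k x)%:E)%E.
have mg : measurable_fun D g.
  apply: ge0_emeasurable_sum => k //; first by move=> x Dx _; rewrite lee_fin f0.
  by move=> _; apply/measurable_EFinP.
have g0 x : D x -> (0 <= g x)%E.
  by move=> Dx; apply: nneseries_ge0 => k _ _; rewrite lee_fin f0.
have ig : (\int[mu]_(x in D) g x < +oo)%E.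
  rewrite /g integral_nneseries //; first last.
  - by move=> k; apply/measurable_EFinP.
  apply: (@le_lt_trans _ _ (A / (1 - r))%:E); last exact: ltry.
  apply: lime_le.
    apply: is_cvg_nneseries => k _ _; apply: integral_ge0 => x Dx.
    by rewrite lee_fin f0.
  apply: nearW => k.
  apply: (@le_trans _ _ (\sum_(0 <= i < k) (A * r ^+ i)%:E)%E).
    by apply: lee_sum => i _.
  rewrite sumEFin lee_fin.
  by apply: geometric_le_lim => //; rewrite ger0_norm // ltW.
have : mu.-integrable D g.
  apply/integrableP; split => //.
  rewrite (eq_integral g) // => x; rewrite inE => Dx.
  by rewrite gee0_abs // g0.
move=> /(integrable_ae mD); apply: filterS => x + Dx => /(_ Dx) gfin.
apply: nondecreasing_is_cvgn.
  by apply: nondecreasing_series => k _ _; exact: f0.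
exists (fine (g x)) => _ [k _ <-].
rewrite -lee_fin fineK // /series /= -sumEFin.
by apply: nneseries_lim_ge => i _ _; rewrite lee_fin f0.
Qed.

(** Coordinatewise upper limits: total, measurable for every sigma-algebra for
    which the sequence is, and equal to the limit wherever there is one. *)
Definition plim {S} {m n} (Y : nat -> S -> 'M[R]_(m, n)) (x : S) : 'M[R]_(m, n) :=
  \matrix_(i, j) fine (limn_esup (fun k => (Y k x i j)%:E)).

Lemma plim_cvg S m n (Y : nat -> S -> 'M[R]_(m, n)) x (L : 'M[R]_(m, n)) :
  (forall i j, Y k x i j @[k --> \oo] --> L i j) -> plim Y x = L.
Proof.
move=> YL; apply/matrixP => i j; rewrite mxE.
have /cvg_limn_einf_sup[_ ->] : (Y k x i j)%:E @[k --> \oo] --> (L i j)%:E.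
  by apply: cvg_EFin; [exact: nearW|exact: YL].
by [].
Qed.

End mean_square.

Lemma measurable_plim d (T : measurableType d) (R : realType) (D : set T) m n
    (Y : nat -> T -> 'M[R]_(m, n)) : measurable D ->
  (forall k, measurable_fun D (Y k)) -> measurable_fun D (plim Y).
Proof.
move=> mD mY; apply/measurable_mxP => // i j; under eq_fun do rewrite mxE.
apply: (measurableT_comp (@fine_measurable R setT measurableT)).
apply: measurable_fun_limn_esup => k.
by apply/measurable_EFinP; move/measurable_mxP: (mY k); exact.
Qed.

Section mean_square_limits.
Context {d : measure_display} {T : measurableType d} {R : realType}.
Variable mu : {measure set T -> \bar R}.
Variable D : set T.
Hypothesis mD : measurable D.

(** Geometric decay makes the squared distances summable almost everywhere, so
    that they tend to zero there. *)
Lemma plim_ae_eq m n (Y : nat -> T -> 'M[R]_(m, n)) (X : T -> 'M[R]_(m, n))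
    (A r : R) : 0 < r < 1 -> 0 <= A ->
  (forall k, measurable_fun D (Y k)) -> measurable_fun D X ->
  (forall k, intsq mu D (fun x => (Y k x - X x)%R) <= (A * r ^+ k)%:E)%E ->
  {ae mu, forall x, D x -> plim Y x = X x}.
Proof.
move=> r01 A0 mY mX YX.
suff: {ae mu, forall x, D x -> cvgn (series (fun k => sqnorm (Y k x - X x)))}.
  apply: filterS => x hx Dx; have h0 := @cvg_series_cvg_0 R R^o _ (hx Dx).
  apply: plim_cvg => i j.
  apply: (cvg_sqr_dominated _ h0) => k.
  by have := coord_sqr_le (Y k x - X x) i j; rewrite !mxE.
apply: (ae_cvg_series_geometric mD r01 A0) => //.
by move=> k; apply: measurable_sqnorm => //; exact: measurable_mxB.
Qed.

(** Young's inequality with parameter 1/r - 1 makes the geometric bounds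
    telescope exactly. *)
Lemma cauchy_chain m n (Y : nat -> T -> 'M[R]_(m, n)) (A r : R) : 0 < r < 1 ->
  (forall k, measurable_fun D (Y k)) -> 0 <= A ->
  (forall k, intsq mu D (fun x => (Y k.+1 x - Y k x)%R) <= (A * r ^+ 2 ^+ k)%:E)%E ->
  forall j k, (intsq mu D (fun x => (Y (k + j)%N x - Y k x)%R) <=
    (A / (1 - r) ^+ 2 * r ^+ 2 ^+ k)%:E)%E.
Proof.
move=> /andP[r0 r1] mY A0 hA; elim=> [|j ih] k.
  rewrite addn0 /intsq; under eq_integral do rewrite subrr sqnorm0.
  by rewrite integral0 lee_fin !mulr_ge0 // ?exprn_ge0 // ?invr_ge0 ?exprn_ge0 ?subr_ge0 // ltW.
have e0 : 0 < (1 - r) / r by rewrite divr_gt0 // subr_gt0.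
have := @intsqD_young _ _ _ mu D mD _ _ (fun x => Y (k.+1 + j)%N x - Y k.+1 x)
  (fun x => Y k.+1 x - Y k x) _ e0.
move=> /(_ (measurable_mxB mD (mY _) (mY _)) (measurable_mxB mD (mY _) (mY _))).
under eq_fun do rewrite subrKA; rewrite addSnnS => /le_trans; apply.
apply: (@le_trans _ _ ((1 + (1 - r) / r)%:E * (A / (1 - r) ^+ 2 * r ^+ 2 ^+ k.+1)%:E
   + (1 + ((1 - r) / r)^-1)%:E * (A * r ^+ 2 ^+ k)%:E)%E).
  apply: leeD; apply: lee_wpmul2l; rewrite ?lee_fin //.
  - by rewrite addr_ge0 // ltW.
  - by have := ih k.+1; rewrite addSnnS.
  - by rewrite addr_ge0 // invr_ge0 ltW.
rewrite -!EFinM -EFinD lee_fin [_ ^+ k.+1]exprS; set q := r ^+ 2 ^+ k.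
rewrite le_eqVlt; apply/orP; left; apply/eqP; field.
by rewrite (gt_eqF r0) subr_eq0 gt_eqF //= subr_eq0 gt_eqF.
Qed.

(** Completeness of the space of square integrable functions; Fatou's lemma
    carries the bounds over to the limit. *)
Lemma plim_complete m n (Y : nat -> T -> 'M[R]_(m, n)) (A r : R) : 0 < r < 1 ->
  (forall k, measurable_fun D (Y k)) -> 0 <= A ->
  (forall k, intsq mu D (fun x => (Y k.+1 x - Y k x)%R) <= (A * r ^+ 2 ^+ k)%:E)%E ->
  {ae mu, forall x, D x -> forall i j, Y k x i j @[k --> \oo] --> plim Y x i j} /\
  forall k, (intsq mu D (fun x => (plim Y x - Y k x)%R) <=
    (A / (1 - r) ^+ 2 * r ^+ 2 ^+ k)%:E)%E.
Proof.
move=> r01 mY A0 hA; have /andP[r0 r1] := r01.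
have aecvg : {ae mu, forall x, D x ->
    forall i j, Y k x i j @[k --> \oo] --> plim Y x i j}.
  have : {ae mu, forall x, D x ->
      cvgn (series (fun k => r ^- k * sqnorm (Y k.+1 x - Y k x)))}.
  apply: (ae_cvg_series_geometric mD r01 A0) => //.
  - move=> k; apply: measurable_funM => //.
    by apply: measurable_sqnorm => //; exact: measurable_mxB.
  - by move=> k x _; rewrite mulr_ge0 ?sqnorm_ge0 // invr_ge0 exprn_ge0 // ltW.
  - move=> k; under eq_integral do rewrite EFinM.
    rewrite ge0_integralZl_EFin //; first last.
    + by rewrite invr_ge0 exprn_ge0 // ltW.
    + by apply: measurable_EFin_sqnorm => //; exact: measurable_mxB.
    + by move=> x _; rewrite lee_fin.
    apply: (@le_trans _ _ ((r ^- k)%:E * (A * r ^+ 2 ^+ k)%:E)%E).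
      apply: lee_wpmul2l; last exact: hA.
      by rewrite lee_fin invr_ge0 exprn_ge0 // ltW.
    rewrite -EFinM lee_fin -exprM mulnC exprM expr2 le_eqVlt; apply/orP; left.
    by apply/eqP; field; rewrite expf_neq0 // gt_eqF.
  apply: filterS => x hx Dx i j.
  suff : cvgn (fun k => Y k x i j).
    move=> /cvg_ex[l hl].
    rewrite mxE; have /cvg_limn_einf_sup[_ ->] : (Y k x i j)%:E @[k --> \oo] --> l%:E.
      by apply: cvg_EFin; [exact: nearW|exact: hl].
    exact: hl.
  have -> : (fun k => Y k x i j) =
      (fun k => Y 0%N x i j + series (telescope (fun k => Y k x i j)) k).
    by apply/funext => k; rewrite -eq_sum_telescope.
  apply: is_cvgD; first exact: is_cvg_cst.
  apply: (@normed_cvg R R^o).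
  apply: (@series_le_cvg _ _ (fun k => r ^+ k + r ^- k * sqnorm (Y k.+1 x - Y k x))).
  - by move=> k; exact: normr_ge0.
  - move=> k; rewrite addr_ge0 // ?mulr_ge0 ?sqnorm_ge0 // ?invr_ge0 exprn_ge0 //; exact: ltW.
  - move=> k /=; rewrite /telescope.
    have := coord_sqr_le (Y k.+1 x - Y k x) i j; rewrite !mxE.
    set s := sqnorm _; set y := _ - _ => ys.
    have rk0 : 0 < r ^+ k by rewrite exprn_gt0.
    apply: (@le_trans _ _ (r ^+ k + r ^- k * y ^+ 2)); last first.
      by rewrite lerD2l ler_wpM2l // invr_ge0 ltW.
    have rkr : r ^+ k * r ^- k = 1 by rewrite mulfV // gt_eqF.
    rewrite -(ler_pM2l rk0) mulrDr mulrA rkr mul1r.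
    have := sqr_ge0 (`|y| - r ^+ k).
    rewrite sqrrB real_normK ?num_real //.
    have := mulr_ge0 (ltW rk0) (normr_ge0 y); lra.
  - have -> : (fun k => r ^+ k + r ^- k * sqnorm (Y k.+1 x - Y k x)) =
      (fun k => r ^+ k) \+ (fun k => r ^- k * sqnorm (Y k.+1 x - Y k x)) by [].
    rewrite seriesD; apply: is_cvgD; last exact: hx.
    have -> : (fun k => r ^+ k) = geometric 1 r by apply/funext => k /=; rewrite mul1r.
    by apply: is_cvg_geometric_series; rewrite ger0_norm // ltW.
split=> // k.
have mP : measurable_fun D (plim Y) by exact: measurable_plim.
pose f j x := (sqnorm (Y (k + j)%N x - Y k x))%:E.
have mf j : measurable_fun D (f j).
  by apply: measurable_EFin_sqnorm => //; exact: measurable_mxB.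
have f0 j x : D x -> (0 <= f j x)%E by move=> _; rewrite lee_fin.
have mlf : measurable_fun D (fun x => limn_einf (f^~ x)).
  have -> : (fun x => limn_einf (f^~ x)) =
      (fun x => (- limn_esup (fun j => - f j x))%E).
    apply/funext => x; rewrite -limn_einfN; congr (limn_einf _).
    by apply/funext => j; exact/esym/oppeK.
  apply: (measurableT_comp (@oppe_measurable R setT)) => //.
  apply: measurable_fun_limn_esup => j.
  exact: (measurableT_comp (@oppe_measurable R setT)).
apply: (@le_trans _ _ (\int[mu]_(x in D) limn_einf (f^~ x))%E).
  apply: ae_ge0_le_integral => //.
  - by move=> x _; rewrite lee_fin.
  - by apply: measurable_EFin_sqnorm => //; exact: measurable_mxB.
  - move=> x Dx; rewrite limn_einf_lim; apply: lime_ge; first exact: is_cvg_einfs.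
    by apply: nearW => j; apply: le_ereal_inf_tmp => _ [i _ <-]; exact: f0.
  apply: filterS aecvg => x hx Dx.
  have /cvg_limn_einf_sup[-> _] : f j x @[j --> \oo] --> (sqnorm (plim Y x - Y k x))%:E.
    apply: cvg_EFin; first exact: nearW.
    rewrite /f /= sqnormE; under eq_fun do rewrite sqnormE.
    apply: cvg_bigsum => a; apply: cvg_bigsum => b.
    have hk : Y (k + j)%N x a b - Y k x a b @[j --> \oo] -->
        plim Y x a b - Y k x a b.
      apply: cvgB; last exact: cvg_cst.
      under eq_fun do rewrite addnC.
      by have := hx Dx a b; rewrite -(cvg_shiftn k).
    have E (Z : 'M[R]_(m, n)) : (Z - Y k x) a b ^+ 2 =
        (Z a b - Y k x a b) * (Z a b - Y k x a b).
      by rewrite !mxE expr2.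
    by under eq_fun do rewrite E; rewrite E; exact: cvgM.
  by [].
apply: le_trans (fatou mu mD mf f0) _.
rewrite limn_einf_lim; apply: lime_le; first exact: is_cvg_einfs.
apply: nearW => j; apply: (@le_trans _ _ (\int[mu]_(x in D) f j x)%E).
  by apply: ereal_inf_lbound; exists j => /=.
exact: cauchy_chain.
Qed.

End mean_square_limits.

(** * Integration over slabs of a product *)

Section any_integral.
Import HBNNSimple.
Context {d : measure_display} {T : measurableType d} {R : realType}.
Variable mu : {measure set T -> \bar R}.

(** Monotonicity without measurability: a simple function below [f], cut off
    on the exceptional null set, lies below [g] and has the same integral. *)
Lemma ae_ge0_le_integral_any (D : set T) (f g : T -> \bar R) :
  (forall x, D x -> (0 <= f x)%E) -> (forall x, D x -> (0 <= g x)%E) ->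
  {ae mu, forall x, D x -> (f x <= g x)%E} ->
  (\int[mu]_(x in D) f x <= \int[mu]_(x in D) g x)%E.
Proof.
move=> f0 g0 [N [mN N0 hN]].
rewrite (integral_mkcond D f) (integral_mkcond D g).
have pos (k : T -> \bar R) : (forall x, D x -> (0 <= k x)%E) ->
    forall x, (0 <= (k \_ D) x)%E.
  by move=> k0 x; rewrite patchE; case: ifPn => // /set_mem; exact: k0.
rewrite ge0_integralTE; last exact: pos.
apply: ge_ereal_sup => _ [h hf <-].
pose h' := proj_nnsfun h (measurableC mN).
rewrite -integralT_nnsfun.
have -> : (\int[mu]_x (h x)%:E = \int[mu]_x (h' x)%:E)%E.
  apply: ge0_ae_eq_integral => //.
  - by apply/measurable_EFinP.
  - by apply/measurable_EFinP.
  - by move=> x _; rewrite lee_fin.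
  - by move=> x _; rewrite lee_fin.
  exists N; split => // x /= hx; apply: contrapT => Nx; apply: hx => _.
  by rewrite /h' /= /proj_nnsfun /= mindicE mem_set //= mulr1.
rewrite integralT_nnsfun ge0_integralTE; last exact: pos.
apply: ereal_sup_ubound; exists h' => // x /=.
rewrite /h' /proj_nnsfun /= mindicE.
have [xN|xN] := boolP (x \in ~` N); last by rewrite mulr0; exact: pos.
rewrite mulr1; apply: le_trans (hf x) _; rewrite !patchE.
case: ifPn => // /set_mem Dx; apply: contrapT => nle.
by move/set_mem: xN; apply; apply: hN => /= /(_ Dx).
Qed.

Lemma ae_ge0_eq_integral_any (D : set T) (f g : T -> \bar R) :
  (forall x, D x -> (0 <= f x)%E) -> (forall x, D x -> (0 <= g x)%E) ->
  {ae mu, forall x, D x -> f x = g x} ->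
  (\int[mu]_(x in D) f x = \int[mu]_(x in D) g x)%E.
Proof.
move=> f0 g0 fg; apply/le_anti/andP; split.
all: apply: ae_ge0_le_integral_any => //; apply: filterS fg => x + Dx => /(_ Dx).
all: by move=> ->.
Qed.

Lemma ae_eq_integral_any (D : set T) (f g : T -> \bar R) :
  {ae mu, forall x, D x -> f x = g x} ->
  (\int[mu]_(x in D) f x = \int[mu]_(x in D) g x)%E.
Proof.
move=> fg; rewrite [LHS]integralE [RHS]integralE; congr (_ - _)%E.
all: apply: ae_ge0_eq_integral_any => //; apply: filterS fg => x + Dx => /(_ Dx) e.
- by rewrite !funeposE e.
- by rewrite !funenegE e.
Qed.

End any_integral.

Section slab.
Context {d1 d2 : measure_display} {T1 : measurableType d1} {T2 : measurableType d2}.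
Context {R : realType}.
Variables (m1 : {sigma_finite_measure set T1 -> \bar R}).
Variables (m2 : {sigma_finite_measure set T2 -> \bar R}).
Variable D : set T1.
Hypothesis mD : measurable D.

Local Notation slab := (D `*` [set: T2]).

Lemma measurable_slab : measurable slab.
Proof. exact: measurableX. Qed.

Lemma slab_patch (f : T1 * T2 -> \bar R) t w :
  (f \_ slab) (t, w) = if t \in D then f (t, w) else 0%E.
Proof.
rewrite patchE; case: ifPn => [/set_mem[/= Dt _]|h]; first by rewrite mem_set.
by case: ifPn => // /set_mem Dt; exfalso; move/negP: h; apply; rewrite inE.
Qed.

Lemma measurable_slab_patch (f : T1 * T2 -> \bar R) :
  measurable_fun slab f -> measurable_fun setT (f \_ slab).
Proof. by move=> mf; apply/(measurable_restrictT _ measurable_slab). Qed.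

Lemma slab_patch_ge0 (f : T1 * T2 -> \bar R) :
  (forall p, slab p -> (0 <= f p)%E) -> forall p, (0 <= (f \_ slab) p)%E.
Proof. by move=> f0 p; rewrite patchE; case: ifPn => // /set_mem; exact: f0. Qed.

Lemma slab_inner (f : T1 * T2 -> \bar R) t :
  (\int[m2]_w (f \_ slab) (t, w) =
   ((fun t => \int[m2]_w f (t, w)) \_ D) t)%E.
Proof.
rewrite patchE; under eq_integral do rewrite slab_patch.
by case: ifPn => // _; rewrite integral0.
Qed.

Lemma tonelli_slab (f : T1 * T2 -> \bar R) :
  measurable_fun slab f -> (forall p, slab p -> (0 <= f p)%E) ->
  (\int[m1 \x m2]_(p in slab) f p = \int[m1]_(t in D) \int[m2]_w f (t, w))%E.
Proof.
move=> mf f0; rewrite integral_mkcond fubini_tonelli1; first last.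
- exact: slab_patch_ge0.
- exact: measurable_slab_patch.
by rewrite [RHS]integral_mkcond; apply: eq_integral => t _; exact: slab_inner.
Qed.

Lemma measurable_slab_integral (f : T1 * T2 -> \bar R) :
  measurable_fun slab f -> (forall p, slab p -> (0 <= f p)%E) ->
  measurable_fun D (fun t => \int[m2]_w f (t, w))%E.
Proof.
move=> mf f0; apply/(measurable_restrictT _ mD).
have -> : ((fun t => \int[m2]_w f (t, w)) \_ D = fubini_F m2 (f \_ slab))%E.
  by apply/funext => t; rewrite -slab_inner.
apply: measurable_fun_fubini_tonelli_F; first exact: measurable_slab_patch.
exact: slab_patch_ge0.
Qed.

Lemma tonelli_slab_swap (f : T1 * T2 -> \bar R) :
  measurable_fun slab f -> (forall p, slab p -> (0 <= f p)%E) ->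
  (\int[m1]_(t in D) \int[m2]_w f (t, w) = \int[m2]_w \int[m1]_(t in D) f (t, w))%E.
Proof.
move=> mf f0.
have := @fubini_tonelli _ _ _ _ _ m1 m2 (f \_ slab) (measurable_slab_patch mf)
  (slab_patch_ge0 f0).
rewrite /fubini_F /fubini_G => h.
rewrite integral_mkcond -[LHS](eq_integral _ _ (fun t _ => slab_inner f t)) h.
apply: eq_integral => w _; rewrite [RHS]integral_mkcond.
by apply: eq_integral => t _; rewrite slab_patch patchE.
Qed.

Lemma measurable_slab_integral2 (f : T1 * T2 -> \bar R) :
  measurable_fun slab f -> (forall p, slab p -> (0 <= f p)%E) ->
  measurable_fun setT (fun w => \int[m1]_(t in D) f (t, w))%E.
Proof.
move=> mf f0.
have -> : ((fun w => \int[m1]_(t in D) f (t, w)) = fubini_G m1 (f \_ slab))%E.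
  apply/funext => w; rewrite /fubini_G [LHS]integral_mkcond.
  by apply: eq_integral => t _; rewrite slab_patch patchE.
apply: measurable_fun_fubini_tonelli_G; first exact: measurable_slab_patch.
exact: slab_patch_ge0.
Qed.

Lemma fubini_slab (f : T1 * T2 -> \bar R) :
  (m1 \x m2)%E.-integrable slab f ->
  (\int[m1 \x m2]_(p in slab) f p = \int[m1]_(t in D) \int[m2]_w f (t, w))%E.
Proof.
move=> mf; rewrite [LHS]integral_mkcond -integral12_prod_meas1; last first.
  by apply/(integrable_mkcond _ measurable_slab).
by rewrite [RHS]integral_mkcond; apply: eq_integral => t _; exact: slab_inner.
Qed.

Lemma measurable_slab_section2 d' (T' : measurableType d') (f : T1 * T2 -> T') w :
  measurable_fun slab f -> measurable_fun D (fun t => f (t, w)).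
Proof.
move=> mf; have -> : (fun t => f (t, w)) = f \o (fun t => (t, w)) by [].
apply: (measurable_comp measurable_slab) => //.
  by move=> _ [t Dt <-]; split.
by apply: measurable_funS (pair2_measurable w).
Qed.

Lemma ae_slab1 (Q : T1 * T2 -> Prop) :
  {ae (m1 \x m2)%E, forall p, slab p -> Q p} ->
  {ae m1, forall t, D t -> {ae m2, forall w, Q (t, w)}}.
Proof.
move=> [N [mN N0 hN]].
have : (\int[m1]_t `|m2 (xsection N t)| = 0)%E.
  by rewrite -[RHS]N0; apply: eq_integral => t _; rewrite gee0_abs.
rewrite ae_eq_integral_abs //; last exact: measurable_fun_xsection.
apply: filterS => t /(_ I) /= h Dt; exists (xsection N t); split => //.
  exact: measurable_xsection.
by move=> w /= hw; apply/xsectionP; apply: hN => /= hp; apply: hw; exact: hp.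
Qed.

End slab.

(** * Projection onto a closed convex set *)

Section projection.
Context {R : realType} {m : nat}.
Variable K : set 'cV[R]_m.
Hypothesis K0 : K !=set0.
Hypothesis clK : closed K.
Hypothesis cvK : convex_set K.

Lemma convex_segment x y t : K x -> K y -> 0 <= t -> t <= 1 ->
  K (x + t *: (y - x)).
Proof.
move=> Kx Ky t0 t1.
have /set_mem := cvK (Itv01 t0 t1) (mem_set Ky) (mem_set Kx).
have <- : t *: y + (1 - t) *: x = x + t *: (y - x); last by [].
by apply/matrixP => i j; rewrite !mxE; ring.
Qed.

Lemma cvg_mx_coord (v : nat -> 'cV[R]_m) (p : 'cV[R]_m) :
  (forall i j, v k i j @[k --> \oo] --> p i j) -> v k @[k --> \oo] --> p.
Proof.
move=> vp; apply/cvg_ballP => e e0.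
have : \forall k \near \oo, forall i j, ball (p i j) e (v k i j).
  by apply: filter_forall => i; apply: filter_forall => j; move/cvg_ballP: (vp i j); exact.
by apply: filterS => k hk; split.
Qed.

(** A minimising sequence is Cauchy by the parallelogram identity; its limit is
    a nearest point, and comparing that point with a segment issued from it
    gives the variational inequality. *)
Lemma projection_exists (q : 'cV[R]_m) :
  exists p, K p /\ forall v, K v -> mxdot (q - p) (v - p) <= 0.
Proof.
pose E := [set sqnorm (q - v) | v in K].
have lbE : lbound E 0 by move=> _ [v _ <-]; exact: sqnorm_ge0.
have hE : has_inf E.
  split; last by exists 0.
  by have [v Kv] := K0; exists (sqnorm (q - v)); exists v.
have dE v : K v -> inf E <= sqnorm (q - v).
  by move=> Kv; apply: ge_inf; [exists 0|exists v].
set dl := inf E in dE.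
pose r k : R := (1 / 4) ^+ k.+1.
have r0 k : 0 < r k by rewrite exprn_gt0.
have /choice[v hv] : forall k, exists v, K v /\ sqnorm (q - v) <= dl + r k.
  move=> k; have [_ [v Kv <-] lt_v] := inf_adherent (r0 k) hE.
  by exists v; split => //; exact: ltW.
have vC k : sqnorm (v k.+1 - v k) <= 4 * r k.
  have := @convex_segment (v k) (v k.+1) (1 / 2) (hv k).1 (hv k.+1).1.
  move=> /(_ ltac:(lra) ltac:(lra)) /dE.
  have -> : q - (v k + (1 / 2) *: (v k.+1 - v k)) =
      (1 / 2) *: ((q - v k.+1) + (q - v k)).
    apply/matrixP => i j; rewrite !mxE; lra.
  have -> : v k.+1 - v k = (q - v k) - (q - v k.+1).
    by apply/matrixP => i j; rewrite !mxE; lra.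
  rewrite sqnormZ sqnormB sqnormD (mxdotC (q - v k)) expr2.
  have := (hv k).2; have := (hv k.+1).2.
  have -> : r k.+1 = r k / 4 by rewrite /r exprSr; lra.
  have := r0 k; lra.
pose p : 'cV[R]_m := \matrix_(i, j) lim (v k i j @[k --> \oo]).
have vp i j : v k i j @[k --> \oo] --> p i j.
  rewrite mxE; suff : cvgn (fun k => v k i j) by [].
  have -> : (fun k => v k i j) =
      (fun k => v 0%N i j + series (telescope (fun k => v k i j)) k).
    by apply/funext => k; rewrite -eq_sum_telescope.
  apply: is_cvgD; first exact: is_cvg_cst.
  apply: (@normed_cvg R R^o).
  apply: (@series_le_cvg _ _ (geometric 1 (1 / 2))).
  - by move=> k; exact: normr_ge0.
  - by move=> k /=; rewrite mul1r exprn_ge0.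
  - move=> k /=; rewrite /telescope mul1r.
    have := le_trans (coord_sqr_le (v k.+1 - v k) i j) (vC k); rewrite !mxE => h.
    rewrite -ler_sqr ?nnegrE ?normr_ge0 ?exprn_ge0 // real_normK ?num_real //.
    apply: le_trans h _; rewrite /r exprS exprAC.
    have -> : (1 / 2 : R) ^+ 2 = 1 / 4 by rewrite expr2; lra.
    have e4 : 4 * (1 / 4) = 1 :> R by lra.
    by rewrite mulrA e4 mul1r.
  - apply: is_cvg_geometric_series; rewrite ger0_norm; lra.
have Kp : K p.
  apply: (closed_cvg _ clK) (cvg_mx_coord vp).
  by apply: nearW => k; exact: (hv k).1.
have dp : sqnorm (q - p) <= dl.
  have c1 : sqnorm (q - v k) @[k --> \oo] --> sqnorm (q - p).
    rewrite sqnormE; under eq_fun do rewrite sqnormE.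
    apply: cvg_bigsum => i; apply: cvg_bigsum => j.
    have e (Z : 'cV[R]_m) : (q - Z) i j ^+ 2 = (q i j - Z i j) * (q i j - Z i j).
      by rewrite !mxE expr2.
    rewrite e; under eq_fun do rewrite e.
    by apply: cvgM; (apply: cvgB; [exact: cvg_cst|exact: vp]).
  have c2 : dl + r k @[k --> \oo] --> dl + 0.
    apply: cvgD; first exact: cvg_cst.
    have -> : r = geometric (1 / 4) (1 / 4).
      by apply/funext => k; rewrite /r exprS.
    by apply: cvg_geometric; rewrite ger0_norm; lra.
  rewrite addr0 in c2.
  apply: (ler_cvg_to c1 c2); apply: nearW => k; exact: (hv k).2.
exists p; split => // w Kw; rewrite leNgt; apply/negP => lt0.
set c := mxdot _ _ in lt0.
pose S := sqnorm (w - p); have S0 : 0 <= S by exact: sqnorm_ge0.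
pose t := Num.min 1 (c / (S + 1)).
have S1 : 0 < S + 1 by lra.
have t0 : 0 < t by rewrite lt_min ltr01 divr_gt0.
have t1 : t <= 1 by rewrite ge_min lexx.
have tS : t * S < 2 * c.
  have h : t <= c / (S + 1) by rewrite ge_min lexx orbT.
  have : t * (S + 1) <= c by rewrite -ler_pdivlMr.
  by rewrite mulrDr mulr1; lra.
have := dE _ (convex_segment Kp Kw (ltW t0) t1).
rewrite opprD addrA sqnormB mxdotZr sqnormZ -/c -/S => h.
have : t * (2 * c) <= t * (t * S) by move: h dp; rewrite expr2; lra.
by rewrite ler_pM2l // leNgt tS.
Qed.

Definition nearest (q : 'cV[R]_m) : 'cV[R]_m :=
  xget 0 [set p | K p /\ forall v, K v -> mxdot (q - p) (v - p) <= 0].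

Lemma nearest_in q : K (nearest q).
Proof. by have [] := xgetPex 0 (projection_exists q). Qed.

Lemma nearest_var q v : K v -> mxdot (q - nearest q) (v - nearest q) <= 0.
Proof. by have [_] := xgetPex 0 (projection_exists q); exact. Qed.

Lemma nearest_nonexpansive a b : sqnorm (nearest a - nearest b) <= sqnorm (a - b).
Proof.
have := nearest_var a (nearest_in b); have := nearest_var b (nearest_in a).
set p := nearest a; set s := nearest b => h1 h2.
have : sqnorm (p - s) <= mxdot (a - b) (p - s).
  rewrite /sqnorm; move: h1 h2.
  by rewrite !(mxdotBl, mxdotBr) (mxdotC s p); lra.
have := mxdot_le (a - b) (p - s); have := ler_norm (mxdot (a - b) (p - s)); lra.
Qed.

Lemma nearest_uniq q p : K p -> (forall v, K v -> mxdot (q - p) (v - p) <= 0) ->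
  p = nearest q.
Proof.
move=> Kp hp; have := nearest_var q Kp; have := hp _ (nearest_in q).
set s := nearest q => h1 h2; apply/eqP; rewrite -subr_eq0; apply/eqP/sqnorm_eq0.
apply/eqP; rewrite eq_le sqnorm_ge0 andbT; move: h1 h2; rewrite /sqnorm.
by rewrite !(mxdotBl, mxdotBr) (mxdotC s p); lra.
Qed.

Lemma nearest_id p : K p -> nearest p = p.
Proof. by move=> Kp; apply/esym/nearest_uniq => // v _; rewrite subrr -(scale0r 0) mxdotZl mul0r. Qed.

Lemma measurable_nearest : measurable_fun setT nearest.
Proof.
apply/measurable_mxP => // i j; apply: continuous_mx_measurable => a.
apply: (@cvg_sqr_dominated R _ (nbhs a) (nbhs_filter a) _ (fun b => sqnorm (b - a))).
  move=> b; apply: le_trans (nearest_nonexpansive b a).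
  by have := coord_sqr_le (nearest b - nearest a) i j; rewrite !mxE.
rewrite -(sqnorm0 m 1) -(subrr a) [X in _ --> X]sqnormE; under eq_fun do rewrite sqnormE.
apply: cvg_bigsum => i'; apply: cvg_bigsum => j'.
have e (Z : 'cV[R]_m) : (Z - a) i' j' ^+ 2 = (Z i' j' - a i' j') * (Z i' j' - a i' j').
  by rewrite !mxE expr2.
rewrite e; under eq_fun do rewrite e.
by apply: cvgM; (apply: cvgB; [exact: coord_continuous|exact: cvg_cst]).
Qed.

(** Projections of rational points form a countable dense subset of [K], so one
    exceptional null set can serve all competitors in the variational
    inequality. *)
Lemma nearest_rat_dense (A u : 'cV[R]_m) :
  (forall q : 'cV[rat]_m, 0 <= mxdot A (nearest (map_mx ratr q) - u)) ->
  forall v, K v -> 0 <= mxdot A (v - u).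
Proof.
move=> hq v Kv; rewrite leNgt; apply/negP => lt0.
set c := - mxdot A (v - u); have c0 : 0 < c by rewrite oppr_gt0.
pose S := sqnorm A; have S0 : 0 <= S by exact: sqnorm_ge0.
pose e := c / (S + 1); have S1 : 0 < S + 1 by lra.
have e0 : 0 < e by rewrite divr_gt0.
have eS : e * S < c.
  have : e * (S + 1) = c by rewrite /e divfK // gt_eqF.
  by rewrite mulrDr mulr1; lra.
pose D := e * c; have D0 : 0 < D by rewrite mulr_gt0.
pose dl := Num.min 1 (D / m.+1%:R).
have dl0 : 0 < dl by rewrite lt_min ltr01 divr_gt0.
have [q hqv] := rat_mx_approx v dl0.
have sq : sqnorm (map_mx ratr q - v) <= D.
  apply: (@le_trans _ _ (\sum_(i < m) D / m.+1%:R)); last first.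
    rewrite sumr_const card_ord -[X in X <= _]mulr_natl mulrCA ler_piMr ?(ltW D0) //.
    by rewrite ler_pdivrMr ?mul1r ?ler_nat.
  rewrite sqnormE; apply: ler_sum => i _; rewrite big_ord1 !mxE.
  have := hqv i ord0; set y := _ - _ => ylt.
  rewrite -real_normK ?num_real // expr2.
  have y1 : `|y| <= 1 by apply: le_trans (ltW ylt) _; rewrite ge_min lexx.
  have y2 : `|y| <= D / m.+1%:R by apply: le_trans (ltW ylt) _; rewrite ge_min lexx orbT.
  by apply: le_trans y2; rewrite ler_piMl.
have := hq q; set w := nearest _ => hw.
have wv : sqnorm (w - v) <= D.
  by apply: le_trans sq; rewrite -{1}(nearest_id Kv); exact: nearest_nonexpansive.
have hc : mxdot A (w - v) >= c.
  by move: hw; rewrite /c !mxdotBr; lra.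
have := sqnorm_ge0 (e *: A - (w - v)); rewrite sqnormB sqnormZ mxdotZl -/S => h.
have h1 : 2 * (e * c) <= e * (e * S) + e * c.
  have : e * c <= e * mxdot A (w - v) by rewrite ler_pM2l.
  by move: h wv; rewrite /D expr2; lra.
have h2 : e * (e * S) < e * c by rewrite ltr_pM2l.
lra.
Qed.

End projection.

(** * Independence and centred Gaussian variables *)

Section normal_moments.
Context {R : realType}.
Local Notation mu := (@lebesgue_measure R).

Lemma ge0_integral_reflect (f : R -> \bar R) : measurable_fun setT f ->
  (forall x, 0 <= f x)%E -> (\int[mu]_x f x = \int[mu]_x f (- x)%R)%E.
Proof.
move=> mf f0.
have mN : measurable_fun setT (-%R : measurableTypeR R -> measurableTypeR R).
  exact: oppr_measurable.
have := ge0_integral_pushforward mN mu measurableT mf.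
rewrite preimage_setT => <- //.
by apply: eq_measure_integral => //= A mA AS; exact/esym/lebesgue_measureN.
Qed.

Lemma ge0_integral_normal_prob (s : R) (f : R -> \bar R) :
  measurable_fun setT f -> (forall x, 0 <= f x)%E ->
  (\int[normal_prob 0 s]_x f x = \int[mu]_x (f x * (normal_pdf 0 s x)%:E))%E.
Proof.
move=> mf f0; have dom := normal_prob_dominates 0 s.
rewrite -(Radon_Nikodym_SigmaFinite.change_of_variables dom) //.
have mRN : measurable_fun setT (Radon_Nikodym_SigmaFinite.f (normal_prob 0 s) mu).
  exact: measurable_int (Radon_Nikodym_SigmaFinite.f_integrable dom).
have mpdf : measurable_fun setT (fun x => (normal_pdf 0 s x)%:E).
  by apply/measurable_EFinP; exact: measurable_normal_pdf.
apply: ae_eq_integral => //; try exact: emeasurable_funM.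
apply: ae_eqe_mul2l; apply: integral_ae_eq => //.
- exact: Radon_Nikodym_SigmaFinite.f_integrable.
- move=> A _ mA; rewrite -Radon_Nikodym_SigmaFinite.f_integral //.
Qed.

(** The Gaussian factor absorbs the square: [y <= exp y] turns half of the
    exponent into a polynomial bound, at the price of doubling the variance. *)
Lemma normal_second_moment (s : R) : 0 < s ->
  (\int[normal_prob 0 s]_x (x ^+ 2)%:E <= (8 * s ^+ 2)%:E)%E.
Proof.
move=> s0; rewrite ge0_integral_normal_prob; first last.
- by move=> x; rewrite lee_fin sqr_ge0.
- by apply/measurable_EFinP; exact: measurable_funX.
have s2 : 0 < Num.sqrt 2 * s by rewrite mulr_gt0 // sqrtr_gt0.
have bound x : x ^+ 2 * normal_pdf 0 s x <=
    8 * s ^+ 2 * normal_pdf 0 (Num.sqrt 2 * s) x.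
  rewrite /normal_pdf (gt_eqF s0) (gt_eqF s2) /normal_peak /normal_fun subr0.
  rewrite exprMn sqr_sqrtr //.
  have := @pi_gt0 R; move: (pi : R) => c c0.
  set p := s ^+ 2 * c *+ 2.
  have p0 : 0 < p by rewrite pmulrn_lgt0 // mulr_gt0 // exprn_gt0.
  have -> : 2 * s ^+ 2 * c *+ 2 = 2 * p by rewrite /p !mulr2n; ring.
  have sp0 : 0 < Num.sqrt p by rewrite sqrtr_gt0.
  have h1 : (Num.sqrt p)^-1 <= 2 * (Num.sqrt (2 * p))^-1.
    have q0 : 0 < Num.sqrt (2 * p) by rewrite sqrtr_gt0 mulr_gt0.
    rewrite -[leLHS]mul1r ler_pdivrMr // mulrAC ler_pdivlMr // mul1r.
    rewrite -ler_sqr ?nnegrE ?ltW ?mulr_gt0 // exprMn !sqr_sqrtr ?ltW ?mulr_gt0 //.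
    by rewrite expr2; lra.
  set y := x ^+ 2 / (4 * s ^+ 2).
  have ss0 : 0 < s ^+ 2 by rewrite exprn_gt0.
  have -> : - x ^+ 2 / (s ^+ 2 *+ 2) = - y - y.
    by rewrite /y mulr2n; field; rewrite !gt_eqF ?addr_gt0 // ?mulr_gt0.
  have -> : - x ^+ 2 / (2 * s ^+ 2 *+ 2) = - y.
    by rewrite /y mulr2n; field; rewrite !gt_eqF ?addr_gt0 // ?mulr_gt0.
  have xy : x ^+ 2 = 4 * s ^+ 2 * y.
    by rewrite /y; field; rewrite gt_eqF.
  rewrite xy expRD expRN.
  have h2 : y * (expR y)^-1 <= 1.
    rewrite ler_pdivrMr ?expR_gt0 // mul1r.
    by have := expR_ge1Dx y; lra.
  set E := (expR y)^-1; have E0 : 0 <= E by rewrite invr_ge0 expR_ge0.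
  set a := (Num.sqrt p)^-1; set b := (Num.sqrt (2 * p))^-1.
  have a0 : 0 <= a by rewrite invr_ge0 sqrtr_ge0.
  have -> : 4 * s ^+ 2 * y * (a * (E * E)) = 4 * s ^+ 2 * E * (a * (y * E)) by ring.
  have -> : 8 * s ^+ 2 * (b * E) = 4 * s ^+ 2 * E * (2 * b) by ring.
  apply: ler_wpM2l; first by rewrite !mulr_ge0 // ltW.
  by apply: le_trans h1; rewrite ler_piMr.
apply: (@le_trans _ _ (\int[mu]_x ((8 * s ^+ 2)%:E * (normal_pdf 0 (Num.sqrt 2 * s) x)%:E))%E).
  apply: ge0_le_integral => //.
  - by move=> x _; rewrite -EFinM lee_fin mulr_ge0 ?sqr_ge0 ?normal_pdf_ge0.
  - by apply/measurable_EFinP/measurable_funM; [exact: measurable_funX|exact: measurable_normal_pdf].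
  - by apply/measurable_EFinP/measurable_funM => //; exact: measurable_normal_pdf.
  - by move=> x _; rewrite -!EFinM lee_fin.
rewrite ge0_integralZl_EFin //.
- by rewrite integral_normal_pdf mule1.
- by move=> x _; rewrite lee_fin normal_pdf_ge0.
- by apply/measurable_EFinP; exact: measurable_normal_pdf.
- by rewrite mulr_ge0 // sqr_ge0.
Qed.

Lemma normal_symmetric (s : R) : 0 < s ->
  (\int[normal_prob 0 s]_x (Num.max x 0)%:E =
   \int[normal_prob 0 s]_x (Num.max (- x) 0)%:E)%E.
Proof.
move=> s0.
have mp : measurable_fun setT (fun x : R => (Num.max x 0)%:E).
  by apply/measurable_EFinP; apply: measurable_maxr.
have mn : measurable_fun setT (fun x : R => (Num.max (- x) 0)%:E).
  by apply/measurable_EFinP; apply: measurable_maxr.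
have p0 (x : R) : (0 <= (Num.max x 0)%:E)%E by rewrite lee_fin le_max lexx orbT.
rewrite !ge0_integral_normal_prob // ge0_integral_reflect.
- apply: eq_integral => x _; rewrite /normal_pdf (gt_eqF s0).
  by rewrite /normal_fun !subr0 sqrrN.
- apply: emeasurable_funM => //.
  by apply/measurable_EFinP; exact: measurable_normal_pdf.
- by move=> x; rewrite mule_ge0 // lee_fin normal_pdf_ge0.
Qed.

End normal_moments.

Section random_variables.
Context {d : measure_display} {T : measurableType d} {R : realType}.
Variable P : probability T R.
Local Open Scope ereal_scope.

Lemma integrable_sqr (X : T -> R) : measurable_fun setT X ->
  \int[P]_w (X w ^+ 2)%:E < +oo -> P.-integrable setT (EFin \o X).
Proof.
move=> mX X2; apply/integrableP; split; first exact/measurable_EFinP.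
apply: (@le_lt_trans _ _ (\int[P]_w (1 + (X w ^+ 2)%:E))).
  apply: ge0_le_integral => //.
  - by apply: measurableT_comp => //; exact/measurable_EFinP.
  - by apply: emeasurable_funD => //; apply/measurable_EFinP; exact: measurable_funX.
  move=> w _ /=; rewrite -EFinD lee_fin -real_normK ?num_real //.
  by have := sqr_ge0 (`|X w| - 1)%R; rewrite sqrrB expr1n; have := normr_ge0 (X w); lra.
have P1 : \int[P]_w 1 = 1.
  by rewrite integral_cst // mul1e; exact: probability_setT.
rewrite ge0_integralD //.
- by rewrite P1 lte_add_pinfty // ltry.
- by move=> w _; rewrite lee_fin sqr_ge0.
- by apply/measurable_EFinP; exact: measurable_funX.
Qed.

Section gaussian_law.
Variables (Y : T -> R) (s : R).
Hypothesis s0 : (0 < s)%R.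
Hypothesis mY : measurable_fun setT Y.
Hypothesis lawY : forall D, measurable D -> P (Y @^-1` D) = normal_prob 0 s D.

Let ge0_law (f : R -> \bar R) : measurable_fun setT f -> (forall x, 0 <= f x) ->
  \int[P]_w f (Y w) = \int[normal_prob 0 s]_x f x.
Proof.
move=> mf f0.
have mY' : measurable_fun setT (Y : T -> measurableTypeR R) := mY.
pose Y0 : {mfun T >-> measurableTypeR R} :=
  HB.pack (Y : T -> measurableTypeR R) (isMeasurableFun.Build _ _ _ _ _ mY').
have := @ge0_integral_distribution _ _ _ _ _ P Y0 f mf f0.
rewrite /comp /= => <-; apply: eq_measure_integral => D mD _.
exact: lawY.
Qed.

Lemma gaussian_second_moment : \int[P]_w (Y w ^+ 2)%:E <= (8 * s ^+ 2)%:E.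
Proof.
rewrite (ge0_law (f := fun x => (x ^+ 2)%:E)); first exact: normal_second_moment.
- by apply/measurable_EFinP; exact: measurable_funX.
- by move=> x; rewrite lee_fin sqr_ge0.
Qed.

Lemma gaussian_centred : \int[P]_w (Y w)%:E = 0.
Proof.
have iY : P.-integrable setT (EFin \o Y).
  by apply: integrable_sqr => //; apply: le_lt_trans gaussian_second_moment _; exact: ltry.
have mp : measurable_fun setT (fun x : R => (Num.max x 0)%:E).
  by apply/measurable_EFinP; apply: measurable_maxr.
have mn : measurable_fun setT (fun x : R => (Num.max (- x) 0)%:E).
  by apply/measurable_EFinP; apply: measurable_maxr.
have p0 (x : R) : 0 <= (Num.max x 0)%:E by rewrite lee_fin le_max lexx orbT.
have pE : \int[P]_w ((EFin \o Y)^\+ w) = \int[P]_w (Num.max (Y w) 0)%:E.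
  by apply: eq_integral => w _; rewrite funeposE /= EFin_max.
have nE : \int[P]_w ((EFin \o Y)^\- w) = \int[P]_w (Num.max (- Y w) 0)%:E.
  by apply: eq_integral => w _; rewrite funenegE /= EFin_max.
have eqpn : \int[P]_w ((EFin \o Y)^\+ w) = \int[P]_w ((EFin \o Y)^\- w).
  rewrite pE nE (ge0_law mp p0) (ge0_law mn (fun x => p0 (- x)%R)).
  exact: normal_symmetric.
rewrite integralE eqpn subee //.
exact: integrable_neg_fin_num.
Qed.

End gaussian_law.

(** The joint law of independent variables is the product of the marginals, so
    that expectations of products factor by Fubini's theorem. *)
Section independent.
Variables X Y : T -> R.
Hypothesis mX : measurable_fun setT X.
Hypothesis mY : measurable_fun setT Y.
Hypothesis indep : forall A D, measurable A -> measurable D ->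
  P (X @^-1` A `&` Y @^-1` D) = P (X @^-1` A) * P (Y @^-1` D).

Let X' : {mfun T >-> R} := HB.pack X (isMeasurableFun.Build _ _ _ _ X mX).
Let Y' : {mfun T >-> R} := HB.pack Y (isMeasurableFun.Build _ _ _ _ Y mY).
Let mXY : measurable_fun setT (fun w => (X w, Y w)).
Proof. exact: measurable_fun_pair. Qed.
Let XY' : {mfun T >-> (R * R)%type} :=
  HB.pack (fun w => (X w, Y w)) (isMeasurableFun.Build _ _ _ _ _ mXY).

Let joint_law S : measurable S ->
  (distribution P X' \x distribution P Y') S = distribution P XY' S.
Proof.
by apply: product_measure_unique => A D mA mD; exact: indep.
Qed.

Lemma indep_ge0_integralM (f g : R -> \bar R) :
  measurable_fun setT f -> measurable_fun setT g ->
  (forall x, 0 <= f x) -> (forall x, 0 <= g x) ->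
  \int[P]_w (f (X w) * g (Y w)) = \int[P]_w f (X w) * \int[P]_w g (Y w).
Proof.
move=> mf mg f0 g0.
pose h (p : R * R) := f p.1 * g p.2.
have mh : measurable_fun setT h.
  by apply: emeasurable_funM; apply: measurableT_comp.
have h0 p : 0 <= h p by exact: mule_ge0.
have := @ge0_integral_distribution _ _ _ _ _ P XY' h mh h0.
rewrite /comp /= => <-.
transitivity (\int[distribution P X' \x distribution P Y']_p h p).
  by apply: eq_measure_integral => S mS _; exact/esym/joint_law.
rewrite fubini_tonelli1 // /fubini_F /h /=.
under eq_integral do rewrite ge0_integralZl //.
rewrite ge0_integralZr //; last by apply: integral_ge0.
by rewrite !ge0_integral_distribution.
Qed.

Lemma indep_centred : P.-integrable setT (EFin \o X) ->
  P.-integrable setT (EFin \o Y) -> \int[P]_w (Y w)%:E = 0 ->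
  P.-integrable setT (fun w => (X w * Y w)%:E) /\ \int[P]_w (X w * Y w)%:E = 0.
Proof.
move=> iX iY Y0.
have mM : measurable_fun setT (fun w => (X w * Y w)%:E).
  by apply/measurable_EFinP; exact: measurable_funM.
have iXY : P.-integrable setT (fun w => (X w * Y w)%:E).
  apply/integrableP; split => //.
  have -> : \int[P]_w `|(X w * Y w)%:E| = \int[P]_w (`|(X w)%:E| * `|(Y w)%:E|).
    by apply: eq_integral => w _; rewrite EFinM abseM.
  rewrite (indep_ge0_integralM (f := fun x => `|x%:E|) (g := fun x => `|x%:E|)) //.
  - move/integrableP: iX => [_]; move/integrableP: iY => [_] /=.
    by move=> h1 h2; apply: lte_mul_pinfty => //; [exact: integral_ge0|rewrite ge0_fin_numE //; exact: integral_ge0].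
  - by apply: measurableT_comp => //; exact: measurable_EFin.
  - by apply: measurableT_comp => //; exact: measurable_EFin.
split=> //.
pose h (p : R * R) := (p.1 * p.2)%:E.
have mh : measurable_fun setT h.
  by apply/measurable_EFinP; apply: measurable_funM.
have := @integral_distribution _ _ _ _ _ P XY' h mh iXY.
rewrite /comp /= => <-.
transitivity (\int[distribution P X' \x distribution P Y']_p h p).
  by apply: eq_measure_integral => S mS _; exact/esym/joint_law.
have ih : (distribution P X' \x distribution P Y').-integrable setT h.
  apply/integrableP; split => //.
  have -> : \int[distribution P X' \x distribution P Y']_p `|h p| =
      \int[distribution P XY']_p `|h p|.
    by apply: eq_measure_integral => S mS _; exact: joint_law.
  rewrite ge0_integral_distribution //; last by apply: measurableT_comp.
  by move/integrableP: iXY => [].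
rewrite -integral12_prod_meas1 // /fubini_F /h /=.
rewrite (eq_integral (cst 0)) ?integral0 // => x _.
under eq_integral do rewrite EFinM.
have iY' : (distribution P Y').-integrable setT (EFin : R -> \bar R).
  by apply: integrable_pushforward.
rewrite integralZl // (integral_distribution (f := EFin)) //.
by rewrite /comp /= Y0 mule0.
Qed.

End independent.

End random_variables.

(** * The natural filtration and Brownian increments *)

Section filtration.
Context {d : measure_display} {Omega : measurableType d} {R : realType}.
Context {l : nat}.
Variable B : R -> Omega -> 'cV[R]_l.

Definition past_events (t : R) : set (set Omega) :=
  \bigcup_(s in `[0, t]%classic) preimage_set_system setT (B s) measurable.

(** Omega with the events known at time [t]; closure properties of adapted
    variables are those of measurable functions on it. *)
Definition at_time (t : R) := g_sigma_algebraType (past_events t).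

Lemma measurable_wrtP m n t (X : Omega -> 'M[R]_(m, n)) :
  measurable_wrt (natural_filtration B t) X <->
  measurable_fun setT (X : at_time t -> 'M[R]_(m, n)).
Proof.
split=> [mX _ A mA|mX A mA]; first by rewrite setTI; exact: mX.
by have := mX measurableT A mA; rewrite setTI.
Qed.

Lemma past_events_mono s t : s <= t -> natural_filtration B s `<=` natural_filtration B t.
Proof.
move=> st; apply: sub_sigma_algebra2 => A [r /=]; rewrite in_itv /= => /andP[r0 rs] hA.
by exists r => //=; rewrite in_itv /= r0 (le_trans rs).
Qed.

Lemma at_time_mono d' (T' : measurableType d') s t (X : Omega -> T') : s <= t ->
  measurable_fun setT (X : at_time s -> T') -> measurable_fun setT (X : at_time t -> T').
Proof.
move=> st mX _ A mA; rewrite setTI; apply: (past_events_mono st).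
by have := mX measurableT A mA; rewrite setTI.
Qed.

Lemma adapted_self s t : 0 <= s -> s <= t ->
  measurable_fun setT (B s : at_time t -> 'cV[R]_l).
Proof.
move=> s0 st _ A mA; apply: sub_sigma_algebra; exists s.
  by rewrite /= in_itv /= s0.
by exists A.
Qed.

Hypothesis mB : forall t, 0 <= t -> measurable_fun setT (B t).

Lemma past_events_measurable t : natural_filtration B t `<=` measurable.
Proof.
apply: smallest_sub; first exact: sigma_algebra_measurable.
move=> A [r /=]; rewrite in_itv /= => /andP[r0 _] [C mC <-].
exact: mB.
Qed.

Lemma at_time_measurable d' (T' : measurableType d') t (X : Omega -> T') :
  measurable_fun setT (X : at_time t -> T') -> measurable_fun setT X.
Proof.
move=> mX _ A mA; rewrite setTI; apply: (@past_events_measurable t).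
by have := mX measurableT A mA; rewrite setTI.
Qed.

End filtration.

Section increments.
Context {d : measure_display} {Omega : measurableType d} {R : realType}.
Variable P : probability Omega R.
Context {l : nat}.
Variable B : R -> Omega -> 'cV[R]_l.
Hypothesis bmB : is_brownian_motion P B.

Lemma incr_measurable s t k : 0 <= s -> 0 <= t ->
  measurable_fun setT (fun w => (B t w - B s w) k ord0).
Proof.
move=> s0 t0; have : measurable_fun setT (fun w => B t w - B s w).
  by apply: measurable_mxB => //; exact: (bm_measurable bmB).
by move=> /measurable_mxP; exact.
Qed.

Lemma incr_law s t k : 0 <= s -> s < t -> forall D, measurable D ->
  P ((fun w => (B t w - B s w) k ord0) @^-1` D) = normal_prob 0 (Num.sqrt (t - s)) D.
Proof.
move=> s0 st D mD.
pose E (i : 'I_l) := if i == k then D else setT.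
have mE i : measurable (E i) by rewrite /E; case: ifP.
have := bm_gauss bmB s0 st mE.
have -> : [set w | forall i, E i ((B t w - B s w)%R i ord0)] =
    (fun w => (B t w - B s w) k ord0) @^-1` D.
  apply/seteqP; split=> w /=; first by move=> /(_ k); rewrite /E eqxx.
  by move=> h i; rewrite /E; case: eqP => [->|].
move=> ->; rewrite (bigD1 k) //= /E eqxx big1 ?mule1 // => i /negPf ->.
exact: probability_setT.
Qed.

Lemma incr_second_moment s t k : 0 <= s -> s <= t ->
  (\int[P]_w (((B t w - B s w) k ord0) ^+ 2)%:E <= (8 * (t - s))%:E)%E.
Proof.
move=> s0; rewrite le_eqVlt => /predU1P[->|st].
  under eq_integral do rewrite subrr mxE expr0n.
  by rewrite integral0 subrr mulr0.
have sq0 : 0 < Num.sqrt (t - s) by rewrite sqrtr_gt0 subr_gt0.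
have := gaussian_second_moment sq0 (incr_measurable k s0 (le_trans s0 (ltW st)))
  (incr_law k s0 st).
by rewrite sqr_sqrtr // subr_ge0 ltW.
Qed.

Lemma incr_integrable s t k : 0 <= s -> s <= t ->
  P.-integrable setT (fun w => ((B t w - B s w) k ord0)%:E).
Proof.
move=> s0 st; apply: integrable_sqr.
  by apply: incr_measurable => //; exact: le_trans st.
by apply: le_lt_trans (incr_second_moment k s0 st) _; exact: ltry.
Qed.

Lemma incr_centred s t k : 0 <= s -> s <= t ->
  (\int[P]_w ((B t w - B s w) k ord0)%:E = 0)%E.
Proof.
move=> s0; rewrite le_eqVlt => /predU1P[->|st].
  by under eq_integral do rewrite subrr mxE; rewrite integral0.
have sq0 : 0 < Num.sqrt (t - s) by rewrite sqrtr_gt0 subr_gt0.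
exact: (gaussian_centred sq0 (incr_measurable k s0 (le_trans s0 (ltW st)))
  (incr_law k s0 st)).
Qed.

Lemma incr_indep s t k (X : Omega -> R) : 0 <= s -> s <= t ->
  measurable_fun setT (X : at_time B s -> R) ->
  forall A D, measurable A -> measurable D ->
  P (X @^-1` A `&` (fun w => (B t w - B s w) k ord0) @^-1` D) =
  (P (X @^-1` A) * P ((fun w => (B t w - B s w)%R k ord0) @^-1` D))%E.
Proof.
move=> s0 st mX A D mA mD.
have FA : natural_filtration B s (X @^-1` A).
  by have := mX measurableT A mA; rewrite setTI.
have mD' : measurable ((fun v : 'cV[R]_l => v k ord0) @^-1` D).
  by have := @measurable_coord R l 1 k ord0 measurableT D mD; rewrite setTI.
exact: (bm_indep bmB s0 st FA mD').
Qed.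

(** Multiplication by an increment independent of the past scales the second
    moment and destroys the mean. *)
Lemma incr_mul_second_moment s t k (X : Omega -> R) : 0 <= s -> s <= t ->
  measurable_fun setT (X : at_time B s -> R) ->
  (\int[P]_w ((X w * (B t w - B s w) k ord0) ^+ 2)%:E <=
   (8 * (t - s))%:E * \int[P]_w (X w ^+ 2)%:E)%E.
Proof.
move=> s0 st mX.
have msq : measurable_fun setT (fun x : R => (x ^+ 2)%:E).
  by apply/measurable_EFinP; exact: measurable_funX.
have sq0 (x : R) : (0 <= (x ^+ 2)%:E)%E by rewrite lee_fin sqr_ge0.
under eq_integral do rewrite exprMn EFinM.
rewrite (indep_ge0_integralM (at_time_measurable (bm_measurable bmB) mX)
  (incr_measurable k s0 (le_trans s0 st)) (incr_indep k s0 st mX) msq msq sq0 sq0).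
rewrite muleC; apply: lee_wpmul2r; last exact: incr_second_moment.
exact: integral_ge0.
Qed.

Lemma incr_mul_centred s t k (X : Omega -> R) : 0 <= s -> s <= t ->
  measurable_fun setT (X : at_time B s -> R) ->
  P.-integrable setT (EFin \o X) ->
  P.-integrable setT (fun w => (X w * (B t w - B s w) k ord0)%:E) /\
  (\int[P]_w (X w * (B t w - B s w) k ord0)%:E = 0)%E.
Proof.
move=> s0 st mX iX.
exact: (indep_centred (at_time_measurable (bm_measurable bmB) mX)
  (incr_measurable k s0 (le_trans s0 st)) (incr_indep k s0 st mX) iX
  (incr_integrable k s0 st) (incr_centred k s0 st)).
Qed.

End increments.

Section square_integrable.
Context {d : measure_display} {T : measurableType d} {R : realType}.
Variable P : probability T R.
Local Open Scope ereal_scope.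

Definition sqint (X : T -> R) :=
  measurable_fun setT X /\ \int[P]_w (X w ^+ 2)%:E < +oo.

Let msqr (X : T -> R) : measurable_fun setT X ->
  measurable_fun setT (fun w => (X w ^+ 2)%:E).
Proof. by move=> mX; apply/measurable_EFinP; exact: measurable_funX. Qed.

Let sqr0 (X : T -> R) w : 0 <= (X w ^+ 2)%:E.
Proof. by rewrite lee_fin sqr_ge0. Qed.

Lemma sqint_integrableM X Y : sqint X -> sqint Y ->
  P.-integrable setT (fun w => (X w * Y w)%:E).
Proof.
move=> [mX X2] [mY Y2]; apply/integrableP; split.
  by apply/measurable_EFinP; exact: measurable_funM.
apply: (@le_lt_trans _ _ (\int[P]_w ((X w ^+ 2)%:E + (Y w ^+ 2)%:E))).
  apply: ge0_le_integral => //.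
  - by apply: measurableT_comp => //; apply/measurable_EFinP; exact: measurable_funM.
  - by apply: emeasurable_funD; exact: msqr.
  move=> w _ /=; rewrite -EFinD lee_fin.
  have := sqr_ge0 (X w - Y w)%R; have := sqr_ge0 (X w + Y w)%R.
  rewrite sqrrB sqrrD => h1 h2.
  have := sqr_ge0 (X w); have := sqr_ge0 (Y w).
  by rewrite ler_norml => *; apply/andP; split; lra.
rewrite ge0_integralD //; try exact: msqr.
exact: lte_add_pinfty.
Qed.

Lemma sqint_sum (I : Type) (s : seq I) (X : I -> T -> R) :
  (forall i, sqint (X i)) -> sqint (fun w => \sum_(i <- s) X i w)%R.
Proof.
move=> hX; split; first by apply: measurable_sum => i; exact: (hX i).1.
elim: s => [|i s ih].
  by under eq_integral do rewrite big_nil expr0n; rewrite integral0.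
have mS : measurable_fun setT (fun w => \sum_(i <- s) X i w)%R.
  by apply: measurable_sum => j; exact: (hX j).1.
under eq_integral do rewrite big_cons.
apply: (@le_lt_trans _ _ (\int[P]_w (2%:E * (X i w ^+ 2)%:E +
    2%:E * ((\sum_(i <- s) X i w) ^+ 2)%:E))).
  apply: ge0_le_integral => //.
  - by move=> w _; rewrite lee_fin sqr_ge0.
  - by apply: msqr; apply: measurable_funD => //; exact: (hX i).1.
  - apply: emeasurable_funD; apply/measurable_EFinP; apply: measurable_funM => //.
      by apply: measurable_funX; exact: (hX i).1.
    exact: measurable_funX.
  move=> w _; rewrite -!EFinM -EFinD lee_fin.
  by set a := X i w; set b := (\sum_(j <- s) _)%R; have := sqr_ge0 (a - b)%R; rewrite sqrrB sqrrD; lra.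
have m2 (Y : T -> R) : measurable_fun setT Y ->
    measurable_fun setT (fun w => 2%:E * (Y w ^+ 2)%:E).
  by move=> mY; apply/measurable_EFinP; apply: measurable_funM => //; exact: measurable_funX.
rewrite ge0_integralD //; first last.
- exact: m2.
- by move=> w _; apply: mule_ge0; rewrite lee_fin ?sqr_ge0.
- by apply: m2; exact: (hX i).1.
- by move=> w _; apply: mule_ge0; rewrite lee_fin ?sqr_ge0.
have e2 (Y : T -> R) : measurable_fun setT Y ->
    \int[P]_w (2%:E * (Y w ^+ 2)%:E) = 2%:E * \int[P]_w (Y w ^+ 2)%:E.
  by move=> mY; rewrite ge0_integralZl_EFin //; exact: msqr.
rewrite !e2 //; last exact: (hX i).1.
by apply: lte_add_pinfty; apply: lte_mul_pinfty => //; exact: (hX i).2.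
Qed.

(** Pythagoras for a sum of two orthogonal variables. *)
Lemma sqint_orthogonalD X Y : sqint X -> sqint Y ->
  \int[P]_w (X w * Y w)%:E = 0 ->
  \int[P]_w ((X w + Y w) ^+ 2)%:E =
  \int[P]_w (X w ^+ 2)%:E + \int[P]_w (Y w ^+ 2)%:E.
Proof.
move=> hX hY XY0.
have iX : P.-integrable setT (fun w => (X w ^+ 2)%:E).
  by under eq_fun do rewrite expr2; exact: sqint_integrableM.
have iY : P.-integrable setT (fun w => (Y w ^+ 2)%:E).
  by under eq_fun do rewrite expr2; exact: sqint_integrableM.
have iXY := sqint_integrableM hX hY.
have -> : \int[P]_w ((X w + Y w) ^+ 2)%:E =
    \int[P]_w ((X w ^+ 2)%:E + (Y w ^+ 2)%:E + 2%:E * (X w * Y w)%:E).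
  apply: eq_integral => w _; rewrite -EFinM -!EFinD; congr EFin.
  by rewrite sqrrD mulr2n; ring.
rewrite integralD //; first last.
- exact: integrableZl.
- exact: integrableD.
by rewrite integralZl // XY0 mule0 adde0 integralD.
Qed.

End square_integrable.

(** * The Ito estimate for step integrands *)

Lemma intsq_coord d (T : measurableType d) (R : realType)
    (mu : {measure set T -> \bar R}) (D : set T) m n (X : T -> 'M[R]_(m, n)) :
  measurable D -> measurable_fun D X ->
  intsq mu D X =
  (\sum_(i < m) \sum_(j < n) \int[mu]_(x in D) (X x i j ^+ 2)%:E)%E.
Proof.
move=> mD /(measurable_mxP _ mD) mX; rewrite /intsq.
have mXij i j : measurable_fun D (fun x => (X x i j ^+ 2)%:E).
  by apply/measurable_EFinP; apply: measurable_funX; exact: mX.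
under eq_integral do rewrite sqnormE -sumEFin.
rewrite ge0_integral_sum //.
- apply: eq_bigr => i _; under eq_integral do rewrite -sumEFin.
  rewrite ge0_integral_sum // => j x _; by rewrite lee_fin sqr_ge0.
- move=> i; under eq_fun do rewrite -sumEFin.
  by apply: emeasurable_sum => j.
- by move=> i x _; rewrite lee_fin sumr_ge0 // => j _; rewrite sqr_ge0.
Qed.

Section grid.
Context {d : measure_display} {Omega : measurableType d} {R : realType}.
Variable P : probability Omega R.
Context {l : nat}.
Variable B : R -> Omega -> 'cV[R]_l.
Hypothesis bmB : is_brownian_motion P B.

Let incr r (j : nat) (k : 'I_l) (w : Omega) : R :=
  (B (r j.+1) w - B (r j) w) k ord0.

(** The increments over successive cells are orthogonal to the past, so the
    second moments of the cells add up. *)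
Lemma grid_sqint (r : nat -> R) (c : nat -> 'I_l -> Omega -> R) (N : nat) :
  (forall j, (j < N)%N -> 0 <= r j /\ r j <= r j.+1) ->
  (forall j k, (j < N)%N -> measurable_fun setT (c j k : at_time B (r j) -> R)) ->
  (forall j k, (j < N)%N -> sqint P (c j k)) ->
  let Y w := \sum_(j < N) \sum_k c j k w * incr r j k w in
  [/\ measurable_fun setT (Y : at_time B (r N) -> R), sqint P Y &
   (\int[P]_w (Y w ^+ 2)%:E <= \sum_(j < N) ((8 * l%:R * (r j.+1 - r j))%:E *
      \sum_k \int[P]_w (c j k w ^+ 2)%:E))%E].
Proof.
elim: N => [|N ih] hr mc hc /=.
  split.
  - by under eq_fun do rewrite big_ord0; exact: measurable_cst.
  - split; first by under eq_fun do rewrite big_ord0; exact: measurable_cst.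
    by under eq_integral do rewrite big_ord0 expr0n; rewrite integral0.
  - by under eq_integral do rewrite big_ord0 expr0n; rewrite integral0 big_ord0.
have [|j k jN|j k jN|] := ih; do ?[by move=> j jN; apply: hr; exact: leqW|
  by apply: mc; exact: leqW|by apply: hc; exact: leqW|].
set Y := (fun w => \sum_(j < N) _) => mY hY Yle.
have [r0 rS] := hr N (leqnn _).
pose Z w := \sum_k c N k w * incr r N k w.
have minc k : measurable_fun setT (incr r N k : at_time B (r N.+1) -> R).
  have : measurable_fun setT
      ((fun w => B (r N.+1) w - B (r N) w) : at_time B (r N.+1) -> 'cV[R]_l).
    by apply: measurable_mxB => //; apply: adapted_self => //; exact: le_trans rS.
  by move=> /measurable_mxP; exact.
have hcB k : sqint P (fun w => c N k w * incr r N k w).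
  split.
    apply: measurable_funM; first exact: (hc N k (leqnn _)).1.
    by apply: (incr_measurable bmB) => //; exact: le_trans rS.
  apply: le_lt_trans (incr_mul_second_moment bmB k r0 rS (mc N k (leqnn _))) _.
  by apply: lte_mul_pinfty => //; [rewrite lee_fin mulr_ge0 // subr_ge0|exact: (hc N k (leqnn _)).2].
have hZ : sqint P Z by exact: sqint_sum.
have YZ : (fun w => \sum_(j < N.+1) \sum_k c j k w * incr r j k w) =
    (fun w => Y w + Z w).
  by apply/funext => w; rewrite big_ord_recr.
rewrite YZ; split.
- apply: measurable_funD; first exact: at_time_mono rS mY.
  apply: measurable_sum => k; apply: measurable_funM => //.
  by apply: at_time_mono rS _; exact: mc.
- split; first by apply: measurable_funD; [exact: hY.1|exact: hZ.1].
  have := @sqint_sum _ _ _ P bool [:: true; false] (fun b => if b then Y else Z).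
  move=> /(_ ltac:(by case))[_]; under eq_integral do rewrite big_cons big_seq1.
  by [].
have YZ0 : (\int[P]_w (Y w * Z w)%:E = 0)%E.
  have YcB k : P.-integrable setT (fun w => (Y w * c N k w * incr r N k w)%:E) /\
      (\int[P]_w (Y w * c N k w * incr r N k w)%:E = 0)%E.
    apply: (incr_mul_centred bmB k r0 rS (X := fun w => Y w * c N k w)).
      by apply: measurable_funM => //; exact: mc.
    by apply: sqint_integrableM => //; exact: hc.
  transitivity (\int[P]_w (\sum_k (Y w * c N k w * incr r N k w)%:E))%E.
    apply: eq_integral => w _; rewrite sumEFin mulr_sumr; congr EFin.
    by apply: eq_bigr => k _; rewrite mulrA.
  rewrite integral_sum //; last by move=> k; exact: (YcB k).1.
  by rewrite big1 // => k _; exact: (YcB k).2.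
under eq_integral do rewrite big_ord_recr /= -/(Y _) -/(Z _).
rewrite (sqint_orthogonalD hY hZ YZ0) big_ord_recr /=; apply: leeD => //.
apply: (@le_trans _ _ (\int[P]_w (l%:R%:E * \sum_k ((c N k w * incr r N k w) ^+ 2)%:E))%E).
  apply: ae_ge0_le_integral_any => //.
  - by move=> w _; rewrite lee_fin sqr_ge0.
  - move=> w _; apply: mule_ge0; first by rewrite lee_fin.
    by apply: sume_ge0 => k _; rewrite lee_fin sqr_ge0.
  - by apply: aeW => w _; rewrite sumEFin -EFinM lee_fin sqr_sum_le.
have msqcB k : measurable_fun setT (fun w => ((c N k w * incr r N k w) ^+ 2)%:E).
  by apply/measurable_EFinP; apply: measurable_funX; exact: (hcB k).1.
rewrite ge0_integralZl_EFin //; last 2 first.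
- by move=> w _; apply: sume_ge0 => k _; rewrite lee_fin sqr_ge0.
- exact: emeasurable_sum.
rewrite ge0_integral_sum //; last by move=> k w _; rewrite lee_fin sqr_ge0.
rewrite -mulrA mulrCA EFinM -muleA; apply: lee_wpmul2l; first by rewrite lee_fin.
rewrite ge0_sume_distrr; last first.
  by move=> k _; apply: integral_ge0 => w _; rewrite lee_fin sqr_ge0.
apply: lee_sum => k _.
exact: (incr_mul_second_moment bmB k r0 rS (mc N k (leqnn _))).
Qed.

Lemma grid_isometry n (r : nat -> R) (c : nat -> Omega -> 'M[R]_(n, l)) (N : nat) :
  (forall j, (j < N)%N -> 0 <= r j /\ r j <= r j.+1) ->
  (forall j, (j < N)%N -> measurable_fun setT (c j : at_time B (r j) -> 'M[R]_(n, l))) ->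
  (forall j, (j < N)%N -> (intsq P setT (c j) < +oo)%E) ->
  (intsq P setT (fun w => \sum_(j < N) c j w *m (B (r j.+1) w - B (r j) w))%R <=
   \sum_(j < N) (8 * l%:R * (r j.+1 - r j))%:E * intsq P setT (c j))%E.
Proof.
move=> hr mc hc.
have mc' j : (j < N)%N -> measurable_fun setT (c j).
  by move=> jN; exact: (at_time_measurable (bm_measurable bmB) (mc j jN)).
have hij j (i : 'I_n) (k : 'I_l) : (j < N)%N -> sqint P (fun w => c j w i k).
  move=> jN; split.
    by move/measurable_mxP: (mc' j jN); exact.
  apply: le_lt_trans (hc j jN); rewrite intsq_coord //; last exact: mc'.
  have nn i' k' : (0 <= \int[P]_x (c j x i' k' ^+ 2)%:E)%E.
    by apply: integral_ge0 => w _; rewrite lee_fin sqr_ge0.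
  rewrite (bigD1 i) //= (bigD1 k) //= -addeA leeDl // adde_ge0 //.
    by apply: sume_ge0.
  by apply: sume_ge0 => *; apply: sume_ge0.
have key i := grid_sqint (c := fun j k w => c j w i k) hr
  (fun j k jN => (measurable_mxP _ measurableT).1 (mc j jN) i k)
  (fun j k jN => hij j i k jN).
have mS : measurable_fun setT (fun w => \sum_(j < N) c j w *m (B (r j.+1) w - B (r j) w)).
  apply/measurable_mxP => // i k.
  have -> : (fun w => (\sum_(j < N) c j w *m (B (r j.+1) w - B (r j) w)) i k) =
      (fun w => \sum_(j < N) \sum_k c j w i k * incr r j k w).
    apply/funext => w; rewrite summxE; apply: eq_bigr => j _; rewrite mxE.
    by apply: eq_bigr => q _; rewrite ord1.
  by have [_ []] := key i.
rewrite intsq_coord //.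
under eq_bigr do rewrite big_ord1.
apply: (@le_trans _ _ (\sum_(i < n) \sum_(j < N) ((8 * l%:R * (r j.+1 - r j))%:E *
      \sum_k \int[P]_w (c j w i k ^+ 2)%:E))%E).
  apply: lee_sum => i _; have [_ _] := key i; apply: le_trans.
  rewrite le_eqVlt; apply/orP; left; apply/eqP; apply: eq_integral => w _.
  rewrite summxE; congr (_ ^+ 2)%:E; apply: eq_bigr => j _; rewrite mxE.
  by apply: eq_bigr => q _.
rewrite exchange_big /=; apply: lee_sum => j _.
rewrite intsq_coord //; last exact: mc'.
rewrite ge0_sume_distrr // => i _; apply: sume_ge0 => k _.
by apply: integral_ge0 => w _; rewrite lee_fin sqr_ge0.
Qed.

End grid.

Lemma lebesgue_measure_itvco {R : realType} (a b : R) : a <= b ->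
  lebesgue_measure `[a, b[%classic = (b - a)%:E.
Proof.
rewrite lebesgue_measure_itv /= lte_fin => ab; case: ltP => // ba.
by rewrite (le_anti (introT andP (conj ab ba))) subrr.
Qed.

(** A common refinement: on the grid [x0 :: q] every interval whose end points
    are grid points is a union of cells. *)
Section refinement.
Context {R : realType}.
Variables (x0 : R) (q : seq R).
Hypothesis srt : sorted <=%R (x0 :: q).
Local Notation r := (nth 0 (x0 :: q)).
Local Notation N := (size q).

Lemma refine_mono j k : (j <= k)%N -> (k <= N)%N -> r j <= r k.
Proof.
move=> jk kN; apply: (sorted_leq_nth le_trans lexx) => //; rewrite inE /= ltnS //.
exact: leq_trans kN.
Qed.

Lemma refine_telescope (V : zmodType) (h : R -> V) b : b \in x0 :: q ->
  h b - h x0 = \sum_(j < N) (if r j < b then h (r j.+1) - h (r j) else 0).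
Proof.
move=> bq; pose k := index b (x0 :: q).
have kN : (k <= N)%N by rewrite -ltnS [X in (_ < X)%N](_ : _ = size (x0 :: q)) // index_mem.
have rk : r k = b by exact: nth_index.
transitivity (\sum_(0 <= j < N) (if (j < k)%N then h (r j.+1) - h (r j) else 0)).
  rewrite [RHS](big_cat_nat (leq0n k) kN) /=.
  have -> : \sum_(0 <= j < k) (if (j < k)%N then h (r j.+1) - h (r j) else 0) =
      h b - h x0.
    rewrite -[in RHS]rk -[in X in _ - h X]/(r 0%N) -(telescope_sumr (fun j => h (r j))) //.
    by apply: eq_big_nat => j /andP[_ ->].
  rewrite big_nat_cond big1 ?addr0 // => j; rewrite andbT => /andP[kj _].
  by rewrite ltnNge kj.
rewrite big_mkord; apply: eq_bigr => j _; congr (if _ then _ else _).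
have [jk|kj] := ltnP j k.
  apply/esym; rewrite lt_neqAle -{2}rk refine_mono // ?andbT; last exact: ltnW.
  apply/eqP => e; have := before_find (a := pred1 b) 0 jk.
  by rewrite /= e eqxx.
by apply/esym/negbTE; rewrite -leNgt -rk refine_mono // ltnW.
Qed.

Lemma refine_cell (V : zmodType) (h : R -> V) a b : a <= b ->
  a \in x0 :: q -> b \in x0 :: q ->
  h b - h a = \sum_(j < N) (if (a <= r j) && (r j < b) then h (r j.+1) - h (r j) else 0).
Proof.
move=> ab aq bq; rewrite -(subrKA (h x0)) -(opprB (h a)) !refine_telescope //.
rewrite -sumrB; apply: eq_bigr => j _; have [ra|ar] := ltP (r j) a.
  by rewrite (lt_le_trans ra ab) subrr.
by rewrite subr0.
Qed.

(** Grid points are not crossed inside a cell. *)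
Lemma refine_le a j s : a \in x0 :: q -> (j < N)%N -> r j <= s -> s < r j.+1 ->
  (a <= s) = (a <= r j).
Proof.
move=> aq jN js sj; apply/idP/idP => [as_|]; last by move=> h; exact: le_trans js.
rewrite leNgt; apply/negP => ja.
have kN : (index a (x0 :: q) <= N)%N.
  by rewrite -ltnS [X in (_ < X)%N](_ : _ = size (x0 :: q)) // index_mem.
have rk : r (index a (x0 :: q)) = a by exact: nth_index.
have jk : (j < index a (x0 :: q))%N.
  rewrite ltnNge; apply/negP => kj; move: ja; rewrite ltNge => /negP; apply.
  by rewrite -[in leLHS]rk refine_mono // ltnW.
have := refine_mono jk kN; rewrite rk leNgt => /negP; apply.
exact: le_lt_trans sj.
Qed.

Lemma refine_sum_le (G : R -> \bar R) : (forall s, 0 <= G s)%E ->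
  (forall j s, (j < N)%N -> r j <= s -> s < r j.+1 -> G s = G (r j)) ->
  (\sum_(j < N) (r j.+1 - r j)%:E * G (r j) <=
   \int[lebesgue_measure]_(s in `[x0, r N]) G s)%E.
Proof.
move=> G0 Gc.
pose H M s := (\sum_(j < M) (\1_(`[r j, r j.+1[%classic) s)%:E * G (r j))%E.
have HE M s : (M <= N)%N -> H M s = if (x0 <= s) && (s < r M) then G s else 0%E.
  elim: M => [|M ih] MN.
    by rewrite /H big_ord0 /= leNgt; case: ltP.
  rewrite /H big_ord_recr /= -/(H M s) ih ?(ltnW MN) // indicE mem_setE in_itv /=.
  have rM : r M <= r M.+1 by apply: refine_mono.
  have x0M : x0 <= r M by apply: (@refine_mono 0%N) => //; exact: ltnW.
  have [sM|Ms] := ltP s (r M).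
    have sM' : s < q`_M := lt_le_trans sM rM.
    by rewrite sM' !andbT mul0e adde0.
  rewrite andbF (le_trans x0M Ms) /= add0e.
  have [sM1|sM1] := ltP s q`_M; last by rewrite mul0e.
  by rewrite mul1e -(Gc M s MN Ms sM1).
have -> : (\sum_(j < N) (r j.+1 - r j)%:E * G (r j) =
    \int[lebesgue_measure]_(s in `[x0, r N]) H N s)%E.
  have I0 j s : (0 <= (\1_(`[r j, r j.+1[%classic) s : R)%:E)%E by rewrite lee_fin.
  have mI D j : measurable_fun D (fun s => (\1_(`[r j, r j.+1[%classic) s : R)%:E).
    by apply/measurable_EFinP; exact: measurable_indic.
  rewrite ge0_integral_sum; first last.
  - by move=> j s _; apply: mule_ge0.
  - by move=> j; apply: emeasurable_funM => //; exact: mI.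
  - exact: measurable_itv.
  apply: eq_bigr => -[j jN] _; rewrite [Ordinal _ : nat]/=.
  rewrite ge0_integralZr; [|exact: measurable_itv|exact: mI|by move=> *; exact: I0|exact: G0].
  have jS : r j <= r j.+1 by exact: refine_mono.
  rewrite integral_indic // setIidl; last first.
    move=> s /=; rewrite !in_itv /= => /andP[js sj].
    rewrite (le_trans (refine_mono (leq0n j) (ltnW jN)) js) /=.
    by apply: (le_trans (ltW sj)); exact: (@refine_mono j.+1 N jN (leqnn N)).
  by congr (_ * _)%E; exact/esym/lebesgue_measure_itvco.
apply: ae_ge0_le_integral_any => //.
- by move=> s _; apply: sume_ge0 => j _; rewrite mule_ge0 // lee_fin.
by apply: aeW => s _; rewrite HE //; case: ifP.
Qed.

End refinement.

(** * Mean square norms of processes and the Ito estimate *)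

Lemma ae_imply d (T : measurableType d) (R : realType)
    (mu : {measure set T -> \bar R}) (Q W : T -> Prop) :
  (forall x, Q x -> W x) -> {ae mu, forall x, Q x} -> {ae mu, forall x, W x}.
Proof. by move=> QW; apply: filterS. Qed.

Lemma ge0_subset_integral_any d (T : measurableType d) (R : realType)
    (mu : {measure set T -> \bar R}) (A D : set T) (f : T -> \bar R) :
  (forall x, 0 <= f x)%E -> A `<=` D ->
  (\int[mu]_(x in A) f x <= \int[mu]_(x in D) f x)%E.
Proof.
move=> f0 AD; rewrite (integral_mkcond A) (integral_mkcond D).
apply: ae_ge0_le_integral_any.
- by move=> x _; rewrite patchE; case: ifP.
- by move=> x _; rewrite patchE; case: ifP.
apply: aeW => x _; rewrite !patchE; case: ifPn => [/set_mem /AD h|_].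
  by rewrite mem_set.
by case: ifP.
Qed.

Section intsq_closure.
Context {d : measure_display} {T : measurableType d} {R : realType}.
Variable mu : {measure set T -> \bar R}.
Variable D : set T.
Hypothesis mD : measurable D.

Lemma intsqZ m n (c : R) (X : T -> 'M[R]_(m, n)) : measurable_fun D X ->
  intsq mu D (fun x => c *: X x) = ((c ^+ 2)%:E * intsq mu D X)%E.
Proof.
move=> mX; rewrite /intsq; under eq_integral do rewrite sqnormZ EFinM.
rewrite ge0_integralZl_EFin //.
- by move=> x _; rewrite lee_fin sqnorm_ge0.
- exact: measurable_EFin_sqnorm.
- exact: sqr_ge0.
Qed.

Lemma intsqN m n (X : T -> 'M[R]_(m, n)) :
  intsq mu D (fun x => - X x) = intsq mu D X.
Proof. by apply: eq_integral => x _; rewrite sqnormN. Qed.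

Lemma intsq0 m n : intsq mu D (fun=> 0 : 'M[R]_(m, n)) = 0%E.
Proof. by rewrite /intsq; under eq_integral do rewrite sqnorm0; rewrite integral0. Qed.

Lemma intsqD_lty m n (X Y : T -> 'M[R]_(m, n)) :
  measurable_fun D X -> measurable_fun D Y ->
  (intsq mu D X < +oo)%E -> (intsq mu D Y < +oo)%E ->
  (intsq mu D (fun x => X x + Y x)%R < +oo)%E.
Proof.
move=> mX mY X2 Y2; apply: le_lt_trans (intsqD_le2 mu mD mX mY) _.
by apply: lte_add_pinfty; apply: lte_mul_pinfty.
Qed.

Lemma intsqB_lty m n (X Y : T -> 'M[R]_(m, n)) :
  measurable_fun D X -> measurable_fun D Y ->
  (intsq mu D X < +oo)%E -> (intsq mu D Y < +oo)%E ->
  (intsq mu D (fun x => X x - Y x)%R < +oo)%E.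
Proof.
move=> mX mY X2 Y2; apply: intsqD_lty => //; last by rewrite intsqN.
have -> : (fun x => - Y x) = (fun x => 0 - Y x) by apply/funext => x; rewrite sub0r.
by apply: measurable_mxB.
Qed.

Lemma intsq_sum_lty m n (I : Type) (s : seq I) (X : I -> T -> 'M[R]_(m, n)) :
  (forall i, measurable_fun D (X i)) -> (forall i, intsq mu D (X i) < +oo)%E ->
  (intsq mu D (fun x => \sum_(i <- s) X i x)%R < +oo)%E.
Proof.
move=> mX X2; elim: s => [|i s ih].
  by under eq_fun do rewrite big_nil; rewrite intsq0.
under eq_fun do rewrite big_cons; apply: intsqD_lty => //.
exact: measurable_mx_sum.
Qed.

End intsq_closure.

Section processes.
Context {d : measure_display} {Omega : measurableType d} {R : realType}.
Variable P : probability Omega R.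
Local Notation mu := (@lebesgue_measure R).

Local Notation step m n := (@step_process d Omega R m n).

Definition msq (t : R) {m n} (phi : R -> Omega -> 'M[R]_(m, n)) : \bar R :=
  (\int[mu]_(s in `[0%R, t]) 'E_P[fun w => (mxnorm2 (phi s w) ^+ 2)%R])%E.

Definition jointly_measurable (t : R) {m n} (phi : R -> Omega -> 'M[R]_(m, n)) :=
  measurable_fun (`[0, t]%classic `*` [set: Omega]) (fun p : R * Omega => phi p.1 p.2).

Lemma expectation_mxnorm2 m n (X : Omega -> 'M[R]_(m, n)) :
  ('E_P[fun w => (mxnorm2 (X w) ^+ 2)%R] = intsq P setT X)%E.
Proof.
by rewrite unlock; apply: eq_integral => w _; rewrite mxnorm2_sqr.
Qed.

Lemma msqE t m n (phi : R -> Omega -> 'M[R]_(m, n)) :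
  msq t phi = (\int[mu]_(s in `[0%R, t]) intsq P setT (phi s))%E.
Proof. by apply: eq_integral => s _; exact: expectation_mxnorm2. Qed.

Lemma msq_ge0 t m n (phi : R -> Omega -> 'M[R]_(m, n)) : (0 <= msq t phi)%E.
Proof. by rewrite msqE; apply: integral_ge0 => s _; exact: intsq_ge0. Qed.

Lemma msq_fin t m n (phi : R -> Omega -> 'M[R]_(m, n)) :
  (msq t phi < +oo)%E -> msq t phi \is a fin_num.
Proof. by rewrite (ge0_fin_numE (msq_ge0 t phi)). Qed.

Lemma msq_slab t m n (phi : R -> Omega -> 'M[R]_(m, n)) :
  jointly_measurable t phi ->
  msq t phi = intsq (mu \x P)%E (`[0, t]%classic `*` setT) (fun p : R * Omega => phi p.1 p.2).
Proof.
move=> mphi; rewrite msqE /intsq tonelli_slab //.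
- by apply: measurable_EFin_sqnorm => //; exact: measurable_slab.
- by move=> p _; rewrite lee_fin sqnorm_ge0.
Qed.

Lemma jmB t m n (phi psi : R -> Omega -> 'M[R]_(m, n)) :
  jointly_measurable t phi -> jointly_measurable t psi ->
  jointly_measurable t (psub phi psi).
Proof. by move=> h1 h2; apply: measurable_mxB => //; exact: measurable_slab. Qed.

Lemma jm_sub s t m n (phi : R -> Omega -> 'M[R]_(m, n)) : s <= t ->
  jointly_measurable t phi -> jointly_measurable s phi.
Proof.
move=> st; apply: measurable_funS; first exact: measurable_slab.
move=> [r w] /= [+ _]; rewrite !in_itv /= => /andP[r0 rs]; split => //=.
by rewrite r0 (le_trans rs).
Qed.

Lemma msq_mono s t m n (phi : R -> Omega -> 'M[R]_(m, n)) : s <= t ->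
  (msq s phi <= msq t phi)%E.
Proof.
move=> st; rewrite !msqE; apply: ge0_subset_integral_any.
  by move=> r; exact: intsq_ge0.
by apply: subset_itvl; rewrite bnd_simp.
Qed.

Lemma eq_msq t m n p q (phi : R -> Omega -> 'M[R]_(m, n))
    (psi : R -> Omega -> 'M[R]_(p, q)) :
  {ae mu, forall s, s \in `[0, t] -> {ae P, forall w, sqnorm (phi s w) = sqnorm (psi s w)}} ->
  msq t phi = msq t psi.
Proof.
move=> h; rewrite !msqE; apply: ae_ge0_eq_integral_any.
- by move=> s _; exact: intsq_ge0.
- by move=> s _; exact: intsq_ge0.
apply: (ae_imply _ h) => s + sI => /(_ sI) h'; apply: ae_ge0_eq_integral_any.
- by move=> w _; rewrite lee_fin sqnorm_ge0.
- by move=> w _; rewrite lee_fin sqnorm_ge0.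
by apply: (ae_imply _ h') => w -> _.
Qed.

Lemma msq_lin t m n p q m' n' (X : R -> Omega -> 'M[R]_(m, n))
    (Y : R -> Omega -> 'M[R]_(p, q)) (Z : R -> Omega -> 'M[R]_(m', n')) (a b : R) :
  0 <= a -> 0 <= b -> jointly_measurable t X -> jointly_measurable t Y ->
  jointly_measurable t Z ->
  (forall s w, s \in `[0, t] ->
    sqnorm (Z s w) <= a * sqnorm (X s w) + b * sqnorm (Y s w)) ->
  (msq t Z <= a%:E * msq t X + b%:E * msq t Y)%E.
Proof.
move=> a0 b0 mX mY mZ h; rewrite !msq_slab //; apply: intsq_lin => //.
- exact: measurable_slab.
- by apply: aeW => -[s w] [/= sI _]; exact: h.
Qed.

Lemma msq_triangle2 t m n (Y X Z : R -> Omega -> 'M[R]_(m, n)) :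
  jointly_measurable t X -> jointly_measurable t Y -> jointly_measurable t Z ->
  (msq t (psub X Z) <= 2%:E * msq t (psub X Y) + 2%:E * msq t (psub Y Z))%E.
Proof.
move=> mX mY mZ; apply: msq_lin => //; try exact: jmB.
by move=> s w _; exact: sqnorm_triangle2.
Qed.

Lemma msq_subC t m n (X Y : R -> Omega -> 'M[R]_(m, n)) :
  msq t (psub X Y) = msq t (psub Y X).
Proof. by apply: eq_msq; apply: aeW => s _; apply: aeW => w; exact: sqnormBC. Qed.

Lemma msq_eq0 t m n (phi psi : R -> Omega -> 'M[R]_(m, n)) :
  jointly_measurable t phi -> jointly_measurable t psi ->
  msq t (psub phi psi) = 0%E -> eq_L2 P 0 t phi psi.
Proof.
move=> m1 m2; have m3 := jmB m1 m2.
rewrite msq_slab // intsq_eq0 //; last exact: measurable_slab.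
move=> /ae_slab1 h; apply: (ae_imply _ h) => s + sI => /(_ sI) h'.
by apply: (ae_imply _ h') => w /= /eqP; rewrite subr_eq0 => /eqP.
Qed.

Section ito.
Context {l : nat}.
Variable B : R -> Omega -> 'cV[R]_l.
Hypothesis bmB : is_brownian_motion P B.

(** Overlapping step intervals are first cut along a common grid. *)
Lemma steps_isometry n (I : finType) (a b : I -> R)
    (xi : I -> Omega -> 'M[R]_(n, l)) (t : R) :
  (forall i, 0 <= a i /\ a i <= b i /\ b i <= t) ->
  (forall i, measurable_fun setT (xi i : at_time B (a i) -> 'M[R]_(n, l))) ->
  (forall i, intsq P setT (xi i) < +oo)%E ->
  (intsq P setT (fun w => \sum_i xi i w *m (B (b i) w - B (a i) w))%R <=
   (8 * l%:R)%:E * msq t (fun s w =>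
     \sum_i (\1_(`[a i, b i[%classic) s : R) *: xi i w)%R)%E.
Proof.
move=> hab mxi xi2.
have mxi' i : measurable_fun setT (xi i).
  exact: (at_time_measurable (bm_measurable bmB) (mxi i)).
pose xs := codom a ++ codom b.
have axs i : a i \in xs by rewrite mem_cat codom_f.
have bxs i : b i \in xs by rewrite mem_cat codom_f orbT.
have xs0t x : x \in xs -> 0 <= x <= t.
  rewrite mem_cat => /orP[] /codomP[i ->]; have [h1 [h2 h3]] := hab i.
    by rewrite h1 (le_trans h2 h3).
  by rewrite h3 (le_trans h1 h2).
have [xs0|xsn0] := eqVneq xs [::].
  have noI (i : I) : False by have := axs i; rewrite xs0.
  have -> : (fun w => \sum_i xi i w *m (B (b i) w - B (a i) w)) = (fun=> 0).
    by apply/funext => w; rewrite big1 // => i; have := noI i.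
  by rewrite intsq0 mule_ge0 ?msq_ge0 // lee_fin mulr_ge0.
have := sort_sorted (@le_total _ R) xs; have := mem_sort <=%R xs.
case: (sort _ _) => [|x0 q] memr srt.
  by exfalso; move/eqP: xsn0; apply; apply: size0nil; apply/eqP; rewrite -leqn0 leqNgt;
     apply/negP => h; have := mem_nth 0 h; rewrite -memr.
have aq i : a i \in x0 :: q by rewrite memr.
have bq i : b i \in x0 :: q by rewrite memr.
pose r := nth 0 (x0 :: q).
have r0t j : (j <= size q)%N -> 0 <= r j <= t.
  by move=> jN; apply: xs0t; rewrite -memr mem_nth.
pose e s w := \sum_i (\1_(`[a i, b i[%classic) s : R) *: xi i w.
have -> : (fun w => \sum_i xi i w *m (B (b i) w - B (a i) w)) =
    (fun w => \sum_(j < size q) e (r j) w *m (B (r j.+1) w - B (r j) w)).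
  apply/funext => w; under [RHS]eq_bigr do rewrite mulmx_suml.
  rewrite [RHS]exchange_big /=; apply: eq_bigr => i _.
  rewrite (refine_cell srt (fun s => B s w) (hab i).2.1 (aq i) (bq i)) mulmx_sumr.
  apply: eq_bigr => j _; rewrite indicE mem_setE in_itv /=; case: (_ && _).
    by rewrite scale1r.
  by rewrite scale0r mulmx0 mul0mx.
have me j : (j < size q)%N ->
    measurable_fun setT (e (r j) : at_time B (r j) -> 'M[R]_(n, l)).
  move=> jq; apply: measurable_mx_sum => // i.
  rewrite indicE mem_setE in_itv /=.
  case: (boolP (_ && _)) => [/andP[ar _]|_]; rewrite ?mulr1n ?mulr0n; last first.
    by under eq_fun do rewrite scale0r; exact: measurable_cst.
  by under eq_fun do rewrite scale1r; exact: (at_time_mono ar (mxi i)).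
have e2 s : (intsq P setT (e s) < +oo)%E.
  apply: intsq_sum_lty => // i.
    by apply: measurable_mxZ => //; exact: mxi'.
  by rewrite intsqZ // lte_mul_pinfty // lee_fin sqr_ge0.
have rr j : (j < size q)%N -> 0 <= r j /\ r j <= r j.+1.
  by move=> jq; split; [have /andP[] := r0t j (ltnW jq)|exact: refine_mono].
apply: le_trans (grid_isometry bmB rr me (fun j _ => e2 (r j))) _.
rewrite msqE -/e; pose G s := intsq P setT (e s).
apply: (@le_trans _ _ ((8 * l%:R)%:E * \int[mu]_(s in `[x0, r (size q)]) G s)%E); last first.
  apply: lee_wpmul2l; first by rewrite lee_fin mulr_ge0.
  apply: ge0_subset_integral_any; first by move=> s; exact: intsq_ge0.
  have /andP[x00 _] := r0t 0%N (leq0n _); have /andP[_ rt] := r0t _ (leqnn (size q)).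
  by apply: subset_itv; rewrite bnd_simp.
apply: le_trans (lee_wpmul2l _ (refine_sum_le srt (G := G) _ _)); first last.
- move=> j s jq js sj; rewrite /G; congr intsq; apply/funext => w.
  apply: eq_bigr => i _; rewrite !indicE !mem_setE !in_itv /=.
  rewrite (refine_le srt (aq i) jq js sj); congr (_%:R *: _); congr nat_of_bool.
  by congr (_ && _); rewrite !ltNge (refine_le srt (bq i) jq js sj).
- by move=> s; exact: intsq_ge0.
- by rewrite lee_fin mulr_ge0.
rewrite ge0_sume_distrr; last first.
  move=> j _; apply: mule_ge0; last exact: intsq_ge0.
  by rewrite lee_fin subr_ge0; have [] := rr j (ltn_ord j).
by apply: lee_sum => j _; rewrite muleA -EFinM.
Qed.

Lemma step_times t m n (S : step m n) : is_step_process P B t S ->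
  forall i, (i < sp_size S)%N ->
  0 <= sp_time S i /\ sp_time S i <= sp_time S i.+1 /\ sp_time S i.+1 <= t.
Proof.
move=> [S0 St mono _ _].
have h i j : (i <= j)%N -> (j <= sp_size S)%N -> sp_time S i <= sp_time S j.
  elim: j => [|j ih]; first by rewrite leqn0 => /eqP ->.
  rewrite leq_eqVlt => /predU1P[-> //|ij] jN.
  by apply: le_trans (ih ij (ltnW jN)) (mono j jN).
move=> i iN; split; first by rewrite -S0 h // ltnW.
by split; [exact: mono|rewrite -St h].
Qed.

Lemma step_coef t m n (S : step m n) : is_step_process P B t S ->
  forall i, (i < sp_size S)%N ->
  measurable_fun setT (sp_coef S i : at_time B (sp_time S i) -> 'M[R]_(m, n)) /\
  (intsq P setT (sp_coef S i) < +oo)%E.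
Proof.
move=> [_ _ _ mS S2] i iN; split; first by apply/measurable_wrtP; exact: mS.
by have := S2 i iN; rewrite expectation_mxnorm2.
Qed.

Lemma step_coef_measurable t m n (S : step m n) :
  is_step_process P B t S ->
  forall i, (i < sp_size S)%N -> measurable_fun setT (sp_coef S i).
Proof.
move=> hS i iN; exact: (at_time_measurable (bm_measurable bmB) (step_coef hS iN).1).
Qed.

Lemma step_eval_jm s t m n (S : step m n) : is_step_process P B s S ->
  jointly_measurable t (step_eval S).
Proof.
move=> hS; rewrite /jointly_measurable /step_eval.
apply: measurable_mx_sum => [|i]; first exact: measurable_slab.
apply: measurable_mxZ; first exact: measurable_slab.
  by apply: measurable_funTS; apply: measurableT_comp => //; exact: measurable_indic.
apply: measurable_funTS; apply: measurableT_comp => //.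
exact: (step_coef_measurable hS (ltn_ord i)).
Qed.

Lemma step_integral_measurable t n (S : step n l) :
  is_step_process P B t S ->
  measurable_fun setT (step_integral B S : at_time B t -> 'cV[R]_n).
Proof.
move=> hS; apply: measurable_mx_sum => // i.
have [i0 [ii it]] := step_times hS (ltn_ord i).
apply: measurable_mxM => //.
  exact: (at_time_mono (le_trans ii it) (step_coef hS (ltn_ord i)).1).
apply: measurable_mxB => //; apply: adapted_self => //.
- exact: le_trans ii.
- exact: le_trans it.
Qed.

Lemma ito_step_diff s t n (S S' : step n l) : s <= t ->
  is_step_process P B s S -> is_step_process P B t S' ->
  (intsq P setT (fun w => step_integral B S w - step_integral B S' w)%R <=
   (8 * l%:R)%:E * msq t (psub (step_eval S) (step_eval S')))%E.
Proof.
move=> st hS hS'.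
pose I := ('I_(sp_size S) + 'I_(sp_size S'))%type.
pose a (i : I) := match i with inl i => sp_time S i | inr i => sp_time S' i end.
pose b (i : I) := match i with inl i => sp_time S i.+1 | inr i => sp_time S' i.+1 end.
pose xi (i : I) := match i with
  inl i => sp_coef S i | inr i => fun w => -1 *: sp_coef S' i w end.
have -> : (fun w => step_integral B S w - step_integral B S' w) =
    (fun w => \sum_i xi i w *m (B (b i) w - B (a i) w)).
  apply/funext => w; rewrite big_sumType /= -sumrN; congr (_ + _).
  by apply: eq_bigr => i _; rewrite scaleN1r mulNmx.
have -> : psub (step_eval S) (step_eval S') =
    (fun r w => \sum_i (\1_(`[a i, b i[%classic) r : R) *: xi i w).
  apply/funext => r; apply/funext => w; rewrite big_sumType /= /psub -sumrN.
  congr (_ + _).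
  by apply: eq_bigr => i _; rewrite scalerA mulrC -scalerA scaleN1r.
apply: steps_isometry => -[] i.
- have [h1 [h2 h3]] := step_times hS (ltn_ord i).
  by do 2!split => //; exact: le_trans st.
- exact: (step_times hS' (ltn_ord i)).
- exact: (step_coef hS (ltn_ord i)).1.
- by apply: measurable_mxZ => //; exact: (step_coef hS' (ltn_ord i)).1.
- exact: (step_coef hS (ltn_ord i)).2.
- rewrite intsqZ //; last exact: (step_coef_measurable hS' (ltn_ord i)).
  by apply: lte_mul_pinfty => //; [rewrite lee_fin sqr_ge0|exact: (step_coef hS' (ltn_ord i)).2].
Qed.

Definition cutoff (s : R) {m n} (phi : R -> Omega -> 'M[R]_(m, n)) : R -> Omega -> 'M[R]_(m, n) :=
  fun r w => if r <= s then phi r w else 0.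

Lemma cutoff_jm s t m n (phi : R -> Omega -> 'M[R]_(m, n)) : s <= t ->
  jointly_measurable s phi -> jointly_measurable t (cutoff s phi).
Proof.
move=> st mphi; rewrite /jointly_measurable /cutoff.
apply: measurable_fun_if; first exact: measurable_slab.
- apply: measurable_funTS; apply: (@measurable_fun_ler _ _ _ _ (fun p : R * Omega => p.1) (fun=> s)) => //.
  exact: measurable_fst.
- apply: measurable_funS mphi; first exact: measurable_slab.
  by move=> [r w] /= [[]]; rewrite !in_itv /= => /andP[-> _] _ rs; rewrite rs.
- exact: measurable_cst.
Qed.

Lemma msq_cutoff_step s t m n (phi : R -> Omega -> 'M[R]_(m, n)) (S : step m n) :
  s <= t -> is_step_process P B s S ->
  msq t (psub (cutoff s phi) (step_eval S)) = msq s (psub phi (step_eval S)).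
Proof.
move=> st hS; rewrite !msqE [LHS]integral_mkcond [RHS]integral_mkcond.
apply: eq_integral => r _; rewrite !patchE !mem_setE !in_itv /=.
have [r0|] := leP 0 r => //=.
have [rs|sr] := leP r s.
  rewrite (le_trans rs st); congr intsq; apply/funext => w.
  by rewrite /psub /cutoff rs.
case: ifP => // _; rewrite -[RHS](intsq0 P setT m n); congr intsq; apply/funext => w.
rewrite /psub /cutoff leNgt sr /= sub0r /step_eval big1 ?oppr0 // => i _.
rewrite indicE mem_setE in_itv /= ltNge.
have [_ [_ it]] := step_times hS (ltn_ord i).
by rewrite (le_trans it (ltW sr)) andbF scale0r.
Qed.

Let mule4D (x y : \bar R) : (0 <= x)%E -> (0 <= y)%E ->
  (4%:E * x + 4%:E * y = 2%:E * (2%:E * x + 2%:E * y))%E.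
Proof.
move=> x0 y0; have e4 : 4 = 2 * 2 :> R by ring.
by rewrite ge0_muleDr; [rewrite e4 EFinM !muleA| |]; rewrite ?mule_ge0.
Qed.

(** Ito integrals over different horizons and of different integrands are
    compared through their approximating step processes, and the bound passes
    to the limit. The constant is that of the step integrals, times 4 for two
    uses of (a + b)^2 <= 2 a^2 + 2 b^2. *)
Lemma ito_estimate s t n (phi phi' : R -> Omega -> 'M[R]_(n, l))
    (I I' : Omega -> 'cV[R]_n) : s <= t ->
  is_ito_integral P B s phi I -> is_ito_integral P B t phi' I' ->
  (intsq P setT (fun w => I w - I' w)%R <=
   (32 * l%:R)%:E * msq t (psub (cutoff s phi) phi'))%E.
Proof.
move=> st [[mphi _ _] mI [S [hS Sphi SI]]] [[mphi' _ _] mI' [S' [hS' Sphi' SI']]].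
have jphi : jointly_measurable s phi by exact: mphi.
have jphi' : jointly_measurable t phi' by exact: mphi'.
have jc := cutoff_jm st jphi.
have mSI k : measurable_fun setT (step_integral B (S k)).
  exact: (at_time_measurable (bm_measurable bmB) (step_integral_measurable (hS k))).
have mSI' k : measurable_fun setT (step_integral B (S' k)).
  exact: (at_time_measurable (bm_measurable bmB) (step_integral_measurable (hS' k))).
pose e1 k := intsq P setT (fun w => I w - step_integral B (S k) w).
pose e2 k := intsq P setT (fun w => I' w - step_integral B (S' k) w).
pose e3 k := msq s (psub phi (step_eval (S k))).
pose e4 k := msq t (psub phi' (step_eval (S' k))).
have c1 : e1 k @[k --> \oo] --> 0%E.
  by move: SI; under eq_fun do rewrite expectation_mxnorm2.
have c2 : e2 k @[k --> \oo] --> 0%E.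
  by move: SI'; under eq_fun do rewrite expectation_mxnorm2.
have c3 : e3 k @[k --> \oo] --> 0%E by exact: Sphi.
have c4 : e4 k @[k --> \oo] --> 0%E by exact: Sphi'.
set M := msq t (psub (cutoff s phi) phi').
have bound k : (intsq P setT (fun w => I w - I' w)%R <=
    (4%:E * e1 k + 4%:E * e2 k) +
    (2 * (8 * l%:R))%:E * ((4%:E * e3 k + 4%:E * e4 k) + 2%:E * M))%E.
  apply: (@le_trans _ _ (2%:E * intsq P setT (fun w =>
       (I w - step_integral B (S k) w) - (I' w - step_integral B (S' k) w))%R +
     2%:E * intsq P setT (fun w => step_integral B (S k) w - step_integral B (S' k) w)%R)%E).
    apply: intsq_lin => //; try (do ?[apply: measurable_mxB => //]).
    apply: aeW => w _.
    have -> : I w - I' w = ((I w - step_integral B (S k) w) -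
        (I' w - step_integral B (S' k) w)) +
        (step_integral B (S k) w - step_integral B (S' k) w).
      by apply/matrixP => i j; rewrite !mxE; ring.
    exact: sqnormD_le2.
  apply: leeD.
    rewrite mule4D ?intsq_ge0 //.
    apply: lee_wpmul2l => //; apply: intsq_lin => //; try (do ?[apply: measurable_mxB => //]).
    by apply: aeW => w _; exact: sqnormB_le2.
  rewrite EFinM -muleA; apply: lee_wpmul2l => //.
  apply: le_trans (ito_step_diff st (hS k) (hS' k)) _.
  apply: lee_wpmul2l; first by rewrite lee_fin mulr_ge0.
  have jS : jointly_measurable t (step_eval (S k)) := step_eval_jm (hS k).
  have jS' : jointly_measurable t (step_eval (S' k)) := step_eval_jm (hS' k).
  rewrite /e3 -(msq_cutoff_step _ st (hS k)).
  apply: (@le_trans _ _ (2%:E * msq t (psub (psub (cutoff s phi) (step_eval (S k)))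
      (psub phi' (step_eval (S' k)))) + 2%:E * M)%E).
    have j1 := jmB jc jS; have j2 := jmB jphi' jS'.
    apply: msq_lin => //; [exact: jmB|exact: jmB|exact: jmB|].
    move=> r w _; rewrite /psub.
    have -> : step_eval (S k) r w - step_eval (S' k) r w =
        - ((cutoff s phi r w - step_eval (S k) r w) - (phi' r w - step_eval (S' k) r w))
        + (cutoff s phi r w - phi' r w).
      by apply/matrixP => i j; rewrite !mxE; ring.
    by apply: le_trans (sqnormD_le2 _ _) _; rewrite sqnormN.
  apply: leeD => //.
  rewrite mule4D ?msq_ge0 //.
  have j1 := jmB jc jS; have j2 := jmB jphi' jS'.
  apply: lee_wpmul2l => //; apply: msq_lin => //; first exact: jmB.
  by move=> r w _; exact: sqnormB_le2.
have lim0 (u v : nat -> \bar R) : u k @[k --> \oo] --> 0%E -> v k @[k --> \oo] --> 0%E ->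
    (4%:E * u k + 4%:E * v k)%E @[k --> \oo] --> 0%E.
  move=> hu hv.
  have h0 (w : nat -> \bar R) : w k @[k --> \oo] --> 0%E -> (4%:E * w k)%E @[k --> \oo] --> 0%E.
    move=> hw; have h4 : (4%:E : \bar R) \is a fin_num by [].
    by have := @cvgeZl _ _ R w 0%E 4%:E h4 hw; rewrite mule0.
  have hd : ((0 : \bar R) +? 0)%E by [].
  have hs := @cvgeD _ \oo eventually_filter R _ _ _ _ hd (h0 _ hu) (h0 _ hv).
  by rewrite adde0 in hs; exact: hs.
have -> : ((32 * l%:R)%:E * M = 0 + (2 * (8 * l%:R))%:E * (0 + 2%:E * M))%E.
  by rewrite !add0e muleA -EFinM; congr (_%:E * _)%E; ring.
have def0 x : ((0 : \bar R) +? x)%E by exact: fin_num_adde_defr.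
have hM : (2%:E * M)%E @[k --> \oo] --> (2%:E * M)%E by exact: cvg_cst.
have hE := @cvgeD _ \oo (eventually_filter) R _ _ _ _ (def0 _) (lim0 _ _ c3 c4) hM.
have hZ := @cvgeZl _ _ R _ _ (2 * (8 * l%:R))%:E isT hE.
have hA := @cvgeD _ \oo (eventually_filter) R _ _ _ _ (def0 _) (lim0 _ _ c1 c2) hZ.
exact: (@cvge_ge _ \oo eventually_filter R _ _ _ (nearW _ bound) hA).
Qed.

End ito.
End processes.

(** * Step processes are dense among square integrable adapted processes *)

Section small_oscillation.
Context {R : realType}.
Local Notation mu := (@lebesgue_measure R).

(** At almost every time a bounded function oscillates little, on average, over
    a short interval: these are its Lebesgue points. *)
Lemma ae_mean_oscillation (t C : R) (m n : nat) (psi : R -> 'M[R]_(m, n)) (h : nat -> R) :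
  0 <= C -> measurable_fun setT psi -> (forall s i j, `|psi s i j| <= C) ->
  (forall s, ~~ (0 <= s <= t) -> psi s = 0) ->
  (forall k, 0 < h k) -> h k @[k --> \oo] --> 0 ->
  {ae mu, forall s, (fun k => ((h k)^-1)%:E *
     \int[mu]_(r in ball s (2 * h k)) (sqnorm (psi s - psi r))%:E)%E k
     @[k --> \oo] --> 0%E}.
Proof.
move=> C0 mpsi psiC psi0 h0 hlim.
have mij i j : measurable_fun setT (fun s => psi s i j) by move/measurable_mxP: mpsi; exact.
have loc i j : locally_integrable setT (fun s => psi s i j).
  apply: open_integrable_locally; first exact: openT.
  apply/integrableP; split; first by apply/measurable_EFinP; exact: mij.
  apply: (@le_lt_trans _ _ (\int[mu]_(s in `[0%R, t]) (cst C%:E) s)%E).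
    rewrite [leRHS]integral_mkcond; apply: ae_ge0_le_integral_any => //.
      by move=> s _; rewrite patchE; case: ifP; rewrite // lee_fin.
    apply: aeW => s _ /=; rewrite patchE mem_setE in_itv /=.
    by case: ifPn => [_|/psi0 ->]; rewrite ?lee_fin ?mxE ?normr0.
  rewrite integral_cst //= lebesgue_measure_itv /= lte_fin.
  by case: ifP => _; rewrite ?mule0 // -EFinB -EFinM ltry.
have : {ae mu, forall s, forall i j, lebesgue_pt (fun s => psi s i j) s}.
  have h1 i : {ae mu, forall s, forall j, lebesgue_pt (fun s => psi s i j) s}.
    by apply: filter_forall => j; exact: lebesgue_differentiation.
  by apply: filter_forall => i; exact: h1.
move=> hae; apply: (ae_imply _ hae) => s leb.
have dav i j : davg (fun s => psi s i j) s (2 * h k) @[k --> \oo] --> 0%E.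
  have h2 : (2 * h k) @[k --> \oo] --> (0 : R).
    by rewrite -(mulr0 2); apply: cvgM => //; exact: cvg_cst.
  have h2' : (2 * h k) @[k --> \oo] --> (0 : R)^'+.
    move=> A [e /= e0 hA]; move/cvgrPdist_lt: h2 => /(_ e e0).
    by apply: filterS => k hk; apply: hA => //; exact: mulr_gt0.
  exact: (cvg_comp _ _ h2' (leb i j)).
pose U k := (\sum_i \sum_j (8 * C)%:E * davg (fun s => psi s i j) s (2 * h k))%E.
have U0 : U k @[k --> \oo] --> 0%E.
  have c8 : 0 <= 8 * C by rewrite mulr_ge0.
  have -> : (0 = \sum_(i < m) \sum_(j < n) 0 :> \bar R)%E.
    by rewrite big1 // => i _; rewrite big1.
  have pos i j k : (0 <= (8 * C)%:E * davg (fun s => psi s i j) s (2 * h k))%E.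
    by rewrite mule_ge0 ?lee_fin ?davg_ge0.
  apply: (@cvg_nnesum _ \oo eventually_filter R) => i _.
    by apply: nearW => k; apply: sume_ge0.
  apply: (@cvg_nnesum _ \oo eventually_filter R) => j _; first exact: nearW.
  have := @cvgeZl _ _ R _ _ (8 * C)%:E isT (dav i j).
  by rewrite mule0.
apply: (@squeeze_cvge _ _ eventually_filter R (fun=> 0%E) _ U); last 2 first.
- exact: cvg_cst.
- exact: U0.
apply: nearW => k; apply/andP; split.
  apply: mule_ge0; first by rewrite lee_fin invr_ge0 ltW.
  by apply: integral_ge0 => r _; rewrite lee_fin sqnorm_ge0.
have mball : measurable (ball s (2 * h k)) by exact: measurable_ball.
have mcen i j D : measurable_fun D (fun r => (`|psi r i j - psi s i j|)%:E).
  apply/measurable_EFinP; apply: measurableT_comp => //.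
  by apply: measurable_funB => //; exact: measurable_funTS.
have davE i j : (davg (fun s => psi s i j) s (2 * h k) =
    ((4 * h k)^-1)%:E * \int[mu]_(r in ball s (2 * h k)) (`|psi r i j - psi s i j|)%:E)%E.
  rewrite /davg /iavg lebesgue_measure_ball; last by rewrite mulr_ge0 // ltW.
  have -> : (2 * h k) *+ 2 = 4 * h k by rewrite mulr2n; ring.
  by rewrite inver gt_eqF // mulr_gt0.
have pt r : sqnorm (psi s - psi r) <= \sum_i \sum_j (2 * C) * `|psi r i j - psi s i j|.
  rewrite sqnormE; apply: ler_sum => i _; apply: ler_sum => j _; rewrite !mxE.
  rewrite -real_normK ?num_real // expr2 distrC ler_wpM2r //.
  by apply: le_trans (ler_normB _ _) _; rewrite mulrDl !mul1r lerD.
apply: (@le_trans _ _ (((h k)^-1)%:E * \sum_i \sum_j (2 * C)%:E *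
    \int[mu]_(r in ball s (2 * h k)) (`|psi r i j - psi s i j|)%:E)%E).
  apply: lee_wpmul2l; first by rewrite lee_fin invr_ge0 ltW.
  apply: (@le_trans _ _ (\int[mu]_(r in ball s (2 * h k))
      \sum_i \sum_j ((2 * C)%:E * (`|psi r i j - psi s i j|)%:E))%E).
    apply: ae_ge0_le_integral_any.
    - by move=> r _; rewrite lee_fin sqnorm_ge0.
    - move=> r _; apply: sume_ge0 => i _; apply: sume_ge0 => j _.
      by rewrite -EFinM lee_fin !mulr_ge0.
    apply: aeW => r _; apply: (@le_trans _ _ (\sum_i \sum_j (2 * C) * `|psi r i j - psi s i j|)%:E).
      by rewrite lee_fin.
    rewrite -sumEFin; apply: lee_sum => i _; rewrite -sumEFin; apply: lee_sum => j _.
    by rewrite EFinM.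
  have m2 i j D : measurable_fun D (fun r => ((2 * C)%:E * (`|psi r i j - psi s i j|)%:E)%E).
    by apply: emeasurable_funM => //; exact: mcen.
  rewrite ge0_integral_sum //; last 2 first.
  - by move=> i; apply: emeasurable_sum => j; exact: m2.
  - by move=> i r _; apply: sume_ge0 => j _; rewrite -EFinM lee_fin !mulr_ge0.
  apply: lee_sum => i _; rewrite ge0_integral_sum //; last 2 first.
  - by move=> j; exact: m2.
  - by move=> j r _; rewrite -EFinM lee_fin !mulr_ge0.
  apply: lee_sum => j _; rewrite ge0_integralZl_EFin //; last exact: mulr_ge0.
  exact: mcen.
rewrite ge0_sume_distrr; last first.
  move=> i _; apply: sume_ge0 => j _; apply: mule_ge0; first by rewrite lee_fin mulr_ge0.
  by apply: integral_ge0 => r _; rewrite lee_fin.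
apply: lee_sum => i _; rewrite ge0_sume_distrr; last first.
  move=> j _; apply: mule_ge0; first by rewrite lee_fin mulr_ge0.
  by apply: integral_ge0 => r _; rewrite lee_fin.
apply: lee_sum => j _; rewrite davE !muleA -!EFinM.
apply: lee_wpmul2r; first by apply: integral_ge0 => r _; rewrite lee_fin.
rewrite lee_fin invfM le_eqVlt; apply/orP; left; apply/eqP; field.
by rewrite gt_eqF.
Qed.

End small_oscillation.

Section bounded_integrand.
Context {d : measure_display} {Omega : measurableType d} {R : realType}.
Variable P : probability Omega R.
Local Notation mu := (@lebesgue_measure R).
Variables (m n : nat) (phi : R -> Omega -> 'M[R]_(m, n)) (t C : R).
Hypothesis t0 : 0 < t.
Hypothesis C0 : 0 <= C.
Hypothesis mphi : measurable_fun setT (fun p : R * Omega => phi p.1 p.2).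
Hypothesis phiC : forall s w i j, `|phi s w i j| <= C.
Hypothesis phi0 : forall s w, ~~ (0 <= s <= t) -> phi s w = 0.

Let M : R := \sum_(i < m) \sum_(j < n) (C + C) ^+ 2.

Let phiM s r w : sqnorm (phi s w - phi r w) <= M.
Proof.
rewrite sqnormE; apply: ler_sum => i _; apply: ler_sum => j _; rewrite !mxE.
rewrite -real_normK ?num_real // ler_pXn2r ?nnegrE ?addr_ge0 //.
by apply: le_trans (ler_normB _ _) _; rewrite lerD.
Qed.

Let M0 : 0 <= M.
Proof. by apply: sumr_ge0 => i _; apply: sumr_ge0 => j _; exact: sqr_ge0. Qed.

(** Integrated over [s] and [w], this is up to a factor the mean oscillation of
    [phi] around the time [r] at scale [h]. *)
Definition oscillation_kernel (h r s : R) (w : Omega) : \bar R :=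
  if ((0 <= s) && (s <= t)) && (`|s - r| < 2 * h)
  then (h^-1 * sqnorm (phi s w - phi r w))%:E else 0%E.

Definition oscillation (h : R) (r : R) : \bar R :=
  (\int[mu]_s \int[P]_w oscillation_kernel h r s w)%E.

Let mphi' d' (T' : measurableType d') (f : T' -> R) (g : T' -> Omega) :
  measurable_fun setT f -> measurable_fun setT g ->
  measurable_fun setT (fun x => phi (f x) (g x)).
Proof.
move=> mf mg; have -> : (fun x => phi (f x) (g x)) =
  (fun p : R * Omega => phi p.1 p.2) \o (fun x => (f x, g x)) by [].
by apply: measurableT_comp => //; exact: measurable_fun_pair.
Qed.

Lemma measurable_oscillation_kernel h d' (T' : measurableType d')
    (r s : T' -> R) (w : T' -> Omega) :
  measurable_fun setT r -> measurable_fun setT s -> measurable_fun setT w ->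
  measurable_fun setT (fun x => oscillation_kernel h (r x) (s x) (w x)).
Proof.
move=> mr ms mw; apply: measurable_fun_if => //.
- apply: measurable_and.
    by apply: measurable_and; apply: measurable_fun_ler.
  apply: measurable_fun_ltr => //; apply: measurableT_comp => //.
  exact: measurable_funB.
- apply: measurable_funTS; apply/measurable_EFinP; apply: measurable_funM => //.
  by apply: measurable_sqnorm => //; apply: measurable_mxB => //; exact: mphi'.
Qed.

Lemma oscillation_kernel_ge0 h r s w : 0 < h -> (0 <= oscillation_kernel h r s w)%E.
Proof.
move=> h0; rewrite /oscillation_kernel; case: ifP => // _.
by rewrite lee_fin mulr_ge0 ?sqnorm_ge0 // invr_ge0 ltW.
Qed.

Let inner (h : R) s w : 0 <= s <= t -> 0 < h ->
  (\int[mu]_r oscillation_kernel h r s w =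
   (h^-1)%:E * \int[mu]_(r in ball s (2 * h)) (sqnorm (phi s w - phi r w))%:E)%E.
Proof.
move=> st h0; rewrite -ge0_integralZl_EFin //; first last.
- by rewrite invr_ge0 ltW.
- apply: measurable_funTS; apply/measurable_EFinP; apply: measurable_sqnorm => //.
  by apply: measurable_mxB => //; exact: mphi'.
- by move=> r _; rewrite lee_fin sqnorm_ge0.
- exact: measurable_ball.
rewrite [RHS]integral_mkcond; apply: eq_integral => r _.
rewrite patchE /oscillation_kernel /= st /= -EFinM.
have [hr|hr] := boolP (`|s - r| < 2 * h); first by rewrite mem_set.
by rewrite memNset //; exact/negP.
Qed.

Let inner0 (h : R) s w : ~~ (0 <= s <= t) ->
  (\int[mu]_r oscillation_kernel h r s w = 0)%E.
Proof.
move=> st; rewrite (eq_integral (cst 0%E)) ?integral0 // => r _.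
by rewrite /oscillation_kernel /= (negbTE st).
Qed.

Let inner_le (h : R) s w : 0 < h ->
  (\int[mu]_r oscillation_kernel h r s w <= (4 * M)%:E)%E.
Proof.
move=> h0; have [st|/(inner0 h w) ->] := boolP (0 <= s <= t); last first.
  by rewrite lee_fin mulr_ge0.
rewrite inner //.
apply: (@le_trans _ _ ((h^-1)%:E * \int[mu]_(r in ball s (2 * h)) M%:E)%E).
  apply: lee_wpmul2l; first by rewrite lee_fin invr_ge0 ltW.
  apply: ae_ge0_le_integral_any.
  - by move=> r _; rewrite lee_fin sqnorm_ge0.
  - by move=> r _; rewrite lee_fin.
  - by apply: aeW => r _; rewrite lee_fin.
rewrite integral_cst; last exact: measurable_ball.
have h20 : 0 <= 2 * h by rewrite mulr_ge0 // ltW.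
rewrite [X in (_ * (_ * X))%E](lebesgue_measure_ball s h20) -!EFinM lee_fin.
rewrite le_eqVlt; apply/orP; left; apply/eqP; rewrite mulr2n; field.
by rewrite gt_eqF.
Qed.

Let measurable_inner h : 0 < h -> measurable_fun setT
  (fun z : R * Omega => \int[mu]_r oscillation_kernel h r z.1 z.2)%E.
Proof.
move=> h0; apply: (@measurable_fun_fubini_tonelli_G _ _ _ _ _ mu
  (fun p : R * (R * Omega) => oscillation_kernel h p.1 p.2.1 p.2.2)).
  by apply: measurable_oscillation_kernel => //; apply: measurableT_comp.
by move=> p; exact: oscillation_kernel_ge0.
Qed.

Let measurable_average h : 0 < h -> measurable_fun setT
  (fun p : R * R => \int[P]_w oscillation_kernel h p.1 p.2 w)%E.
Proof.
move=> h0; apply: (@measurable_fun_fubini_tonelli_F _ _ _ _ _ P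
  (fun p : R * R * Omega => oscillation_kernel h p.1.1 p.1.2 p.2)).
  by apply: measurable_oscillation_kernel => //; apply: measurableT_comp.
by move=> p; exact: oscillation_kernel_ge0.
Qed.

Lemma oscillation_ge0 h r : 0 < h -> (0 <= oscillation h r)%E.
Proof.
move=> h0; apply: integral_ge0 => s _; apply: integral_ge0 => w _.
exact: oscillation_kernel_ge0.
Qed.

Lemma measurable_oscillation h : 0 < h -> measurable_fun setT (oscillation h).
Proof.
move=> h0; apply: (@measurable_fun_fubini_tonelli_F _ _ _ _ _ mu
  (fun p : R * R => \int[P]_w oscillation_kernel h p.1 p.2 w)%E).
  exact: measurable_average.
by move=> p; apply: integral_ge0 => w _; exact: oscillation_kernel_ge0.
Qed.

(** Dominated convergence, first in time along each path and then over paths. *)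
Lemma oscillation_cvg0 (h : nat -> R) : (forall k, 0 < h k) ->
  h k @[k --> \oo] --> 0 -> (\int[mu]_r oscillation (h k) r)%E @[k --> \oo] --> 0%E.
Proof.
move=> h0 hlim.
pose G k s w := (\int[mu]_r oscillation_kernel (h k) r s w)%E.
have G0 k s w : (0 <= G k s w)%E.
  by apply: integral_ge0 => r _; exact: oscillation_kernel_ge0.
have mG k : measurable_fun setT (fun z : R * Omega => G k z.1 z.2).
  exact: measurable_inner.
have mGs k w : measurable_fun setT (fun s => G k s w).
  have -> : (fun s => G k s w) = (fun z : R * Omega => G k z.1 z.2) \o (fun s => (s, w)) by [].
  by apply: measurableT_comp => //; exact: pair2_measurable.
pose v k w := (\int[mu]_(s in `[0%R, t]) G k s w)%E.
have -> : (fun k => \int[mu]_r oscillation (h k) r)%E = (fun k => \int[P]_w v k w)%E.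
  apply/funext => k; rewrite /oscillation.
  rewrite (@fubini_tonelli _ _ _ _ _ mu mu
    (fun p : R * R => \int[P]_w oscillation_kernel (h k) p.1 p.2 w)%E); last 2 first.
  - exact: measurable_average.
  - by move=> p; apply: integral_ge0 => w _; exact: oscillation_kernel_ge0.
  transitivity (\int[mu]_s \int[P]_w G k s w)%E.
    apply: eq_integral => s _ /=.
    apply: (@fubini_tonelli _ _ _ _ _ mu P
      (fun p : R * Omega => oscillation_kernel (h k) p.1 s p.2)).
      exact: measurable_oscillation_kernel.
    by move=> p; exact: oscillation_kernel_ge0.
  rewrite (@fubini_tonelli _ _ _ _ _ mu P (fun z => G k z.1 z.2)); last 2 first.
  - exact: (mG k).
  - by move=> [s w]; exact: G0.
  apply: eq_integral => w _; rewrite /v [RHS]integral_mkcond; apply: eq_integral => s _.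
  rewrite patchE mem_setE in_itv /=; case: ifPn => // st.
  exact: inner0.
have mv k : measurable_fun setT (v k).
  have h2 := (measurable_funTS (mG k)).
  have := @measurable_slab_integral2 _ _ _ _ _ mu _ (measurable_itv `[0, t])
    (fun z : R * Omega => G k z.1 z.2) (h2 _).
  by apply => p _; exact: G0.
have v_le k w : (v k w <= (4 * M * t)%:E)%E.
  apply: (@le_trans _ _ (\int[mu]_(s in `[0%R, t]) (4 * M)%:E)%E).
    apply: ae_ge0_le_integral_any => //.
      by move=> s _; rewrite lee_fin mulr_ge0.
    by apply: aeW => s _; exact: inner_le.
  rewrite integral_cst //= lebesgue_measure_itv /= lte_fin t0 -EFinB -EFinM.
  by rewrite subr0.
have v0 k w : (0 <= v k w)%E by apply: integral_ge0 => s _; exact: G0.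
have vlim w : v k w @[k --> \oo] --> 0%E.
  have fint : mu.-integrable `[0, t]%classic (cst (4 * M)%:E).
    apply/integrableP; split => //.
    rewrite integral_cst //= lebesgue_measure_itv /= lte_fin t0 -EFinB.
    by rewrite ger0_norm ?mulr_ge0 // -EFinM ltry.
  have osc : {ae mu, forall s, `[0, t]%classic s -> G k s w @[k --> \oo] --> 0%E}.
    have hw : measurable_fun setT (fun s => phi s w) by apply: mphi'.
    have := @ae_mean_oscillation R t C m n (fun s => phi s w) h C0 hw
      (fun s i j => phiC s w i j) (fun s => @phi0 s w) h0 hlim.
    move=> hae; apply: (ae_imply _ hae) => s hs; rewrite /= in_itv /= => st.
    by move: hs; apply: cvg_trans; apply: near_eq_cvg; apply: nearW => k; rewrite /G inner.
  have [_ _] := @dominated_convergence _ _ R mu `[0, t]%classic (measurable_itv _)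
    (fun k s => G k s w) (cst 0%E) (cst (4 * M)%:E)
    (fun k => measurable_funTS (mGs k w)) (measurable_cst _) osc fint
    ltac:(apply: aeW => s k _; rewrite gee0_abs //; exact: inner_le).
  by rewrite integral0.
have fint : P.-integrable setT (cst (4 * M * t)%:E).
  apply/integrableP; split => //.
  rewrite integral_cst //= ger0_norm ?mulr_ge0 // ?ltW //.
  by rewrite [P _]probability_setT mule1 ltry.
have [_ _] := @dominated_convergence _ _ R P setT measurableT
    v (cst 0%E) (cst (4 * M * t)%:E) mv (measurable_cst _)
    ltac:(by apply: aeW => w _) fint
    ltac:(by apply: aeW => w k _; rewrite gee0_abs).
by rewrite integral0.
Qed.

End bounded_integrand.

Section mean_point.
Context {R : realType}.
Local Notation mu := (@lebesgue_measure R).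

(** Otherwise the function would exceed its mean everywhere. *)
Lemma exists_below_mean (a b e : R) (F : R -> \bar R) : a < b -> 0 < e ->
  (forall r, 0 <= F r)%E ->
  exists2 r, a <= r < b & ((b - a)%:E * F r <= \int[mu]_(s in `[a, b[) F s + e%:E)%E.
Proof.
move=> ab e0 F0; apply: contrapT => H.
have ba0 : 0 < b - a by rewrite subr_gt0.
have I0 : (0 <= \int[mu]_(s in `[a, b[) F s)%E by apply: integral_ge0.
have gtF r : a <= r < b ->
    (\int[mu]_(s in `[a, b[) F s + e%:E < (b - a)%:E * F r)%E.
  by move=> abr; rewrite ltNge; apply/negP => h; apply: H; exists r.
have fin : (\int[mu]_(s in `[a, b[) F s)%E \is a fin_num.
  rewrite ge0_fin_numE //; have /gtF : a <= a < b by rewrite lexx ab.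
  by rewrite ltNge => /negP h; rewrite ltNge; apply/negP => h1; apply: h;
    move: h1; rewrite leye_eq => /eqP ->; rewrite addye // leey.
move: gtF; rewrite -(fineK fin) -EFinD; set c := fine _ => gtF.
have c0 : 0 <= c by apply: fine_ge0.
have : (\int[mu]_(s in `[a, b[) ((b - a)^-1 * (c + e))%:E <= \int[mu]_(s in `[a, b[) F s)%E.
  apply: ae_ge0_le_integral_any => //.
    by move=> s _; rewrite lee_fin mulr_ge0 ?invr_ge0 ?(ltW ba0) // addr_ge0 ?(ltW e0).
  apply: aeW => s; rewrite /= in_itv /= => /gtF h.
  have -> : (F s = ((b - a)^-1)%:E * ((b - a)%:E * F s))%E.
    by rewrite muleA -EFinM mulVf ?gt_eqF // mul1e.
  by rewrite EFinM; apply: lee_wpmul2l; [rewrite lee_fin invr_ge0 ltW|exact: ltW].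
rewrite integral_cst //= lebesgue_measure_itvco ?(ltW ab) // -(fineK fin) -/c -EFinM lee_fin.
by rewrite mulrAC mulVf ?gt_eqF // mul1r gerDl leNgt e0.
Qed.

Lemma cvge0_lt (u : nat -> \bar R) (e : R) : u k @[k --> \oo] --> 0%E -> 0 < e ->
  \forall k \near \oo, (u k < e%:E)%E.
Proof.
move=> /fine_cvgP[fin cv] e0.
have h : \forall k \near \oo, fine (u k) < e by exact: (cvgr_lt _ cv).
apply: filterS2 fin h => k fk h; by rewrite -(fineK fk) lte_fin.
Qed.

Lemma integral_cells (h : R) (F : R -> \bar R) (N : nat) : 0 < h ->
  measurable_fun setT F -> (forall r, 0 <= F r)%E ->
  (\sum_(i < N) \int[mu]_(s in `[(i%:R * h)%R, (i.+1%:R * h)%R[) F s =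
   \int[mu]_(s in `[0%R, (N%:R * h)%R[) F s)%E.
Proof.
move=> h0 mF F0; elim: N => [|N ih].
  by rewrite big_ord0 mul0r set_itvco0 integral_set0.
rewrite big_ord_recr /= ih -ge0_integral_setU //; first last.
- apply/disj_setPS => x [/=]; rewrite !in_itv /= => /andP[_ xN] /andP[+ _].
  by rewrite leNgt xN.
- exact: measurable_funTS.
congr integral; apply/seteqP; split => x /=; rewrite !in_itv /=.
  move=> [/andP[-> xN]|/andP[Nx ->]].
    by rewrite (lt_le_trans xN) // ler_wpM2r ?ler_nat // ltW.
  by rewrite andbT (le_trans _ Nx) // mulr_ge0 // ltW.
move=> /andP[-> ->] /=; rewrite andbT.
by have [xN|Nx] := ltP x (N%:R * h); [left|right].
Qed.

Lemma cell_exists (h s : R) (N : nat) : 0 <= s < N%:R * h ->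
  exists2 i, (i < N)%N & i%:R * h <= s < i.+1%:R * h.
Proof.
move=> /andP[s0]; elim: N => [|N ih]; first by rewrite mul0r ltNge s0.
move=> sN; have [sN'|Ns] := ltP s (N%:R * h).
  by have [i iN hi] := ih sN'; exists i => //; exact: ltnW.
by exists N; rewrite ?ltnSn // Ns sN.
Qed.

Lemma sum_cells (h s : R) (N i : nat) (V : lmodType R) (c : nat -> V) : 0 < h ->
  (i < N)%N -> i%:R * h <= s < i.+1%:R * h ->
  \sum_(j < N) (\1_(`[(j%:R * h)%R, (j.+1%:R * h)%R[%classic) s : R) *: c j = c i.
Proof.
move=> h0 iN si; rewrite (bigD1 (Ordinal iN)) //= big1 ?addr0 => [|j ji].
  by rewrite indicE mem_set ?scale1r //= in_itv.
rewrite indicE memNset ?scale0r //= in_itv /= => /andP[js sj].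
move/eqP: ji; apply; apply: val_inj => /=; move: si => /andP[is_ si].
have := le_lt_trans js si; have := le_lt_trans is_ sj.
by rewrite !ltr_pM2r // !ltr_nat !ltnS => h1 h2; apply/eqP; rewrite eqn_leq h1 h2.
Qed.

End mean_point.

Section step_density.
Context {d : measure_display} {Omega : measurableType d} {R : realType}.
Variable P : probability Omega R.
Local Notation mu := (@lebesgue_measure R).
Local Notation step m n := (@step_process d Omega R m n).
Context {l : nat}.
Variable B : R -> Omega -> 'cV[R]_l.
Hypothesis bmB : is_brownian_motion P B.

Lemma sqnorm_bounded m n (A : 'M[R]_(m, n)) C : (forall i j, `|A i j| <= C) ->
  sqnorm A <= (m * n)%:R * C ^+ 2.
Proof.
move=> AC; rewrite sqnormE.
have -> : (m * n)%:R * C ^+ 2 = \sum_(i < m) \sum_(j < n) C ^+ 2.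
  by rewrite !sumr_const !card_ord -mulrnA mulr_natl mulnC.
apply: ler_sum => i _; apply: ler_sum => j _.
have C0 : 0 <= C := le_trans (normr_ge0 _) (AC i j).
by rewrite -real_normK ?num_real // ler_pXn2r ?nnegrE.
Qed.

(** The value of a bounded adapted process on a cell of a fine grid is replaced
    by its value at one time of the previous cell, which is already known when
    the cell begins; a time at which the oscillation does not exceed its mean
    over that previous cell makes the total error small. *)
Lemma bounded_step_approx m n (phi : R -> Omega -> 'M[R]_(m, n)) (t C e : R) :
  0 < t -> 0 <= C -> 0 < e ->
  measurable_fun setT (fun p : R * Omega => phi p.1 p.2) ->
  (forall s w i j, `|phi s w i j| <= C) ->
  (forall s w, ~~ (0 <= s <= t) -> phi s w = 0) ->
  (forall s, 0 <= s <= t ->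
    measurable_fun setT (phi s : at_time B s -> 'M[R]_(m, n))) ->
  exists2 S : step m n, is_step_process P B t S &
    (msq P t (psub phi (step_eval S)) <= e%:E)%E.
Proof.
move=> t0 C0 e0 mphi phiC phi0 adphi.
pose M : R := (m * n)%:R * C ^+ 2.
have M0 : 0 <= M by rewrite mulr_ge0 // sqr_ge0.
have phiM s w : sqnorm (phi s w) <= M by exact: sqnorm_bounded.
have phi2 s : (intsq P setT (phi s) < +oo)%E.
  apply: (@le_lt_trans _ _ (\int[P]_w (cst M%:E) w)%E).
    by apply: ae_ge0_le_integral_any; [| |apply: aeW] => w _; rewrite lee_fin ?sqnorm_ge0.
  by rewrite integral_cst //= [P _]probability_setT mule1 ltry.
pose hh (k : nat) : R := t / k.+1%:R.
have hh0 k : 0 < hh k by rewrite divr_gt0.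
have hlim : hh k @[k --> \oo] --> (0 : R).
  rewrite -(mulr0 t); apply: cvgM; first exact: cvg_cst.
  exact: cvg_harmonic.
have osc := oscillation_cvg0 P t0 C0 mphi phiC phi0 hh0 hlim.
have e40 : 0 < e / 4 by rewrite divr_gt0.
have [k [hk Mk]] : exists k, (\int[mu]_r oscillation P phi t (hh k) r <= (e / 4)%:E)%E /\
    M * hh k <= e / 4.
  have hM : M * hh k @[k --> \oo] --> (0 : R).
    by rewrite -(mulr0 M); apply: cvgM; [exact: cvg_cst|exact: hlim].
  have n1 := cvge0_lt osc e40.
  have n2 : \forall k \near \oo, M * hh k < e / 4 by exact: (cvgr_lt _ hM).
  have [k [/ltW h1 /ltW h2]] := @filter_ex _ _ eventually_filter _ (filterI n1 n2).
  by exists k.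
set h := hh k in hk Mk; have h0 : 0 < h by exact: hh0.
pose N := k.+1; have Nh : N%:R * h = t by rewrite /h /hh mulrC divfK // pnatr_eq0.
pose F := oscillation P phi t h.
have F0 r : (0 <= F r)%E by exact: oscillation_ge0.
have mF : measurable_fun setT F by exact: measurable_oscillation.
pose eN := e / 4 / N%:R; have eN0 : 0 < eN by rewrite divr_gt0.
have /choice[tau htau] i : exists r, i%:R * h <= r < i.+1%:R * h /\
    (h%:E * F r <= \int[mu]_(s in `[(i%:R * h)%R, (i.+1%:R * h)%R[) F s + eN%:E)%E.
  have hi : i%:R * h < i.+1%:R * h by rewrite ltr_pM2r // ltr_nat.
  have [r r1 r2] := exists_below_mean hi eN0 F0; exists r; split => //.
  by move: r2; rewrite -mulrBl -natrB // subSnn mul1r.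
have tau0 i : 0 <= tau i.
  by have [/andP[+ _] _] := htau i; apply: le_trans; rewrite mulr_ge0 // ltW.
(* The first cell has no previous one; the value 0 costs at most M h there. *)
pose S : step m n := @StepProcess _ _ _ _ _ N (fun i => i%:R * h)
  (fun i => if i is i'.+1 then phi (tau i') else fun=> 0).
have iNt i : (i <= N)%N -> i%:R * h <= t.
  by move=> iN; rewrite -Nh ler_wpM2r ?ler_nat // ltW.
exists S.
  split => /=.
  - by rewrite mul0r.
  - exact: Nh.
  - by move=> i _; rewrite ler_wpM2r ?ler_nat // ltW.
  - move=> [|i] iN; apply/measurable_wrtP; first exact: measurable_cst.
    have [/andP[_ /ltW r1] _] := htau i.
    by apply: (at_time_mono r1); apply: adphi; rewrite tau0 (le_trans r1) // iNt // ltnW.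
  - move=> [|i] iN; rewrite expectation_mxnorm2; last exact: phi2.
    by rewrite intsq0.
pose V i s := (h%:E * \int[P]_w oscillation_kernel phi t h (tau i) s w)%E.
have K0 i s w : (0 <= oscillation_kernel phi t h (tau i) s w)%E.
  exact: oscillation_kernel_ge0.
have V0 i s : (0 <= V i s)%E.
  by apply: mule_ge0; [rewrite lee_fin ltW|apply: integral_ge0 => w _].
have mV i : measurable_fun setT (fun s => \int[P]_w oscillation_kernel phi t h (tau i) s w)%E.
  apply: (@measurable_fun_fubini_tonelli_F _ _ _ _ _ P
    (fun p : R * Omega => oscillation_kernel phi t h (tau i) p.1 p.2)) => //.
  exact: measurable_oscillation_kernel.
have point s : `[0, t[%classic s ->
    (intsq P setT (psub phi (step_eval S) s) <=
     M%:E * (\1_(`[0%R, h[%classic) s)%:E + \sum_(i < N) V i s)%E.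
  rewrite /= in_itv /= -{1}Nh => sI; have [i iN si] := cell_exists sI.
  have evS w : step_eval S s w = sp_coef S i w.
    exact: (sum_cells (fun j => sp_coef S j w) h0 iN si).
  case: i iN si evS => [|i] iN /andP[is_ si] evS.
    apply: (@le_trans _ _ M%:E); last first.
      rewrite indicE mem_set /= ?in_itv /= ?mule1 ?leeDl ?sume_ge0 //.
      by rewrite mul0r mul1r in is_ si; rewrite is_ si.
    apply: (@le_trans _ _ (\int[P]_w (cst M%:E) w)%E); last first.
      by rewrite integral_cst //= [P _]probability_setT mule1.
    apply: ae_ge0_le_integral_any; [| |apply: aeW] => w _; rewrite lee_fin ?sqnorm_ge0 //.
    by rewrite /psub evS /= subr0.
  apply: (@le_trans _ _ (V i s)); last first.
    rewrite (bigD1 (Ordinal (ltnW iN))) //= addeCA leeDl //.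
    by apply: adde_ge0; [rewrite mule_ge0 ?lee_fin|exact: sume_ge0].
  have [/andP[ti1 ti2] _] := htau i.
  have close : `|s - tau i| < 2 * h.
    have e2 : i.+2%:R * h = i%:R * h + 2 * h :> R by rewrite -mulrDl -natrD addn2.
    have e1 : i.+1%:R * h = i%:R * h + h :> R by rewrite -[in LHS]addn1 natrD mulrDl mul1r.
    rewrite e2 in si; rewrite e1 in is_ ti2.
    by rewrite ltr_norml; apply/andP; split; move: h0 ti1 ti2 si is_; lra.
  have s01 : 0 <= s <= t by move: sI; rewrite Nh => /andP[-> /ltW ->].
  rewrite /V -ge0_integralZl_EFin //; last 2 first.
  - by apply: measurable_oscillation_kernel => //; exact: measurable_cst.
  - exact: ltW.
  apply: ae_ge0_le_integral_any; [| |apply: aeW] => w _.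
  - by rewrite lee_fin sqnorm_ge0.
  - by apply: mule_ge0 => //; rewrite lee_fin ltW.
  rewrite /psub evS /= /oscillation_kernel s01 close /= -EFinM lee_fin.
  by rewrite mulrA divff ?gt_eqF // mul1r.
have G0 s : (0 <= M%:E * (\1_(`[0%R, h[%classic) s)%:E + \sum_(i < N) V i s)%E.
  by apply: adde_ge0; [rewrite mule_ge0 ?lee_fin|exact: sume_ge0].
rewrite msqE.
apply: (@le_trans _ _ (\int[mu]_s (M%:E * (\1_(`[0%R, h[%classic) s)%:E + \sum_(i < N) V i s))%E).
  rewrite [leLHS]integral_mkcond; apply: ae_ge0_le_integral_any => //.
    by move=> s _; rewrite patchE; case: ifP => // _; exact: intsq_ge0.
  have nt : {ae mu, forall s, s <> t}.
    exists [set t]; split; [exact: measurable_set1|exact: lebesgue_measure_set1|].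
    by move=> s /= /contrapT ->.
  apply: (ae_imply _ nt) => s st _; rewrite patchE; case: ifPn => // /set_mem sI.
  apply: point; move: sI; rewrite /= !in_itv /= => /andP[-> sle] /=.
  by rewrite lt_neqAle sle andbT; apply/eqP.
have mI : measurable_fun setT (fun s : R => (\1_(`[0%R, h[%classic) s : R)%:E).
  by apply/measurable_EFinP; exact: measurable_indic.
rewrite ge0_integralD //; first last.
- by apply: emeasurable_sum => i; apply: measurable_funeM; exact: mV.
- by move=> s _; exact: sume_ge0.
- by apply: measurable_funeM; exact: mI.
- by move=> s _; rewrite mule_ge0 ?lee_fin.
rewrite ge0_integralZl_EFin //.
rewrite integral_indic // setIT [X in (_ * X)%E](lebesgue_measure_itvco (ltW h0)) subr0 -EFinM.
rewrite ge0_integral_sum //; last by move=> i; apply: measurable_funeM; exact: mV.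
apply: (@le_trans _ _ ((e / 4)%:E + \sum_(i < N)
    (\int[mu]_(s in `[(i%:R * h)%R, (i.+1%:R * h)%R[) F s + eN%:E))%E).
  apply: leeD; first by rewrite lee_fin.
  apply: lee_sum => i _; rewrite ge0_integralZl_EFin //; last 3 first.
  - by move=> s _; apply: integral_ge0.
  - exact: mV.
  - exact: ltW.
  exact: (htau i).2.
rewrite big_split /= integral_cells // Nh sumEFin sumr_const card_ord.
have -> : eN *+ N = e / 4 by rewrite -mulr_natr divfK // pnatr_eq0.
apply: (@le_trans _ _ ((e / 4)%:E + ((e / 4)%:E + (e / 4)%:E))%E).
  rewrite leeD2l // leeD2r //; apply: le_trans hk.
  exact: ge0_subset_integral_any.
by rewrite -!EFinD lee_fin; move: e0; lra.
Qed.

Definition truncate (c x : R) : R := Num.max (- c) (Num.min x c).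

Lemma truncate_norm c x : 0 <= c -> `|truncate c x| <= c.
Proof.
move=> c0; rewrite ler_norml /truncate le_max lexx /= ge_max ge_min lexx orbT andbT.
by rewrite (le_trans _ c0) // oppr_le0.
Qed.

Lemma truncate_id c x : `|x| <= c -> truncate c x = x.
Proof. by rewrite ler_norml => /andP[h1 h2]; rewrite /truncate min_l // max_r. Qed.

Lemma truncate_sqr_le c x : 0 <= c -> (x - truncate c x) ^+ 2 <= x ^+ 2.
Proof.
move=> c0; rewrite -real_normK ?num_real // -[leRHS]real_normK ?num_real //.
rewrite ler_pXn2r ?nnegrE // /truncate.
have [xc|cx] := leP x c.
  have [cx|xc'] := leP (- c) x; first by rewrite subrr normr0.
  by rewrite opprK !ltr0_norm; move: xc' c0; lra.
rewrite max_r; last by move: c0; lra.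
by rewrite !gtr0_norm; move: cx c0; lra.
Qed.

Lemma measurable_truncate c d' (T' : measurableType d') (D : set T') (f : T' -> R) :
  measurable_fun D f -> measurable_fun D (fun x => truncate c (f x)).
Proof. by move=> mf; apply: measurable_maxr => //; exact: measurable_minr. Qed.

(** Truncating the entries makes the process bounded without spoiling
    adaptedness; dominated convergence controls the error. *)
Lemma step_approx m n (phi : R -> Omega -> 'M[R]_(m, n)) (t e : R) :
  0 <= t -> L2ad P B 0 t phi -> 0 < e ->
  exists2 S : step m n, is_step_process P B t S &
    (msq P t (psub phi (step_eval S)) <= e%:E)%E.
Proof.
rewrite le_eqVlt => /predU1P[<- _ e0|t0 [mphi adphi phi2] e0].
  exists (@StepProcess _ _ _ _ _ 0 (fun=> 0) (fun _ _ => 0)); first by split.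
  by rewrite msqE set_itv1 integral_set1 lee_fin ltW.
pose psi (k : nat) s w : 'M[R]_(m, n) :=
  if (0 <= s) && (s <= t) then map_mx (truncate k%:R) (phi s w) else 0.
have jphi : jointly_measurable t phi by exact: mphi.
have mslab : measurable (`[0, t]%classic `*` [set: Omega]) by exact: measurable_slab.
have m1 (D : set (R * Omega)) : measurable_fun D (fun p : R * Omega => p.1).
  by apply: measurable_funTS; exact: measurable_fst.
have slabE : (fun p : R * Omega => (0 <= p.1) && (p.1 <= t)) @^-1` [set true] =
    `[0, t]%classic `*` [set: Omega].
  by apply/seteqP; split => -[s w] /=; rewrite in_itv //= => -[].
have mpsi k : measurable_fun setT (fun p : R * Omega => psi k p.1 p.2).
  apply: measurable_fun_if => //.
  - by apply: measurable_and; apply: measurable_fun_ler => //; exact: m1.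
  - rewrite setTI slabE; apply/measurable_mxP => // i j.
    have -> : (fun p : R * Omega => map_mx (truncate k%:R) (phi p.1 p.2) i j) =
      (fun p => truncate k%:R (phi p.1 p.2 i j)) by apply/funext => p; rewrite mxE.
    by apply: measurable_truncate; move/measurable_mxP: mphi => /(_ mslab); exact.
have psiC k s w i j : `|psi k s w i j| <= k%:R.
  rewrite /psi; case: ifP => _; rewrite mxE ?normr0 //; exact: truncate_norm.
have psi0 k s w : ~~ (0 <= s <= t) -> psi k s w = 0.
  by rewrite /psi => /negbTE ->.
have adpsi k s : 0 <= s <= t ->
    measurable_fun setT (psi k s : at_time B s -> 'M[R]_(m, n)).
  move=> st; rewrite /psi st; apply/measurable_mxP => // i j.
  have -> : (fun w => map_mx (truncate k%:R) (phi s w) i j) =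
    (fun w => truncate k%:R (phi s w i j)) by apply/funext => w; rewrite mxE.
  apply: measurable_truncate.
  have /adphi/measurable_wrtP/measurable_mxP h : s \in `[0, t] by rewrite in_itv.
  exact: h.
have jpsi k : jointly_measurable t (psi k) by exact: measurable_funTS.
have dom k p : (`[0, t]%classic `*` [set: Omega]) p ->
    sqnorm (phi p.1 p.2 - psi k p.1 p.2) <= sqnorm (phi p.1 p.2).
  move=> [/=]; rewrite in_itv /= => st _; rewrite /psi st !sqnormE.
  apply: ler_sum => i _; apply: ler_sum => j _; rewrite !mxE.
  exact: truncate_sqr_le.
have cv : msq P t (psub phi (psi k)) @[k --> \oo] --> 0%E.
  under eq_fun do rewrite (msq_slab P (jmB jphi (jpsi _))).
  have integ : (mu \x P)%E.-integrable (`[0, t]%classic `*` setT)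
      (fun p : R * Omega => (sqnorm (phi p.1 p.2))%:E).
    apply/integrableP; split; first exact: measurable_EFin_sqnorm.
    under eq_integral do rewrite gee0_abs ?lee_fin ?sqnorm_ge0 //.
    rewrite -[X in (X < _)%E]/(intsq (mu \x P)%E (`[0, t]%classic `*` setT)
      (fun p : R * Omega => phi p.1 p.2)).
    by rewrite -msq_slab.
  have pt p : (`[0, t]%classic `*` [set: Omega]) p ->
      (sqnorm (psub phi (psi k) p.1 p.2))%:E @[k --> \oo] --> cst 0%E p.
    move=> [/=]; rewrite in_itv /= => st _; apply: cvg_near_cst.
    exists (Num.bound (1 + sqnorm (phi p.1 p.2))) => // k /= Nk.
    rewrite /psub /psi st (_ : map_mx _ _ = phi p.1 p.2) ?subrr ?sqnorm0 //.
    apply/matrixP => i j; rewrite mxE truncate_id //.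
    apply: (@le_trans _ _ (1 + sqnorm (phi p.1 p.2))).
      have h1 := coord_sqr_le (phi p.1 p.2) i j.
      have h2 := sqr_ge0 (`|phi p.1 p.2 i j| - 1).
      move: h2 h1; rewrite sqrrB real_normK ?num_real // expr1n mulr1.
      by have := normr_ge0 (phi p.1 p.2 i j); lra.
    apply: ltW; apply: lt_le_trans (archi_boundP _) _.
      by rewrite addr_ge0 ?sqnorm_ge0.
    by rewrite ler_nat.
  have [_ _] := @dominated_convergence _ _ R (mu \x P)%E _ mslab
    (fun k (p : R * Omega) => (sqnorm (psub phi (psi k) p.1 p.2))%:E) (cst 0%E)
    (fun p : R * Omega => (sqnorm (phi p.1 p.2))%:E)
    ltac:(move=> k; apply: measurable_EFin_sqnorm => //; exact: jmB)
    (measurable_cst _)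
    ltac:(exact: aeW) integ
    ltac:(apply: aeW => p k Dp; rewrite gee0_abs ?lee_fin ?sqnorm_ge0 //; exact: dom).
  by rewrite integral0.
have e40 : 0 < e / 4 by rewrite divr_gt0.
have [k hk] := @filter_ex _ _ eventually_filter _ (cvge0_lt cv e40).
have [S hS Se] := bounded_step_approx t0 (ler0n R k) e40 (mpsi k) (psiC k) (psi0 k) (adpsi k).
exists S => //; apply: le_trans (msq_triangle2 P jphi (jpsi k) (step_eval_jm bmB hS)) _.
apply: (@le_trans _ _ (2%:E * (e / 4)%:E + 2%:E * (e / 4)%:E)%E).
  by apply: leeD; (apply: lee_wpmul2l; first by rewrite lee_fin); [exact: ltW hk|exact: Se].
by rewrite -!EFinM -EFinD lee_fin; move: e0; lra.
Qed.

End step_density.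

(** * Integration in time along paths *)

Section path_integral.
Context {R : realType}.
Local Notation mu := (@lebesgue_measure R).

Definition path_integral (t : R) {n} (h : R -> 'cV[R]_n) : 'cV[R]_n :=
  \col_i (\int[mu]_(s in `[0, t]) (h s i ord0)).

Lemma integrable_sqr_itv (t : R) (h : R -> R) : 0 <= t ->
  measurable_fun `[0, t]%classic h ->
  (\int[mu]_(s in `[0%R, t]) (h s ^+ 2)%:E < +oo)%E ->
  mu.-integrable `[0, t]%classic (EFin \o h) /\
  mu.-integrable `[0, t]%classic (EFin \o (fun s => h s ^+ 2)).
Proof.
move=> t0 mh h2.
have mh2 : measurable_fun `[0, t]%classic (EFin \o (fun s => h s ^+ 2)).
  by apply/measurable_EFinP; exact: measurable_funX.
have i2 : mu.-integrable `[0, t]%classic (EFin \o (fun s => h s ^+ 2)).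
  apply/integrableP; split => //=; under eq_integral do rewrite ger0_norm ?sqr_ge0 //.
  exact: h2.
split=> //; apply/integrableP; split; first exact/measurable_EFinP.
apply: (@le_lt_trans _ _ (\int[mu]_(s in `[0%R, t]) (1 + (h s ^+ 2)%:E))%E).
  apply: ae_ge0_le_integral_any.
  - by move=> s _ /=; rewrite lee_fin.
  - by move=> s _; rewrite -EFinD lee_fin addr_ge0 ?sqr_ge0.
  apply: aeW => s _ /=; rewrite -EFinD lee_fin -real_normK ?num_real //.
  by have := sqr_ge0 (`|h s| - 1)%R; rewrite sqrrB expr1n; have := normr_ge0 (h s); lra.
rewrite ge0_integralD //=; last by move=> s _; rewrite lee_fin sqr_ge0.
rewrite integral_cst //= lebesgue_measure_itv /= lte_fin mul1e.
by apply: lte_add_pinfty => //; case: ifP => _; rewrite ?ltry // -EFinB ltry.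
Qed.

(** Cauchy-Schwarz against the constant function 1. *)
Lemma sqr_Rintegral_le (t : R) (h : R -> R) : 0 <= t ->
  measurable_fun `[0, t]%classic h ->
  (\int[mu]_(s in `[0%R, t]) (h s ^+ 2)%:E < +oo)%E ->
  (((\int[mu]_(s in `[0%R, t]) h s) ^+ 2)%:E <=
   t%:E * \int[mu]_(s in `[0%R, t]) (h s ^+ 2)%:E)%E.
Proof.
move=> t0 mh h2; have [i1 i2] := integrable_sqr_itv t0 mh h2.
have fin : (\int[mu]_(s in `[0%R, t]) (h s ^+ 2)%:E)%E \is a fin_num.
  by rewrite ge0_fin_numE //; apply: integral_ge0 => s _; rewrite lee_fin sqr_ge0.
rewrite -(fineK fin) -EFinM lee_fin -/(Rintegral mu _ (fun s => h s ^+ 2)).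
set I := Rintegral mu _ h; set Q := Rintegral mu _ _.
have [tz|tz] := eqVneq t 0.
  by rewrite /I tz /Rintegral set_itv1 integral_set1 /= expr0n mul0r.
have {}t0 : 0 < t by rewrite lt_neqAle eq_sym tz.
pose c := I / t.
have mut : fine (mu `[0, t]%classic) = t.
  by rewrite lebesgue_measure_itv /= lte_fin t0 -EFinB subr0.
have ic : mu.-integrable `[0, t]%classic (EFin \o (fun=> c ^+ 2)).
  apply/integrableP; split; first exact/measurable_EFinP.
  rewrite (_ : (fun x => _) = cst `|c ^+ 2|%:E) // integral_cst //=.
  by rewrite lebesgue_measure_itv /= lte_fin t0 -EFinB -EFinM ltry.
have : 2 * c * I <= Q + c ^+ 2 * t.
  have ct : \int[mu]_(s in `[0%R, t]) (c ^+ 2) = c ^+ 2 * t by rewrite Rintegral_cst // mut.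
  rewrite -ct -RintegralZl // -RintegralD //.
  apply: le_Rintegral => //.
  - have -> : EFin \o (fun s => 2 * c * h s) = (fun s => (2 * c)%:E * (EFin \o h) s)%E.
      by apply/funext => s /=; rewrite EFinM.
    exact: integrableZl.
  - have -> : EFin \o (fun s => h s ^+ 2 + c ^+ 2) =
        ((EFin \o (fun s => (h s ^+ 2)%R)) \+ (EFin \o (fun=> (c ^+ 2)%R)))%E.
      by apply/funext => s /=; rewrite EFinD.
    exact: integrableD.
  - by move=> s _; have := sqr_ge0 (h s - c); rewrite sqrrB; lra.
have e1 : 2 * c * I = 2 * (I ^+ 2 / t) by rewrite /c; ring.
have e2 : c ^+ 2 * t = I ^+ 2 / t by rewrite /c; field; rewrite gt_eqF.
rewrite e1 e2 => h1; rewrite mulrC -ler_pdivrMr //; lra.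
Qed.

Lemma coord_sqr_lty (t : R) n (h : R -> 'cV[R]_n) i :
  measurable_fun `[0, t]%classic h -> (intsq mu `[0%R, t]%classic h < +oo)%E ->
  measurable_fun `[0, t]%classic (fun s => h s i ord0) /\
  (\int[mu]_(s in `[0%R, t]) (h s i ord0 ^+ 2)%:E < +oo)%E.
Proof.
move=> mh h2; split; first by move/measurable_mxP: mh; exact.
apply: le_lt_trans h2; apply: ae_ge0_le_integral_any => [s _|s _|].
- by rewrite lee_fin sqr_ge0.
- by rewrite lee_fin sqnorm_ge0.
- by apply: aeW => s _; rewrite lee_fin coord_sqr_le.
Qed.

Lemma path_integralB (t : R) n (h h' : R -> 'cV[R]_n) : 0 <= t ->
  measurable_fun `[0, t]%classic h -> measurable_fun `[0, t]%classic h' ->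
  (intsq mu `[0%R, t]%classic h < +oo)%E -> (intsq mu `[0%R, t]%classic h' < +oo)%E ->
  path_integral t (fun s => h s - h' s) = path_integral t h - path_integral t h'.
Proof.
move=> t0 mh mh' h2 h2'; apply/matrixP => i j; rewrite !mxE.
have [m1 f1] := coord_sqr_lty i mh h2; have [m2 f2] := coord_sqr_lty i mh' h2'.
rewrite -RintegralB //; last 2 first.
- exact: (integrable_sqr_itv t0 m1 f1).1.
- exact: (integrable_sqr_itv t0 m2 f2).1.
by apply: eq_Rintegral => s _; rewrite !mxE.
Qed.

Lemma sqnorm_path_integral (t : R) n (h : R -> 'cV[R]_n) : 0 <= t ->
  measurable_fun `[0, t]%classic h -> (intsq mu `[0%R, t]%classic h < +oo)%E ->
  ((sqnorm (path_integral t h))%:E <= t%:E * intsq mu `[0%R, t]%classic h)%E.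
Proof.
move=> t0 mh h2; rewrite intsq_coord // sqnormE -sumEFin ge0_sume_distrr; last first.
  by move=> i _; apply: sume_ge0 => j _; apply: integral_ge0 => s _; rewrite lee_fin sqr_ge0.
apply: lee_sum => i _; rewrite !big_ord1 !mxE.
have [m1 f1] := coord_sqr_lty i mh h2.
exact: sqr_Rintegral_le.
Qed.

Lemma path_integral_cut (s t : R) n (h h' : R -> 'cV[R]_n) : s <= t ->
  (forall r, h' r = if r <= s then h r else 0) ->
  path_integral t h' = path_integral s h.
Proof.
move=> st hh; apply/matrixP => i j; rewrite !mxE /Rintegral; congr fine.
rewrite integral_mkcond [RHS]integral_mkcond; apply: eq_integral => r _.
rewrite !patchE !mem_setE !in_itv /= hh.
have [r0|//] := leP 0 r => /=; have [rs|sr] := leP r s; last by rewrite mxE; case: ifP.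
by rewrite (le_trans rs st).
Qed.

Lemma measurable_path_integral (t : R) d (Omega : measurableType d) n
    (phi : R -> Omega -> 'cV[R]_n) :
  measurable_fun (`[0, t]%classic `*` [set: Omega]) (fun p : R * Omega => phi p.1 p.2) ->
  measurable_fun setT (fun w => path_integral t (phi^~ w)).
Proof.
move=> mphi; apply/measurable_mxP => // i j; under eq_fun do rewrite mxE.
apply: (measurableT_comp (@fine_measurable R setT measurableT)).
under eq_fun do rewrite integralE.
have mc : measurable_fun (`[0, t]%classic `*` [set: Omega])
    (fun p : R * Omega => (phi p.1 p.2 i ord0)%:E).
  apply/measurable_EFinP; move/measurable_mxP: mphi => mphi; apply: mphi.
  exact: measurable_slab.
apply: emeasurable_funB.
  have := @measurable_slab_integral2 _ _ _ _ _ mu _ (measurable_itv `[0, t]) _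
    (measurable_funepos mc) (fun p _ => funepos_ge0 _ p).
  congr measurable_fun; apply/funext => w; apply: eq_integral => s _.
  by rewrite !funeposE.
have := @measurable_slab_integral2 _ _ _ _ _ mu _ (measurable_itv `[0, t]) _
  (measurable_funeneg mc) (fun p _ => funeneg_ge0 _ p).
congr measurable_fun; apply/funext => w; apply: eq_integral => s _.
by rewrite !funenegE.
Qed.

End path_integral.

Section time_integrals.
Context {d : measure_display} {Omega : measurableType d} {R : realType}.
Variable P : probability Omega R.
Local Notation mu := (@lebesgue_measure R).

Lemma msq_swap t m n (phi : R -> Omega -> 'M[R]_(m, n)) : jointly_measurable t phi ->
  measurable_fun setT (fun w => intsq mu `[0%R, t]%classic (phi^~ w)) /\
  msq P t phi = (\int[P]_w intsq mu `[0%R, t]%classic (phi^~ w))%E.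
Proof.
move=> mphi; have msq := measurable_EFin_sqnorm (measurable_slab (measurable_itv `[0, t])) mphi.
have pos (p : R * Omega) : (`[0, t]%classic `*` [set: Omega]) p ->
  (0 <= (sqnorm (phi p.1 p.2))%:E)%E by move=> _; rewrite lee_fin sqnorm_ge0.
split; first exact: (@measurable_slab_integral2 _ _ _ _ _ mu _ (measurable_itv `[0, t]) _ msq pos).
by rewrite msqE; exact: (@tonelli_slab_swap _ _ _ _ _ mu P _ (measurable_itv `[0, t]) _ msq pos).
Qed.

Lemma ae_path_sqr_lty t m n (phi : R -> Omega -> 'M[R]_(m, n)) :
  jointly_measurable t phi -> (msq P t phi < +oo)%E ->
  {ae P, forall w, (intsq mu `[0%R, t]%classic (phi^~ w) < +oo)%E}.
Proof.
move=> mphi; have [mw ->] := msq_swap mphi; move=> fin.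
have int : P.-integrable setT (fun w => intsq mu `[0%R, t]%classic (phi^~ w)).
  apply/integrableP; split => //.
  by under eq_integral do rewrite gee0_abs ?intsq_ge0 //.
apply: (ae_imply _ (integrable_ae measurableT int)) => w /(_ I).
by rewrite ge0_fin_numE // intsq_ge0.
Qed.

Lemma msq_cutoff s t m n (phi : R -> Omega -> 'M[R]_(m, n)) : s <= t ->
  msq P t (cutoff s phi) = msq P s phi.
Proof.
move=> st; rewrite !msqE [LHS]integral_mkcond [RHS]integral_mkcond.
apply: eq_integral => r _; rewrite !patchE !mem_setE !in_itv /=.
have [r0|//] := leP 0 r => /=; rewrite /cutoff.
have [rs|sr] := leP r s; first by rewrite (le_trans rs st).
by rewrite intsq0; case: ifP.
Qed.

Lemma time_integral_estimate s t n (phi phi' : R -> Omega -> 'cV[R]_n) :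
  0 <= s -> s <= t -> jointly_measurable s phi -> jointly_measurable t phi' ->
  (msq P s phi < +oo)%E -> (msq P t phi' < +oo)%E ->
  (intsq P setT (fun w => time_integral s phi w - time_integral t phi' w)%R <=
   t%:E * msq P t (psub (cutoff s phi) phi'))%E.
Proof.
move=> s0 st mphi mphi' phi2 phi2'; have t0 := le_trans s0 st.
have mc := cutoff_jm st mphi; have mB := jmB mc mphi'.
have c2 : (msq P t (cutoff s phi) < +oo)%E by rewrite msq_cutoff.
have [mw ->] := msq_swap mB.
rewrite -ge0_integralZl_EFin //; last by move=> w _; exact: intsq_ge0.
apply: ae_ge0_le_integral_any.
- by move=> w _; rewrite lee_fin sqnorm_ge0.
- by move=> w _; apply: mule_ge0; [rewrite lee_fin|exact: intsq_ge0].
have h1 := ae_path_sqr_lty mc c2; have h2 := ae_path_sqr_lty mphi' phi2'.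
apply: filterS2 h1 h2 => w f1 f2 _.
have m1 := measurable_slab_section2 (measurable_itv `[0, t]) w mc.
have m2 := measurable_slab_section2 (measurable_itv `[0, t]) w mphi'.
have -> : time_integral s phi w = path_integral t ((cutoff s phi)^~ w).
  by apply/esym; apply: path_integral_cut.
rewrite -[time_integral t phi' w]/(path_integral t (phi'^~ w)) -path_integralB //.
apply: sqnorm_path_integral => //; first exact: measurable_mxB.
exact: intsqB_lty.
Qed.

End time_integrals.

(** * The state driven by given coefficient processes *)

Lemma cvge0_geometric {R : realType} (u : nat -> \bar R) (A q : R) : 0 <= q < 1 ->
  (forall k, 0 <= u k)%E -> (forall k, u k <= (A * q ^+ k)%:E)%E ->
  u k @[k --> \oo] --> 0%E.
Proof.
move=> /andP[q0 q1] u0 uA.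
apply: (@squeeze_cvge _ _ eventually_filter R (fun=> 0%E) _ (fun k => (A * q ^+ k)%:E)).
- by apply: nearW => k; rewrite u0 uA.
- exact: cvg_cst.
- apply: cvg_EFin; first exact: nearW.
  by rewrite -(mulr0 A); apply: cvgM; [exact: cvg_cst|apply: cvg_expr; rewrite ger0_norm].
Qed.

Section state.
Context {d : measure_display} {Omega : measurableType d} {R : realType}.
Variable P : probability Omega R.
Local Notation mu := (@lebesgue_measure R).
Local Notation step m n := (@step_process d Omega R m n).
Context {l : nat}.
Variable B : R -> Omega -> 'cV[R]_l.
Hypothesis bmB : is_brownian_motion P B.

Let mB := bm_measurable bmB.

Lemma L2ad_sub s t m n (phi : R -> Omega -> 'M[R]_(m, n)) : s <= t ->
  L2ad P B 0 t phi -> L2ad P B 0 s phi.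
Proof.
move=> st [mphi adphi phi2]; split.
- exact: jm_sub mphi.
- move=> r; rewrite in_itv /= => /andP[r0 rs]; apply: adphi.
  by rewrite in_itv /= r0 (le_trans rs).
- by apply: le_lt_trans phi2; exact: (msq_mono P phi st).
Qed.

Lemma step_sequence m n t (phi : R -> Omega -> 'M[R]_(m, n)) : 0 <= t ->
  L2ad P B 0 t phi ->
  exists S : nat -> step m n, forall k, is_step_process P B t (S k) /\
    (msq P t (psub phi (step_eval (S k))) <= ((1 / 2) ^+ 2 ^+ k)%:E)%E.
Proof.
move=> t0 hphi.
suff /choice[S hS] : forall k : nat, exists S : step m n, is_step_process P B t S /\
    (msq P t (psub phi (step_eval S)) <= ((1 / 2) ^+ 2 ^+ k)%:E)%E by exists S.
move=> k; have e0 : 0 < ((1 / 2) ^+ 2 ^+ k : R) by rewrite !exprn_gt0.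
by have [S hS Se] := step_approx bmB t0 hphi e0; exists S.
Qed.

Lemma msq_cutoff_same t m n (phi psi : R -> Omega -> 'M[R]_(m, n)) :
  msq P t (psub (cutoff t phi) psi) = msq P t (psub phi psi).
Proof.
apply: eq_msq; apply: aeW => s; rewrite in_itv /= => /andP[_ st].
by apply: aeW => w; rewrite /psub /cutoff st.
Qed.

Let half01 : 0 < (1 / 2 : R) < 1. Proof. by apply/andP; split; lra. Qed.
Let quarter01 : 0 <= ((1 / 2) ^+ 2 : R) < 1. Proof. by apply/andP; split; lra. Qed.

(** The integrals of approximating step processes form a Cauchy sequence by the
    Ito estimate. Their coordinatewise upper limit is measurable for the events
    known at time [t], which a limit chosen almost everywhere need not be. *)
Lemma ito_integral_exists n t (psi : R -> Omega -> 'M[R]_(n, l)) : 0 <= t ->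
  L2ad P B 0 t psi ->
  exists2 I, is_ito_integral P B t psi I & measurable_fun setT (I : at_time B t -> 'cV[R]_n).
Proof.
move=> t0 hpsi; have [S hS] := step_sequence t0 hpsi.
have jpsi : jointly_measurable t psi by case: hpsi.
have jS k : jointly_measurable t (step_eval (S k)) := step_eval_jm bmB (hS k).1.
pose Y k := step_integral B (S k).
have mY k : measurable_fun setT (Y k : at_time B t -> 'cV[R]_n).
  exact: (step_integral_measurable (hS k).1).
have mY' k : measurable_fun setT (Y k) := at_time_measurable mB (mY k).
have step_err k : (intsq P setT (fun w => Y k.+1 w - Y k w)%R <=
    (32 * l%:R * (1 / 2) ^+ 2 ^+ k)%:E)%E.
  apply: le_trans (ito_step_diff bmB (lexx t) (hS k.+1).1 (hS k).1) _.
  apply: (@le_trans _ _ ((8 * l%:R)%:E * (4 * (1 / 2) ^+ 2 ^+ k)%:E)%E); last first.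
    by rewrite -EFinM lee_fin le_eqVlt; apply/orP; left; apply/eqP; ring.
  apply: lee_wpmul2l; first by rewrite lee_fin mulr_ge0.
  apply: le_trans (msq_triangle2 P (jS _) jpsi (jS _)) _.
  apply: (@le_trans _ _ (2%:E * ((1 / 2) ^+ 2 ^+ k)%:E + 2%:E * ((1 / 2) ^+ 2 ^+ k)%:E)%E).
    apply: leeD; apply: lee_wpmul2l => //; last exact: (hS k).2.
    rewrite msq_subC; apply: le_trans (hS k.+1).2 _.
    by rewrite lee_fin exprS ler_piMl // ?ltW ?exprn_gt0 //; case/andP: quarter01.
  by rewrite -!EFinM -EFinD lee_fin -mulrDl le_eqVlt; apply/orP; left; apply/eqP; ring.
have A0 : 0 <= 32 * l%:R :> R by rewrite mulr_ge0.
have [_ lim] := plim_complete measurableT half01 mY' A0 step_err.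
exists (plim Y); last exact: measurable_plim.
split=> //; first exact: measurable_plim.
exists S; split=> [k| |]; first exact: (hS k).1.
  apply: (@cvge0_geometric _ _ 1 _ quarter01) => k; first exact: msq_ge0.
  by rewrite mul1r; exact: (hS k).2.
under eq_fun do rewrite expectation_mxnorm2.
by apply: (cvge0_geometric quarter01) => k; [exact: intsq_ge0|exact: lim].
Qed.

Lemma step_eval_jm_at_time t m n (S : step m n) : is_step_process P B t S ->
  measurable_fun (`[0, t]%classic `*` [set: at_time B t])
    (fun p : R * at_time B t => step_eval S p.1 p.2).
Proof.
move=> hS; apply: measurable_mx_sum => [|i]; first exact: measurable_slab.
apply: measurable_mxZ; first exact: measurable_slab.
  by apply: measurable_funTS; apply: measurableT_comp => //; exact: measurable_indic.
apply: measurable_funTS; apply: measurableT_comp => //.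
have [_ [ii it]] := step_times hS (ltn_ord i).
exact: (at_time_mono (le_trans ii it) (step_coef hS (ltn_ord i)).1).
Qed.

(** The integral in time of an adapted process is known at the final time up to
    a null set: it is the limit of the integrals of step processes. *)
Lemma time_integral_version n t (phi : R -> Omega -> 'cV[R]_n) : 0 <= t ->
  L2ad P B 0 t phi ->
  exists2 J, measurable_fun setT (J : at_time B t -> 'cV[R]_n) &
    {ae P, forall w, J w = time_integral t phi w}.
Proof.
move=> t0 hphi; have [S hS] := step_sequence t0 hphi.
have [jphi _ phi2] := hphi.
have jS k : jointly_measurable t (step_eval (S k)) := step_eval_jm bmB (hS k).1.
have S2 k : (msq P t (step_eval (S k)) < +oo)%E.
  apply: (@le_lt_trans _ _ (2%:E * msq P t phi +
      2%:E * msq P t (psub phi (step_eval (S k))))%E).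
    apply: msq_lin => //; first exact: jmB.
    move=> s w _; have -> : step_eval (S k) s w = phi s w - psub phi (step_eval (S k)) s w.
      by rewrite /psub opprB addrC subrK.
    exact: sqnormB_le2.
  apply: lte_add_pinfty; apply: lte_mul_pinfty => //.
  by apply: le_lt_trans (hS k).2 _; exact: ltry.
pose Y k := time_integral t (step_eval (S k)).
have mY k : measurable_fun setT (Y k : at_time B t -> 'cV[R]_n).
  exact: (measurable_path_integral (step_eval_jm_at_time (hS k).1)).
have mY' k : measurable_fun setT (Y k) := at_time_measurable mB (mY k).
have mX : measurable_fun setT (time_integral t phi).
  exact: (measurable_path_integral jphi).
have err k : (intsq P setT (fun w => Y k w - time_integral t phi w)%R <=
    (t * (1 / 2) ^+ 2 ^+ k)%:E)%E.
  apply: le_trans (time_integral_estimate t0 (lexx t) (jS k) jphi (S2 k) phi2) _.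
  by rewrite EFinM lee_wpmul2l ?lee_fin // msq_cutoff_same msq_subC; exact: (hS k).2.
exists (plim Y); first exact: measurable_plim.
have q01 : 0 < ((1 / 2) ^+ 2 : R) < 1 by apply/andP; split; lra.
have h := plim_ae_eq measurableT q01 t0 mY' mX err.
by apply: (ae_imply _ h) => w /(_ I).
Qed.

(** The stochastic equation in integrated form, at a single time and with
    coefficients already evaluated along some processes. *)
Definition is_state n (x0 : 'cV[R]_n) (t : R) (phi : R -> Omega -> 'cV[R]_n)
    (psi : R -> Omega -> 'M[R]_(n, l)) (X : Omega -> 'cV[R]_n) :=
  exists2 I, is_ito_integral P B t psi I &
    {ae P, forall w, X w = x0 + time_integral t phi w + I w}.

Lemma state_exists n (x0 : 'cV[R]_n) t (phi : R -> Omega -> 'cV[R]_n)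
    (psi : R -> Omega -> 'M[R]_(n, l)) : 0 <= t ->
  L2ad P B 0 t phi -> L2ad P B 0 t psi ->
  exists2 X, measurable_fun setT (X : at_time B t -> 'cV[R]_n) & is_state x0 t phi psi X.
Proof.
move=> t0 hphi hpsi; have [J mJ JE] := time_integral_version t0 hphi.
have [I hI mI] := ito_integral_exists t0 hpsi.
exists (fun w => x0 + J w + I w).
  by apply: measurable_mxD => //; apply: measurable_mxD.
by exists I => //; apply: (ae_imply _ JE) => w ->.
Qed.

Definition state_constant (t : R) : R := 2 * (2 * t + 2 * (32 * l%:R)).

(** Comparing states at different times as well serves both for the regularity
    in time of one state and, at equal times, for the contraction argument. *)
Lemma state_estimate n (x0 : 'cV[R]_n) s t (phi phi' : R -> Omega -> 'cV[R]_n)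
    (psi psi' : R -> Omega -> 'M[R]_(n, l)) X X' : 0 <= s -> s <= t ->
  L2ad P B 0 s phi -> L2ad P B 0 t phi' ->
  is_state x0 s phi psi X -> is_state x0 t phi' psi' X' ->
  (intsq P setT (fun w => X w - X' w)%R <=
   (state_constant t)%:E * (msq P t (psub (cutoff s phi) phi') +
     msq P t (psub (cutoff s psi) psi')))%E.
Proof.
move=> s0 st [jphi _ phi2] [jphi' _ phi2'] [I hI XE] [I' hI' XE'].
have t0 := le_trans s0 st.
have mI : measurable_fun setT I by case: hI.
have mI' : measurable_fun setT I' by case: hI'.
have mJ := measurable_path_integral jphi; have mJ' := measurable_path_integral jphi'.
pose DJ w := time_integral s phi w - time_integral t phi' w.
have -> : intsq P setT (fun w => X w - X' w) = intsq P setT (fun w => DJ w + (I w - I' w)).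
  apply: ae_ge0_eq_integral_any.
  - by move=> w _; rewrite lee_fin sqnorm_ge0.
  - by move=> w _; rewrite lee_fin sqnorm_ge0.
  apply: filterS2 XE XE' => w -> -> _; congr (sqnorm _)%:E; rewrite /DJ.
  by apply/matrixP => i j; rewrite !mxE; ring.
have mDJ : measurable_fun setT DJ by exact: measurable_mxB.
apply: le_trans (intsqD_le2 P measurableT mDJ (measurable_mxB measurableT mI mI')) _.
have c0 : 0 <= 2 * t by rewrite mulr_ge0.
have c1 : 0 <= 2 * (32 * l%:R) :> R by rewrite !mulr_ge0.
apply: (@le_trans _ _ ((2 * t)%:E * msq P t (psub (cutoff s phi) phi') +
   (2 * (32 * l%:R))%:E * msq P t (psub (cutoff s psi) psi'))%E).
  rewrite !(EFinM 2) -!muleA; apply: leeD; apply: lee_wpmul2l => //.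
    exact: time_integral_estimate.
  exact: (ito_estimate bmB st hI hI').
have p1 := msq_ge0 P t (psub (cutoff s phi) phi').
have p2 := msq_ge0 P t (psub (cutoff s psi) psi').
rewrite (ge0_muleDr _ p1 p2); apply: leeD; apply: lee_wpmul2r => //;
  by rewrite lee_fin /state_constant; move: c0 c1; lra.
Qed.

End state.

Section state_process.
Context {d : measure_display} {Omega : measurableType d} {R : realType}.
Variable P : probability Omega R.
Local Notation mu := (@lebesgue_measure R).
Local Notation step m n := (@step_process d Omega R m n).
Context {l : nat}.
Variable B : R -> Omega -> 'cV[R]_l.
Hypothesis bmB : is_brownian_motion P B.

Let mB := bm_measurable bmB.

(** Absolute continuity of the mean square integral. *)
Lemma msq_increment_small m n (T e : R) (phi : R -> Omega -> 'M[R]_(m, n)) :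
  jointly_measurable T phi -> (msq P T phi < +oo)%E -> 0 < e ->
  exists2 delta, 0 < delta & forall s t, 0 <= s -> s <= t -> t <= T -> t - s < delta ->
    (msq P t (psub (cutoff s phi) phi) <= e%:E)%E.
Proof.
move=> jphi phi2 e0.
have mslab := measurable_slab (measurable_itv `[0, T]) (T2 := Omega).
pose g s := intsq P setT (phi s).
have g0 s : (0 <= g s)%E by exact: intsq_ge0.
have mg : measurable_fun `[0, T]%classic g.
  have := @measurable_slab_integral _ _ _ _ _ P _ (measurable_itv `[0, T]) _
    (measurable_EFin_sqnorm mslab jphi).
  by apply=> p _; rewrite lee_fin sqnorm_ge0.
have ig : mu.-integrable `[0, T]%classic g.
  apply/integrableP; split => //; under eq_integral do rewrite gee0_abs //.
  by rewrite -msqE.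
have := (integrable_mkcond (mu := mu) g (measurable_itv `[0, T])).1 ig.
set g' := (X in integrable _ _ X) => ig'.
have g'0 s : (0 <= g' s)%E by rewrite /g' patchE; case: ifP.
have if_ : mu.-integrable setT (EFin \o (fine \o g')).
  have mg' : measurable_fun setT g' by case/integrableP: ig'.
  apply/integrableP; split.
    by apply/measurable_EFinP; apply: (measurableT_comp (@fine_measurable R setT measurableT)).
  case/integrableP: ig' => _; apply: le_lt_trans.
  apply: ae_ge0_le_integral_any => //; apply: aeW => s _ /=.
  by rewrite (gee0_abs (g'0 s)) ger0_norm ?fine_ge0 //; case: (g' s) (g'0 s).
have [delta [delta0 hd]] := integral_normr_continuous if_ e0.
exists delta => // s t s0 st tT ts.
have /hd {hd} : (mu `]s, t]%classic < delta%:E)%E.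
  by rewrite lebesgue_measure_itv /= lte_fin; case: ifP => _; rewrite lte_fin.
move=> /(_ (measurable_itv _)) hd.
apply: (@le_trans _ _ (\int[mu]_(r in `]s, t]) g' r)%E).
  rewrite msqE [leLHS]integral_mkcond [leRHS]integral_mkcond.
  apply: ae_ge0_le_integral_any => [r _|r _|].
  - by rewrite patchE; case: ifP => // _; exact: intsq_ge0.
  - by rewrite patchE; case: ifP.
  apply: aeW => r _; rewrite !patchE !mem_setE !in_itv /=.
  have [r0|] := leP 0 r => /=; last by case: ifP.
  have [rt|//] := leP r t; last by case: ifP.
  have [rs|sr] := leP r s => /=.
    have -> : psub (cutoff s phi) phi r = fun=> 0.
      by apply/funext => w; rewrite /psub /cutoff rs subrr.
    by rewrite intsq0.
  rewrite /g' patchE mem_setE in_itv /= r0 (le_trans rt tT) /= /g /intsq.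
  rewrite le_eqVlt; apply/orP; left; apply/eqP; apply: eq_integral => w _.
  by rewrite /psub /cutoff leNgt sr /= sub0r sqnormN.
have mst : measurable (`]s, t]%classic : set (measurableTypeR R)) by exact: measurable_itv.
have i1 := integrable_abse (integrableS measurableT mst (@subsetT _ _) if_).
have fin : (\int[mu]_(r in `]s, t]) (`|(fine \o g') r|)%:E)%E \is a fin_num.
  exact: (integrable_fin_num mst i1).
apply: (@le_trans _ _ (\int[mu]_(r in `]s, t]) (`|(fine \o g') r|)%:E)%E); last first.
  by rewrite -(fineK fin) lee_fin ltW.
apply: ae_ge0_le_integral_any => //.
have := integrable_ae measurableT ig'; apply: filterS => r /(_ I) fr _ /=.
by rewrite ger0_norm ?fine_ge0 // fineK.
Qed.

Lemma L2ad0 t m n : L2ad P B 0 t (fun _ _ => 0 : 'M[R]_(m, n)).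
Proof.
split; first exact: measurable_cst.
  by move=> s _; apply/measurable_wrtP; exact: measurable_cst.
rewrite -[X in (X < _)%E]/(msq P t (fun _ _ => 0 : 'M[R]_(m, n))) msqE.
by under eq_integral do rewrite intsq0; rewrite integral0.
Qed.

Lemma is_state0 n (x0 : 'cV[R]_n) t : 0 <= t ->
  is_state P B x0 t (fun _ _ => 0) (fun _ _ => 0) (fun=> x0).
Proof.
move=> t0; exists (fun=> 0); last first.
  apply: aeW => w; rewrite addr0; apply/matrixP => i j; rewrite !mxE.
  by rewrite /Rintegral integral0_eq ?addr0 // => s _; rewrite mxE.
split; [exact: L2ad0|exact: measurable_cst|].
pose S : step n l := @StepProcess _ _ _ _ _ 1 (fun i => if i is 0%N then 0 else t) (fun _ _ => 0).
exists (fun=> S); split.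
- move=> _; split => // [[]//|i _|i _].
    by apply/measurable_wrtP; exact: measurable_cst.
  by rewrite expectation_mxnorm2 intsq0.
- apply: cvg_near_cst; apply: nearW => k.
  have -> : step_eval S = fun _ _ => 0.
    by apply/funext => s; apply/funext => w; rewrite /step_eval big1 // => i _; rewrite scaler0.
  rewrite -[LHS]/(msq P t (fun _ _ => 0 - 0 : 'M[R]_(n, l))) msqE.
  by under eq_integral do rewrite subrr intsq0; rewrite integral0.
- apply: cvg_near_cst; apply: nearW => k; rewrite expectation_mxnorm2.
  rewrite -(intsq0 P setT n 1); congr intsq; apply/funext => w.
  by rewrite /step_integral big1 ?subrr // => i _; rewrite mul0mx.
Qed.

Lemma state_constant_ge0 t : 0 <= t -> 0 <= @state_constant R l t.
Proof. by move=> t0; rewrite /state_constant mulr_ge0 // addr_ge0 // !mulr_ge0. Qed.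

Lemma state_constant_mono s t : s <= t -> @state_constant R l s <= @state_constant R l t.
Proof. by move=> st; rewrite /state_constant; lra. Qed.

(** The values of the state at the times of finer and finer grids converge, at
    each time, to the state at that time; their limit is a version which is
    measurable jointly in time and chance. *)
Lemma state_process n (x0 : 'cV[R]_n) T (phi : R -> Omega -> 'cV[R]_n)
    (psi : R -> Omega -> 'M[R]_(n, l)) : 0 < T ->
  L2ad P B 0 T phi -> L2ad P B 0 T psi ->
  exists2 x, L2ad P B 0 T x & forall t, t \in `[0, T] -> is_state P B x0 t phi psi (x t).
Proof.
move=> T0 hphi hpsi.
have [jphi _ phi2] := hphi; have [jpsi _ psi2] := hpsi.
have /choice[X hX] (t : R) : exists X : Omega -> 'cV[R]_n, 0 <= t <= T ->
    measurable_fun setT (X : at_time B t -> 'cV[R]_n) /\ is_state P B x0 t phi psi X.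
  have [/andP[t0 tT]|_] := boolP (0 <= t <= T); last by exists (fun=> 0).
  have [X mX sX] := state_exists bmB x0 t0 (L2ad_sub tT hphi) (L2ad_sub tT hpsi).
  by exists X.
pose c := @state_constant R l T; have c0 : 0 <= c by apply: state_constant_ge0; exact: ltW.
have estim s t : 0 <= s -> s <= t -> t <= T ->
    (intsq P setT (fun w => X s w - X t w)%R <=
     c%:E * (msq P t (psub (cutoff s phi) phi) + msq P t (psub (cutoff s psi) psi)))%E.
  move=> s0 st tT; have t0 := le_trans s0 st; have sT := le_trans st tT.
  have [|_ Xs] := hX s; first by rewrite s0.
  have [|_ Xt] := hX t; first by rewrite t0.
  apply: le_trans (state_estimate bmB s0 st (L2ad_sub sT hphi) (L2ad_sub tT hphi) Xs Xt) _.
  apply: lee_wpmul2r; first by apply: adde_ge0; exact: msq_ge0.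
  by rewrite lee_fin; exact: state_constant_mono.
pose q : R := (1 / 2) ^+ 2; have q01 : 0 < q < 1 by rewrite /q; apply/andP; split; lra.
have /choice[N hN] (k : nat) : exists N : nat, forall s t, 0 <= s -> s <= t -> t <= T ->
    t - s < T / N.+1%:R ->
    (intsq P setT (fun w => X s w - X t w)%R <= (c * 2 * q ^+ k)%:E)%E.
  have e0 : 0 < q ^+ k by rewrite exprn_gt0 //; case/andP: q01.
  have [d1 d10 h1] := msq_increment_small jphi phi2 e0.
  have [d2 d20 h2] := msq_increment_small jpsi psi2 e0.
  have dm0 : 0 < Num.min d1 d2 by rewrite lt_min d10.
  have [M _ hM] : \forall M \near \oo, T * harmonic M < Num.min d1 d2.
    have cv : T * harmonic M @[M --> \oo] --> (0 : R).
      by rewrite -(mulr0 T); apply: cvgM; [exact: cvg_cst|exact: cvg_harmonic].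
    exact: (cvgr_lt _ cv).
  exists M => s t s0 st tT /lt_trans /(_ (hM M (leqnn M))).
  rewrite lt_min => /andP[ts1 ts2]; apply: le_trans (estim s t s0 st tT) _.
  apply: (@le_trans _ _ (c%:E * ((q ^+ k)%:E + (q ^+ k)%:E))%E).
    apply: lee_wpmul2l; first by rewrite lee_fin.
    by apply: leeD; [exact: h1|exact: h2].
  by rewrite -EFinD -EFinM lee_fin le_eqVlt; apply/orP; left; apply/eqP; ring.
pose h k : R := T / (N k).+1%:R; have h0 k : 0 < h k by rewrite divr_gt0.
have Nh k : (N k).+1%:R * h k = T by rewrite /h mulrC divfK // pnatr_eq0.
(* One cell more than needed to cover [0, T[, so that the time T has one too. *)
pose Y (k : nat) (s : R) w := \sum_(i < (N k).+2)
  (\1_(`[(i%:R * h k)%R, (i.+1%:R * h k)%R[%classic) s : R) *: X (i%:R * h k) w.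
have iT k i : (i < (N k).+2)%N -> 0 <= i%:R * h k <= T.
  move=> iN; rewrite mulr_ge0 ?(ltW (h0 k)) //= -(Nh k).
  by rewrite ler_wpM2r ?(ltW (h0 k)) // ler_nat.
have YE k s : 0 <= s <= T -> exists r, [/\ 0 <= r, r <= s, s - r < h k & Y k s = X r].
  move=> /andP[s0 sT]; have [|i iN si] := @cell_exists _ (h k) s (N k).+2.
    by rewrite s0 /= (le_lt_trans sT) // -{1}(Nh k) ltr_pM2r // ltr_nat.
  exists (i%:R * h k); have /andP[is_ si'] := si; split => //.
  - by case/andP: (iT k i iN).
  - by rewrite ltrBlDr (lt_le_trans si') // -addn1 natrD mulrDl mul1r addrC.
  - by apply/funext => w; rewrite /Y (sum_cells (fun i => X (i%:R * h k) w) (h0 k) iN si).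
have mYs k s : 0 <= s <= T -> measurable_fun setT (Y k s : at_time B s -> 'cV[R]_n).
  move=> sI; have [r [r0 rs _ ->]] := YE k s sI; apply: (at_time_mono rs).
  by have [|] := hX r; rewrite ?r0 // (le_trans rs) //; case/andP: sI.
have jY k : jointly_measurable T (Y k).
  apply: measurable_mx_sum => [|i]; first exact: measurable_slab.
  apply: measurable_mxZ; first exact: measurable_slab.
    by apply: measurable_funTS; apply: measurableT_comp => //; exact: measurable_indic.
  apply: measurable_funTS; apply: measurableT_comp => //.
  by have [m _] := hX _ (iT k i (ltn_ord i)); exact: (at_time_measurable mB m).
pose x s := plim (fun k => Y k s).
have xX s : 0 <= s <= T -> {ae P, forall w, x s w = X s w}.
  move=> sI; have [mX _] := hX s sI.
  have err k : (intsq P setT (fun w => Y k s w - X s w)%R <= (c * 2 * q ^+ k)%:E)%E.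
    have [r [r0 rs sr ->]] := YE k s sI; apply: hN => //; by case/andP: sI.
  have c20 : 0 <= c * 2 by rewrite mulr_ge0.
  have hae := plim_ae_eq measurableT q01 c20
    (fun k => at_time_measurable mB (mYs k s sI)) (at_time_measurable mB mX) err.
  by apply: (ae_imply _ hae) => w /(_ I).
have st t : t \in `[0, T] -> is_state P B x0 t phi psi (x t).
  rewrite in_itv /= => tI; have [_ [I hI XE]] := hX t tI; exists I => //.
  by apply: filterS2 (xX t tI) XE => w ->.
have mx s : 0 <= s <= T -> measurable_fun setT (x s : at_time B s -> 'cV[R]_n).
  by move=> sI; apply: measurable_plim => // k; exact: mYs.
exists x => //; split.
- have -> : (fun p : R * Omega => x p.1 p.2) = plim (fun k p => Y k p.1 p.2).
    by apply/funext => -[s w].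
  apply: measurable_plim => [|k]; [exact: measurable_slab|exact: jY].
- by move=> s; rewrite in_itv /= => sI; apply/measurable_wrtP; exact: mx.
rewrite -[X in (X < _)%E]/(msq P T x) msqE.
have fin : (msq P T phi + msq P T psi)%E \is a fin_num.
  by rewrite fin_numD !ge0_fin_numE ?phi2 // msq_ge0.
pose M := 2 * (c * fine (msq P T phi + msq P T psi)) + 2 * sqnorm x0.
have M0 : 0 <= M.
  have f0 : 0 <= fine (msq P T phi + msq P T psi).
    by apply: fine_ge0; apply: adde_ge0; exact: msq_ge0.
  by rewrite addr_ge0 // mulr_ge0 ?sqnorm_ge0 // mulr_ge0.
apply: (@le_lt_trans _ _ (\int[mu]_(s in `[0%R, T]) (cst M%:E) s)%E); last first.
  by rewrite integral_cst //= lebesgue_measure_itv /= lte_fin T0 -EFinB -EFinM ltry.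
apply: ae_ge0_le_integral_any => [s _|s _|]; first exact: intsq_ge0.
  by rewrite lee_fin.
apply: aeW => s; rewrite /= => sI; have s0T : 0 <= s <= T by rewrite in_itv in sI.
have [s0 sT] := andP s0T.
have e1 := state_estimate bmB s0 (lexx s) (L2ad_sub sT hphi) (L2ad0 s n 1) (st s sI)
  (is_state0 x0 s0).
have mxs := at_time_measurable mB (mx s s0T).
apply: (@le_trans _ _ (2%:E * intsq P setT (fun w => x s w - x0)%R +
    2%:E * intsq P setT (fun=> x0))%E).
  apply: intsq_lin => //; first exact: measurable_mxB.
  apply: aeW => w _; rewrite -{1}(subrK x0 (x s w)); exact: sqnormD_le2.
have -> : (intsq P setT (fun=> x0) = (sqnorm x0)%:E)%E.
  by rewrite /intsq integral_cst //= [P _]probability_setT mule1.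
have -> : (M%:E = 2%:E * (c%:E * (msq P T phi + msq P T psi)) + 2%:E * (sqnorm x0)%:E)%E.
  by rewrite /M EFinD !EFinM fineK.
apply: leeD => //; apply: lee_wpmul2l => //; apply: le_trans e1 _.
have ph k m (f : R -> Omega -> 'M[R]_(k, m)) :
    (msq P s (psub (cutoff s f) (fun _ _ => 0%R)) <= msq P T f)%E.
  rewrite msq_cutoff_same; apply: le_trans (msq_mono P f sT).
  rewrite le_eqVlt; apply/orP; left; apply/eqP; apply: eq_msq.
  by apply: aeW => r _; apply: aeW => w; rewrite /psub subr0.
apply: (@le_trans _ _ (c%:E * (msq P s (psub (cutoff s phi) (fun _ _ => 0%R)) +
    msq P s (psub (cutoff s psi) (fun _ _ => 0%R))))%E).
  apply: lee_wpmul2r; first by apply: adde_ge0; exact: msq_ge0.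
  by rewrite lee_fin; exact: state_constant_mono.
by apply: lee_wpmul2l; [rewrite lee_fin|apply: leeD; exact: ph].
Qed.

End state_process.

(** * Hilbert space identities and coefficient processes *)

Lemma ae_imply2 d (T : measurableType d) (R : realType)
    (mu : {measure set T -> \bar R}) (Q Q' W : T -> Prop) :
  (forall x, Q x -> Q' x -> W x) ->
  {ae mu, forall x, Q x} -> {ae mu, forall x, Q' x} -> {ae mu, forall x, W x}.
Proof. by move=> QW; apply: filterS2. Qed.

Lemma measurable_pair_on d d1 d2 (T : measurableType d) (T1 : measurableType d1)
    (T2 : measurableType d2) (D : set T) (f : T -> T1) (g : T -> T2) : measurable D ->
  measurable_fun D f -> measurable_fun D g -> measurable_fun D (fun x => (f x, g x)).
Proof.
move=> mD mf mg.
apply: (measurability (preimage_set_system setT fst (@measurable _ T1) `|`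
  preimage_set_system setT snd (@measurable _ T2))) => //.
move=> _ [_ [[A mA <-]|[A mA <-]] <-]; rewrite setTI.
  exact: mf.
exact: mg.
Qed.

Section hilbert.
Context {d : measure_display} {Omega : measurableType d} {R : realType}.
Variable P : probability Omega R.
Local Notation mu := (@lebesgue_measure R).

Lemma norm_H_sqr t m n (phi : R -> Omega -> 'M[R]_(m, n)) :
  norm_H P 0 t phi ^+ 2 = fine (msq P t phi).
Proof. by rewrite sqr_sqrtr // fine_ge0 // (msq_ge0 P t phi). Qed.

Lemma norm_H_ge0 t m n (phi : R -> Omega -> 'M[R]_(m, n)) : 0 <= norm_H P 0 t phi.
Proof. exact: sqrtr_ge0. Qed.

Lemma ae_restrict t T (Q : R -> Prop) : t <= T ->
  {ae mu, forall s, s \in `[0, T] -> Q s} -> {ae mu, forall s, s \in `[0, t] -> Q s}.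
Proof.
move=> tT hae; apply: (ae_imply _ hae) => s + st; apply; move: st.
by rewrite !in_itv /= => /andP[-> /le_trans ->].
Qed.

Lemma eq_L2_sub t T m n (phi psi : R -> Omega -> 'M[R]_(m, n)) : t <= T ->
  eq_L2 P 0 T phi psi -> eq_L2 P 0 t phi psi.
Proof. exact: ae_restrict. Qed.

Lemma eq_L2_psub t m n (phi phi' psi psi' : R -> Omega -> 'M[R]_(m, n)) :
  eq_L2 P 0 t phi phi' -> eq_L2 P 0 t psi psi' ->
  eq_L2 P 0 t (psub phi psi) (psub phi' psi').
Proof.
move=> h1 h2; apply: (ae_imply2 _ h1 h2) => s {}h1 {}h2 sI.
by apply: (ae_imply2 _ (h1 sI) (h2 sI)) => w; rewrite /psub => -> ->.
Qed.

Lemma eq_L2_msq t m n (phi psi : R -> Omega -> 'M[R]_(m, n)) :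
  eq_L2 P 0 t phi psi -> msq P t phi = msq P t psi.
Proof.
move=> hae; apply: eq_msq; apply: (ae_imply _ hae) => s h /h h'.
by apply: (ae_imply _ h') => w ->.
Qed.

Lemma eq_L2_norm_H t m n (phi psi : R -> Omega -> 'M[R]_(m, n)) :
  eq_L2 P 0 t phi psi -> norm_H P 0 t phi = norm_H P 0 t psi.
Proof. by move=> /eq_L2_msq h; rewrite /norm_H; congr (Num.sqrt (fine _)). Qed.

Lemma eq_L2_inner_H t m n (phi phi' psi : R -> Omega -> 'M[R]_(m, n)) :
  eq_L2 P 0 t phi phi' -> inner_H P 0 t phi psi = inner_H P 0 t phi' psi.
Proof.
move=> hae; rewrite /inner_H; congr fine; apply: ae_eq_integral_any.
apply: (ae_imply _ hae) => s h /h h'; rewrite unlock; apply: ae_eq_integral_any.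
by apply: (ae_imply _ h') => w /= -> _.
Qed.

Lemma msq_subr_eq0 t m n (phi psi : R -> Omega -> 'M[R]_(m, n)) :
  eq_L2 P 0 t phi psi -> msq P t (psub phi psi) = 0%E.
Proof.
move=> hae; rewrite (@eq_msq _ _ _ P t m n m n _ (fun _ _ => 0)).
  by rewrite msqE; under eq_integral do rewrite intsq0; rewrite integral0.
apply: (ae_imply _ hae) => s h /h h'.
by apply: (ae_imply _ h') => w; rewrite /psub => ->; rewrite subrr.
Qed.

Lemma norm_H_subrr t m n (phi : R -> Omega -> 'M[R]_(m, n)) :
  norm_H P 0 t (psub phi phi) = 0.
Proof.
apply/eqP; rewrite -sqrf_eq0 norm_H_sqr msq_subr_eq0 //.
by apply: aeW => s _; exact: aeW.
Qed.

(** The mixed term is integrable over the product space, so that Fubini's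
    theorem identifies its integral with the inner product. *)
Lemma msq_sub_scale t (rho : R) m n (X G : R -> Omega -> 'M[R]_(m, n)) :
  jointly_measurable t X -> jointly_measurable t G ->
  (msq P t X < +oo)%E -> (msq P t G < +oo)%E ->
  fine (msq P t (fun s w => X s w - rho *: G s w)) =
  fine (msq P t X) - 2 * rho * inner_H P 0 t G X + rho ^+ 2 * fine (msq P t G).
Proof.
move=> jX jG X2 G2.
pose D := (`[0, t]%classic `*` [set: Omega]).
have mI : measurable (`[0, t]%classic : set (measurableTypeR R)) by exact: measurable_itv.
have mD : measurable (D : set (measurableTypeR R * Omega)%type).
  exact: (measurable_slab (measurable_itv `[0, t])).
pose nu := (mu \x P)%E.
have jZ : jointly_measurable t (fun s w => rho *: G s w) by exact: measurable_mxZ.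
have isq p q (Y : R -> Omega -> 'M[R]_(p, q)) : jointly_measurable t Y ->
    (msq P t Y < +oo)%E -> nu.-integrable D (fun p => (sqnorm (Y p.1 p.2))%:E).
  move=> jY; rewrite msq_slab // => Y2.
  apply/integrableP; split; first exact: measurable_EFin_sqnorm.
  by under eq_integral do rewrite gee0_abs ?lee_fin ?sqnorm_ge0 //.
have iX := isq _ _ X jX X2; have iG := isq _ _ G jG G2.
have mdot : measurable_fun D (fun p => (mxdot (G p.1 p.2) (X p.1 p.2))%:E).
  by apply/measurable_EFinP; exact: measurable_mxdot.
have idot : nu.-integrable D (fun p => (mxdot (G p.1 p.2) (X p.1 p.2))%:E).
  have iGX := integrableD mD iG iX; move: iGX.
  apply: le_integrable => // p Dp /=.
  rewrite lee_fin [leRHS]ger0_norm ?addr_ge0 ?sqnorm_ge0 //.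
  have := mxdot_le (G p.1 p.2) (X p.1 p.2).
  by have := normr_ge0 (mxdot (G p.1 p.2) (X p.1 p.2)); lra.
have -> : inner_H P 0 t G X = fine (\int[nu]_(p in D) (mxdot (G p.1 p.2) (X p.1 p.2))%:E).
  rewrite /inner_H; congr fine.
  rewrite (fubini_slab mI idot); apply: eq_integral => s _.
  by rewrite unlock.
rewrite !msq_slab //; last exact: jmB.
rewrite /intsq.
have iZ : nu.-integrable D (fun p => (- (2 * rho))%:E * (mxdot (G p.1 p.2) (X p.1 p.2))%:E)%E.
  exact: integrableZl.
have iW : nu.-integrable D (fun p => (rho ^+ 2)%:E * (sqnorm (G p.1 p.2))%:E)%E.
  exact: integrableZl.
have -> : (\int[nu]_(p in D) (sqnorm (X p.1 p.2 - rho *: G p.1 p.2))%:E =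
   \int[nu]_(p in D) (((sqnorm (X p.1 p.2))%:E +
      (- (2 * rho))%:E * (mxdot (G p.1 p.2) (X p.1 p.2))%:E) +
      (rho ^+ 2)%:E * (sqnorm (G p.1 p.2))%:E))%E.
  apply: eq_integral => p _; rewrite -!EFinM -!EFinD; congr EFin.
  by rewrite sqnormB mxdotZr sqnormZ mxdotC; ring.
rewrite (integralD mD (integrableD mD iX iZ) iW) (integralD mD iX iZ) !integralZl //.
have fX := integrable_fin_num mD iX; have fG := integrable_fin_num mD iG.
have fd := integrable_fin_num mD idot.
rewrite -/D -/nu; move: fX fG fd.
set a := (\int[_]_(_ in _) (sqnorm (X _ _))%:E)%E.
set b := (\int[_]_(_ in _) (sqnorm (G _ _))%:E)%E.
set c := (\int[_]_(_ in _) (mxdot _ _)%:E)%E => /fineK <- /fineK <- /fineK <-.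
by rewrite -!EFinM -!EFinD /=; ring.
Qed.

End hilbert.

Section coefficients.
Context {d : measure_display} {Omega : measurableType d} {R : realType}.
Variable P : probability Omega R.
Local Notation mu := (@lebesgue_measure R).
Context {l n m : nat}.
Variable B : R -> Omega -> 'cV[R]_l.
Hypothesis bmB : is_brownian_motion P B.
Variables (T : R) (p q : nat) (h : R -> 'cV[R]_n -> 'cV[R]_m -> 'M[R]_(p, q)).
Variables (L M : R).
Hypothesis mh : measurable_fun (`[0, T]%classic `*` [set: 'cV[R]_n] `*` [set: 'cV[R]_m])
    (fun p : R * 'cV[R]_n * 'cV[R]_m => h p.1.1 p.1.2 p.2).
Hypothesis hM : forall t x u, t \in `[0, T] ->
  mxnorm2 (h t x u) <= M * (1 + mxnorm2 x + mxnorm2 u).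
Hypothesis hL : forall t1 t2 x1 x2 u1 u2, t1 \in `[0, T] -> t2 \in `[0, T] ->
    mxnorm2 (h t1 x1 u1 - h t2 x2 u2) <=
      L * (`|t1 - t2| + mxnorm2 (x1 - x2) + mxnorm2 (u1 - u2)).

Definition coef_process (x : R -> Omega -> 'cV[R]_n) (u : R -> Omega -> 'cV[R]_m) :
  R -> Omega -> 'M[R]_(p, q) := fun s w => h s (x s w) (u s w).

Lemma mxnorm20 a b : mxnorm2 (0 : 'M[R]_(a, b)) = 0.
Proof. by rewrite /mxnorm2 -[mxdot _ _]/(sqnorm 0) sqnorm0 sqrtr0. Qed.

Lemma coef_lipschitz_sqr s x u x' u' : s \in `[0, T] ->
  sqnorm (h s x u - h s x' u') <=
  (2 * L ^+ 2) * sqnorm (x - x') + (2 * L ^+ 2) * sqnorm (u - u').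
Proof.
move=> sT; have := hL x x' u u' sT sT; rewrite subrr normr0 add0r => hle.
rewrite -!mxnorm2_sqr; set a := mxnorm2 _ in hle *.
set b := mxnorm2 _ in hle *; set c := mxnorm2 (u - u') in hle *.
have a0 : 0 <= a by exact: mxnorm2_ge0.
apply: (@le_trans _ _ ((L * (b + c)) ^+ 2)); first by rewrite ler_pXn2r ?nnegrE ?(le_trans a0).
have : 0 <= L ^+ 2 * (b - c) ^+ 2 by rewrite mulr_ge0 ?sqr_ge0.
by rewrite exprMn !sqrrD sqrrN; lra.
Qed.

Lemma coef_jm x u : jointly_measurable T x -> jointly_measurable T u ->
  jointly_measurable T (coef_process x u).
Proof.
move=> jx ju; rewrite /jointly_measurable.
have -> : (fun r : R * Omega => coef_process x u r.1 r.2) =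
  (fun p : R * 'cV[R]_n * 'cV[R]_m => h p.1.1 p.1.2 p.2) \o
  (fun r : R * Omega => (r.1, x r.1 r.2, u r.1 r.2)) by [].
apply: (measurable_comp _ _ mh).
- by do 2! apply: measurableX => //; exact: measurable_itv.
- by move=> _ [r [/= rT _] <-].
have mS := measurable_slab (measurable_itv `[0, T]) (T2 := Omega).
apply: measurable_pair_on => //; apply: measurable_pair_on => //.
by apply: measurable_funTS; exact: measurable_fst.
Qed.

Lemma coef_adapted x u s : s \in `[0, T] ->
  measurable_fun setT (x s : at_time B s -> 'cV[R]_n) ->
  measurable_fun setT (u s : at_time B s -> 'cV[R]_m) ->
  measurable_fun setT (coef_process x u s : at_time B s -> 'M[R]_(p, q)).
Proof.
move=> sT mx mu_.
have -> : coef_process x u s =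
  (fun p : R * 'cV[R]_n * 'cV[R]_m => h p.1.1 p.1.2 p.2) \o
  (fun w => (s, x s w, u s w)) by [].
apply: (measurable_comp _ _ mh).
- by do 2! apply: measurableX => //; exact: measurable_itv.
- by move=> _ [w _ <-].
by apply: measurable_fun_pair => //; apply: measurable_fun_pair.
Qed.

Lemma coef_msq_lipschitz t x u x' u' : t <= T ->
  jointly_measurable T x -> jointly_measurable T u ->
  jointly_measurable T x' -> jointly_measurable T u' ->
  (msq P t (psub (coef_process x u) (coef_process x' u')) <=
   (2 * L ^+ 2)%:E * (msq P t (psub x x') + msq P t (psub u u')))%E.
Proof.
move=> tT jx ju jx' ju'.
have c0 : 0 <= 2 * L ^+ 2 by rewrite mulr_ge0 ?sqr_ge0.
have p1 := msq_ge0 P t (psub x x'); have p2 := msq_ge0 P t (psub u u').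
rewrite (ge0_muleDr _ p1 p2); apply: msq_lin => //.
- by apply: jmB; apply: (jm_sub tT).
- by apply: jmB; apply: (jm_sub tT).
- by apply: jmB; apply: (jm_sub tT); exact: coef_jm.
move=> s w; rewrite in_itv /= => /andP[s0 st]; apply: coef_lipschitz_sqr.
by rewrite in_itv /= s0 (le_trans st).
Qed.

Lemma coef_L2ad x u : L2ad P B 0 T x -> L2ad P B 0 T u ->
  L2ad P B 0 T (coef_process x u).
Proof.
move=> [jx adx x2] [ju adu u2]; split; first exact: coef_jm.
  move=> s sT; apply/measurable_wrtP; apply: coef_adapted => //.
    by apply/measurable_wrtP; exact: adx.
  by apply/measurable_wrtP; exact: adu.
rewrite -[X in (X < _)%E]/(msq P T (coef_process x u)).
pose Z (k : nat) (r : R) (w : Omega) : 'cV[R]_k := 0.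
have jZ k : jointly_measurable T (Z k) by exact: measurable_cst.
have j1 := coef_jm jx ju; have j0 := coef_jm (jZ _) (jZ _).
apply: (@le_lt_trans _ _ (2%:E * msq P T (psub (coef_process x u) (coef_process (Z n) (Z m)))
   + 2%:E * msq P T (coef_process (Z n) (Z m)))%E).
  apply: msq_lin => //; first exact: jmB.
  move=> s w _; rewrite -{1}(subrK (coef_process (Z n) (Z m) s w) (coef_process x u s w)).
  exact: sqnormD_le2.
apply: lte_add_pinfty; (apply: lte_mul_pinfty; [by rewrite lee_fin|by []|]).
  apply: le_lt_trans (coef_msq_lipschitz (lexx T) jx ju (jZ _) (jZ _)) _.
  have e a (v : R -> Omega -> 'cV[R]_a) : msq P T (psub v (Z a)) = msq P T v.
    by apply: eq_msq; apply: aeW => s _; apply: aeW => w; rewrite /psub subr0.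
  rewrite !e; apply: lte_mul_pinfty; [|by []|exact: lte_add_pinfty].
  by rewrite lee_fin mulr_ge0 ?sqr_ge0.
rewrite msqE; apply: (@le_lt_trans _ _ (\int[mu]_(s in `[0%R, T]) (cst (M ^+ 2)%:E) s)%E); last first.
  rewrite integral_cst //= lebesgue_measure_itv /= lte_fin.
  by case: ifP => _; rewrite ?mule0 ?ltry // -EFinB -EFinM ltry.
apply: ae_ge0_le_integral_any => [s _|s _|]; first exact: intsq_ge0.
  by rewrite lee_fin sqr_ge0.
apply: aeW => s sT; apply: (@le_trans _ _ (\int[P]_w (cst (M ^+ 2)%:E) w)%E); last first.
  by rewrite integral_cst //= [P _]probability_setT mule1.
apply: ae_ge0_le_integral_any => [w _|w _|].
- by rewrite lee_fin sqnorm_ge0.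
- by rewrite lee_fin sqr_ge0.
apply: aeW => w _; rewrite lee_fin -mxnorm2_sqr.
have := hM 0 0 sT; rewrite !mxnorm20 !addr0 mulr1 => le.
have h0 := mxnorm2_ge0 (h s 0 0).
by rewrite ler_pXn2r ?nnegrE // (le_trans h0).
Qed.

End coefficients.

(** * The variational inequality as a fixed point equation *)

Lemma ae_forall_countable d (T : measurableType d) (R : realType)
    (mu : {measure set T -> \bar R}) (I : countType) (Q : I -> T -> Prop) :
  (forall i, {ae mu, forall x, Q i x}) -> {ae mu, forall x, forall i, Q i x}.
Proof.
move=> hQ; pose Q' k x := if unpickle k is Some i then Q i x else True.
have hQ' k : {ae mu, forall x, Q' k x}.
  by rewrite /Q'; case: unpickle => [i|]; [exact: hQ|exact: aeW].
by apply: (ae_imply _ (ae_foralln hQ')) => x hx i; have := hx (pickle i); rewrite /Q' pickleK.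
Qed.

Lemma ae_and d (T : measurableType d) (R : realType)
    (mu : {measure set T -> \bar R}) (Q Q' : T -> Prop) :
  {ae mu, forall x, Q x} -> {ae mu, forall x, Q' x} -> {ae mu, forall x, Q x /\ Q' x}.
Proof. exact: filterI. Qed.

Section control_update.
Context {d : measure_display} {Omega : measurableType d} {R : realType}.
Variable P : probability Omega R.
Local Notation mu := (@lebesgue_measure R).
Context {l n m : nat}.
Variable B : R -> Omega -> 'cV[R]_l.
Hypothesis bmB : is_brownian_motion P B.
Variables (T : R) (K : set 'cV[R]_m).
Hypothesis T0 : 0 < T.
Hypothesis K0 : K !=set0.
Hypothesis clK : closed K.
Hypothesis cvK : convex_set K.
Variable F : R -> Omega -> 'cV[R]_n -> 'cV[R]_m -> 'cV[R]_m.
Hypothesis wellF : Ftilde_well_defined P T B K F.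
Variables C L : R.
Hypothesis C0 : 0 < C.
Hypothesis CL : C < L.
Hypothesis F_lipschitz :
  forall t (x1 x2 : R -> Omega -> 'cV[R]_n) (u1 u2 : R -> Omega -> 'cV[R]_m),
    t \in `[0, T] ->
    L2ad P B 0 t x1 -> L2ad P B 0 t x2 ->
    Uad P B 0 t K u1 -> Uad P B 0 t K u2 ->
    norm_H P 0 t (psub (Ftilde K F x1 u1) (Ftilde K F x2 u2)) <=
      L * (norm_H P 0 t (psub x1 x2) + norm_H P 0 t (psub u1 u2)).
Hypothesis F_monotone :
  forall t (x : R -> Omega -> 'cV[R]_n) (u1 u2 : R -> Omega -> 'cV[R]_m),
    t \in `[0, T] ->
    L2ad P B 0 t x -> Uad P B 0 t K u1 -> Uad P B 0 t K u2 ->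
    C * norm_H P 0 t (psub u1 u2) ^+ 2 <=
      inner_H P 0 t (psub (Ftilde K F x u1) (Ftilde K F x u2)) (psub u1 u2).

Let mB := bm_measurable bmB.
Let L0 : 0 < L. Proof. exact: lt_trans CL. Qed.

Lemma Uad_sub t (u : R -> Omega -> 'cV[R]_m) : t <= T -> Uad P B 0 T K u -> Uad P B 0 t K u.
Proof. by move=> tT [u1 u2]; split; [exact: L2ad_sub u1|exact: ae_restrict u2]. Qed.

(** The step length for which the map u - rho F(u) contracts best. *)
Definition step_length : R := C / L ^+ 2.
Local Notation rho := step_length.

Let rho0 : 0 < rho. Proof. by rewrite divr_gt0 ?exprn_gt0. Qed.

Definition is_update (x : R -> Omega -> 'cV[R]_n) (u v : R -> Omega -> 'cV[R]_m) :=
  exists phi, [/\ L2ad P B 0 T phi, eq_L2 P 0 T (Ftilde K F x u) phi &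
    v = fun s w => nearest K (u s w - rho *: phi s w)].

Lemma update_exists x u : L2ad P B 0 T x -> Uad P B 0 T K u -> exists v, is_update x u v.
Proof.
move=> hx hu; have [phi h1 h2] := wellF (lexx 0) (ltW T0) (lexx T) hx hu.
by exists (fun s w => nearest K (u s w - rho *: phi s w)), phi.
Qed.

Lemma update_in x u v : is_update x u v -> forall s w, K (v s w).
Proof. by move=> [phi [_ _ ->]] s w; exact: nearest_in. Qed.

Lemma L2ad_intro (v : R -> Omega -> 'cV[R]_m) : jointly_measurable T v ->
  (forall s, s \in `[0, T] -> measurable_fun setT (v s : at_time B s -> 'cV[R]_m)) ->
  (msq P T v < +oo)%E -> L2ad P B 0 T v.
Proof. by move=> jv adv v2; split => // s sT; apply/measurable_wrtP; exact: adv. Qed.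

Lemma L2ad_cst (a : 'cV[R]_m) : L2ad P B 0 T (fun _ _ => a).
Proof.
apply: L2ad_intro => //.
  exact: measurable_cst.
rewrite msqE; apply: (@le_lt_trans _ _ (\int[mu]_(s in `[0%R, T]) (cst (sqnorm a)%:E) s)%E).
  apply: ae_ge0_le_integral_any => [s _|s _|]; first exact: intsq_ge0.
    by rewrite lee_fin sqnorm_ge0.
  apply: aeW => s _.
  by rewrite /intsq integral_cst //= [P _]probability_setT mule1.
by rewrite integral_cst //= lebesgue_measure_itv /= lte_fin T0 -EFinB -EFinM ltry.
Qed.

Lemma L2ad_adapted (v : R -> Omega -> 'cV[R]_m) s : L2ad P B 0 T v -> s \in `[0, T] ->
  measurable_fun setT (v s : at_time B s -> 'cV[R]_m).
Proof. by move=> [_ adv _] sT; apply/measurable_wrtP; exact: adv. Qed.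

Lemma update_Uad x u v : Uad P B 0 T K u -> is_update x u v -> Uad P B 0 T K v.
Proof.
move=> [hu _] hv; split; last first.
  by apply: aeW => s _; apply: aeW => w; exact: (update_in hv).
case: hv => phi [hphi _ ->]; have [ju _ u2] := hu; have [jphi _ phi2] := hphi.
have jS := measurable_slab (measurable_itv `[0, T]) (T2 := Omega).
have jq : jointly_measurable T (fun s w => u s w - rho *: phi s w).
  by apply: measurable_mxB => //; exact: measurable_mxZ.
have jv : jointly_measurable T (fun s w => nearest K (u s w - rho *: phi s w)).
  exact: (measurableT_comp (measurable_nearest K0 clK cvK) jq).
apply: L2ad_intro => //.
  move=> s sT; apply: (measurableT_comp (measurable_nearest K0 clK cvK)).
  apply: measurable_mxB => //; first exact: (L2ad_adapted hu).
  by apply: measurable_mxZ => //; exact: (L2ad_adapted hphi).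
pose p0 := nearest K 0.
apply: (@le_lt_trans _ _ (2%:E * msq P T (fun s w => u s w - rho *: phi s w)%R +
    2%:E * msq P T (fun _ _ => p0))%E).
  apply: msq_lin => //; first exact: measurable_cst.
  move=> s w _; set q := u s w - _; rewrite -{1}(subrK p0 (nearest K q)).
  apply: le_trans (sqnormD_le2 _ _) _; rewrite lerD2r ler_pM2l //.
  by rewrite -{2}[q]subr0; exact: nearest_nonexpansive.
apply: lte_add_pinfty; (apply: lte_mul_pinfty; [by rewrite lee_fin|by []|]); last first.
  by case: (L2ad_cst p0).
rewrite msq_slab //; apply: intsqB_lty => //.
- exact: measurable_mxZ.
- by rewrite -(msq_slab P).
- rewrite intsqZ // -(msq_slab P) //.
  by apply: lte_mul_pinfty => //; rewrite lee_fin sqr_ge0.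
Qed.

Let theta0 : R := 1 - C ^+ 2 / L ^+ 2.
Let theta0_gt0 : 0 < theta0.
Proof.
rewrite subr_gt0 ltr_pdivrMr ?exprn_gt0 // mul1r ltr_pXn2r ?nnegrE //; exact: ltW.
Qed.
Let theta0_lt1 : theta0 < 1.
Proof. by rewrite ltrBlDr ltrDl divr_gt0 // exprn_gt0. Qed.

(** Strong monotonicity and the Lipschitz bound make the explicit step a strict
    contraction in the control. *)
Lemma explicit_step_contracts t x u u' phi phi' : t \in `[0, T] ->
  L2ad P B 0 T x -> Uad P B 0 T K u -> Uad P B 0 T K u' ->
  L2ad P B 0 T phi -> L2ad P B 0 T phi' ->
  eq_L2 P 0 T (Ftilde K F x u) phi -> eq_L2 P 0 T (Ftilde K F x u') phi' ->
  (msq P t (fun s w => (psub u u' s w - rho *: psub phi phi' s w)%R) <=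
   theta0%:E * msq P t (psub u u'))%E.
Proof.
move=> tI hx hu hu' hphi hphi' e e'; have tT : t <= T by rewrite in_itv in tI; case/andP: tI.
have hxt := L2ad_sub tT hx; have hut := Uad_sub tT hu; have hut' := Uad_sub tT hu'.
have eG := eq_L2_psub (eq_L2_sub tT e) (eq_L2_sub tT e').
have mono := F_monotone tI hxt hut hut'; rewrite (eq_L2_inner_H _ eG) in mono.
have lip := F_lipschitz tI hxt hxt hut hut'.
rewrite (eq_L2_norm_H eG) norm_H_subrr add0r in lip.
have jsub a b : L2ad P B 0 T a -> L2ad P B 0 T b ->
    jointly_measurable t (@psub d Omega R m 1 a b) /\ (msq P t (psub a b) < +oo)%E.
  move=> /(L2ad_sub tT)[ja _ a2] /(L2ad_sub tT)[jb _ b2]; split; first exact: jmB.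
  have mS := measurable_slab (measurable_itv `[0, t]) (T2 := Omega).
  rewrite (msq_slab P (jmB ja jb)); apply: intsqB_lty => //; by rewrite -(msq_slab P).
have [ju u2] := jsub _ _ hu.1 hu'.1; have [jG G2] := jsub _ _ hphi hphi'.
have jS := measurable_slab (measurable_itv `[0, t]) (T2 := Omega).
have jD : jointly_measurable t (fun s w => psub u u' s w - rho *: psub phi phi' s w).
  by apply: measurable_mxB => //; exact: measurable_mxZ.
have D2 : (msq P t (fun s w => (psub u u' s w - rho *: psub phi phi' s w)%R) < +oo)%E.
  rewrite msq_slab //; apply: intsqB_lty => //.
  - exact: measurable_mxZ.
  - by rewrite -(msq_slab P).
  - rewrite intsqZ // -(msq_slab P) //.
    by apply: lte_mul_pinfty => //; rewrite lee_fin sqr_ge0.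
have fD : msq P t (fun s w => (psub u u' s w - rho *: psub phi phi' s w)%R) \is a fin_num.
  exact: msq_fin D2.
have fu := msq_fin u2.
rewrite -(fineK fD) -(fineK fu) -EFinM lee_fin (msq_sub_scale _ ju jG u2 G2) -!norm_H_sqr.
move: mono lip; set N := norm_H P 0 t (psub u u'); set G := norm_H _ _ _ _ => mono lip.
have G0 : 0 <= G by exact: norm_H_ge0.
have lip2 : G ^+ 2 <= L ^+ 2 * N ^+ 2.
  by rewrite -exprMn ler_pXn2r ?nnegrE //; exact: le_trans lip.
have r1 : rho * (C * N ^+ 2) <= rho * inner_H P 0 t (psub phi phi') (psub u u').
  by rewrite ler_pM2l.
have r2 : rho ^+ 2 * G ^+ 2 <= rho ^+ 2 * (L ^+ 2 * N ^+ 2).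
  by rewrite ler_pM2l // exprn_gt0 //; exact: rho0.
have e1 : rho * (C * N ^+ 2) = C ^+ 2 / L ^+ 2 * N ^+ 2 by rewrite /rho; ring.
have e2 : rho ^+ 2 * (L ^+ 2 * N ^+ 2) = C ^+ 2 / L ^+ 2 * N ^+ 2.
  by rewrite /rho; field; rewrite gt_eqF.
move: r1 r2; rewrite e1 e2 /theta0; set Q := C ^+ 2 / _; lra.
Qed.

(** The difference of two explicit steps is split into a part where only the
    control changes, which contracts, and a part where only the state changes;
    Young's inequality with a small parameter keeps the first factor below 1. *)
Lemma update_contraction : exists theta kappa, [/\ 0 < theta < 1, 0 <= kappa &
  forall x x' u u' v v', L2ad P B 0 T x -> L2ad P B 0 T x' ->
    Uad P B 0 T K u -> Uad P B 0 T K u' -> is_update x u v -> is_update x' u' v' ->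
    forall t, t \in `[0, T] ->
    (msq P t (psub v v') <= theta%:E * msq P t (psub u u') +
      kappa%:E * msq P t (psub x x'))%E].
Proof.
pose theta := (1 + theta0) / 2; pose eta := (theta - theta0) / theta0.
have eta0 : 0 < eta by rewrite divr_gt0 // /theta; move: theta0_lt1; lra.
exists theta, ((1 + eta^-1) * rho ^+ 2 * L ^+ 2).
have k0 : 0 <= 1 + eta^-1 by rewrite addr_ge0 // invr_ge0 ltW.
have c0 : 0 <= (1 + eta^-1) * rho ^+ 2 by rewrite mulr_ge0 // sqr_ge0.
split; first by rewrite /theta; move: theta0_gt0 theta0_lt1; lra.
  by rewrite mulr_ge0 ?sqr_ge0.
move=> x x' u u' v v' hx hx' hu hu' hv hv' t tI.
have jv := (update_Uad hu hv).1; have jv' := (update_Uad hu' hv').1.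
case: hv jv => phi [hphi ephi ->] [jv _ _]; case: hv' jv' => phi' [hphi' ephi' ->] [jv' _ _].
have tT : t <= T by rewrite in_itv in tI; case/andP: tI.
have [psi hpsi epsi] := wellF (lexx 0) (ltW T0) (lexx T) hx hu'.
have contr := explicit_step_contracts tI hx hu hu' hphi hpsi ephi epsi.
have eE := eq_L2_psub (eq_L2_sub tT epsi) (eq_L2_sub tT ephi').
have lip := F_lipschitz tI (L2ad_sub tT hx) (L2ad_sub tT hx') (Uad_sub tT hu') (Uad_sub tT hu').
rewrite (eq_L2_norm_H eE) norm_H_subrr addr0 in lip.
have jsub k a b : L2ad P B 0 T a -> L2ad P B 0 T b ->
    jointly_measurable t (@psub d Omega R k 1 a b) /\ (msq P t (psub a b) < +oo)%E.
  move=> /(L2ad_sub tT)[ja _ a2] /(L2ad_sub tT)[jb _ b2]; split; first exact: jmB.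
  have mS := measurable_slab (measurable_itv `[0, t]) (T2 := Omega).
  rewrite (msq_slab P (jmB ja jb)); apply: intsqB_lty => //; by rewrite -(msq_slab P).
have [jx x2] := jsub _ _ _ hx hx'; have [jE E2] := jsub _ _ _ hpsi hphi'.
have [ju u2] := jsub _ _ _ hu.1 hu'.1; have [jG G2] := jsub _ _ _ hphi hpsi.
have jS := measurable_slab (measurable_itv `[0, t]) (T2 := Omega).
have jD : jointly_measurable t (fun s w => psub u u' s w - rho *: psub phi psi s w).
  by apply: measurable_mxB => //; exact: measurable_mxZ.
have lip2 : (msq P t (psub psi phi') <= (L ^+ 2)%:E * msq P t (psub x x'))%E.
  have f1 := msq_fin E2; have f2 := msq_fin x2.
  rewrite -(fineK f1) -(fineK f2) -EFinM lee_fin -!norm_H_sqr -exprMn.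
  have n0 := norm_H_ge0 P t (psub psi phi').
  by rewrite ler_pXn2r ?nnegrE //; exact: le_trans lip.
apply: (@le_trans _ _ ((1 + eta)%:E * msq P t (fun s w => (psub u u' s w - rho *: psub phi psi s w)%R)
    + ((1 + eta^-1) * rho ^+ 2)%:E * msq P t (psub psi phi'))%E).
  apply: msq_lin => //.
  - by rewrite addr_ge0 // ltW.
  - exact: (jmB (jm_sub tT jv) (jm_sub tT jv')).
  move=> s w _; apply: le_trans (nearest_nonexpansive K0 clK cvK _ _) _.
  have -> : u s w - rho *: phi s w - (u' s w - rho *: phi' s w) =
      (psub u u' s w - rho *: psub phi psi s w) + (- rho) *: psub psi phi' s w.
    by apply/matrixP => i j; rewrite !mxE; ring.
  apply: le_trans (sqnormD_young _ _ eta0) _.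
  by rewrite sqnormZ sqrrN mulrA.
have e1 : theta = (1 + eta) * theta0 by rewrite /eta; field; rewrite gt_eqF.
apply: leeD.
  rewrite e1 EFinM -muleA; apply: lee_wpmul2l => //.
  by rewrite lee_fin addr_ge0 // ltW.
by rewrite (EFinM _ (L ^+ 2)) -muleA; apply: lee_wpmul2l.
Qed.

(** The variational characterisation of the projection, divided by the step
    length, is the variational inequality. *)
Lemma fixed_point_svi x u y v : Uad P B 0 T K u -> is_update x u v ->
  eq_L2 P 0 T y x -> eq_L2 P 0 T v u -> solves_SVI P T K F y v.
Proof.
move=> [_ uK] [phi [_ ephi ev]] ey evu z Kz.
have h1 := ae_and (ae_and uK ephi) (ae_and ey evu).
apply: (ae_imply _ h1) => s [[hK hphi] [hy hv]] sT.
have h2 := ae_and (ae_and (hK sT) (hphi sT)) (ae_and (hy sT) (hv sT)).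
apply: (ae_imply _ h2) => w [[Kw]]; rewrite /Ftilde asboolT // => Fw [yw vw].
rewrite yw vw Fw; have := nearest_var K0 clK cvK (u s w - rho *: phi s w) Kz.
have -> : nearest K (u s w - rho *: phi s w) = u s w by move: vw; rewrite ev.
by rewrite addrAC subrr add0r mxdotNl mxdotZl oppr_le0 pmulr_rge0.
Qed.

(** The exceptional null set in the variational inequality depends on the
    competitor; a countable dense set of competitors determines the projection. *)
Lemma svi_fixed_point x u : L2ad P B 0 T x -> Uad P B 0 T K u -> solves_SVI P T K F x u ->
  exists2 v, is_update x u v & eq_L2 P 0 T v u.
Proof.
move=> hx hu svi; have [phi hphi ephi] := wellF (lexx 0) (ltW T0) (lexx T) hx hu.
exists (fun s w => nearest K (u s w - rho *: phi s w)); first by exists phi.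
have hq : {ae mu, forall s, forall q : 'cV[rat]_m, s \in `[0, T] ->
    {ae P, forall w, 0 <= mxdot (F s w (x s w) (u s w)) (nearest K (map_mx ratr q) - u s w)}}.
  by apply: ae_forall_countable => q; apply: svi; exact: nearest_in.
have h1 := ae_and (ae_and hu.2 ephi) hq.
apply: (ae_imply _ h1) => s [[hK hphi'] {}hq] sT.
have h2 : {ae P, forall w, forall q : 'cV[rat]_m,
    0 <= mxdot (F s w (x s w) (u s w)) (nearest K (map_mx ratr q) - u s w)}.
  by apply: ae_forall_countable => q; exact: hq.
have h3 := ae_and (ae_and (hK sT) (hphi' sT)) h2.
apply: (ae_imply _ h3) => w [[Kw]]; rewrite /Ftilde asboolT // => Fw /nearest_rat_dense.
rewrite Fw => /(_ K0 clK cvK) hvar; apply/esym; apply: nearest_uniq => // z Kz.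
by rewrite addrAC subrr add0r mxdotNl mxdotZl oppr_le0 pmulr_rge0 // hvar.
Qed.

End control_update.

(** * The fixed point iteration *)

Section exponential_weight.
Context {R : realType}.
Local Notation mu := (@lebesgue_measure R).

Lemma integral_expR_le (b t : R) : 0 < b -> 0 <= t ->
  (\int[mu]_(s in `[0%R, t]) (expR (b * s))%:E <= (expR (b * t) / b)%:E)%E.
Proof.
move=> b0; rewrite le_eqVlt => /predU1P[<-|t0].
  by rewrite set_itv1 integral_set1 lee_fin divr_ge0 ?expR_ge0 // ltW.
pose G (s : R) := b^-1 * expR (b * s).
have dG s : is_derive s (1 : R) G (expR (b * s)).
  have -> : expR (b * s) = b^-1 *: (b * expR (b * s)).
    by rewrite /GRing.scale /= mulrA mulVf ?mul1r // gt_eqF.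
  apply: is_deriveZ; have h := is_derive_expR (b * s).
  have hb : is_derive s (1 : R) (fun s : R => b * s) b.
    by have := is_deriveZ b (is_derive_id s (1 : R)); rewrite /GRing.scale /= mulr1.
  have := @is_derive1_comp R expR (fun s : R => b * s) s _ _ h hb.
  by rewrite mulrC.
have cG : continuous G.
  by move=> s; apply: differentiable_continuous; apply/derivable1_diffP; exact: (@ex_derive _ _ _ _ _ _ _ (dG s)).
have ce : continuous (fun s : R => expR (b * s)).
  move=> s; apply: (@continuous_comp R R R (fun s : R => b * s) expR).
    by apply: (@continuousM R R (fun=> b) id); [exact: cst_continuous|exact: cvg_id].
  exact: continuous_expR.
have -> := @continuous_FTC2 R (fun s => expR (b * s)) G 0 t t0.
- by rewrite -EFinB lee_fin /G [leRHS]mulrC gerBl mulr_ge0 ?expR_ge0 // invr_ge0 ltW.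
- exact: continuous_subspaceT.
- split.
  + by move=> s _; exact: (@ex_derive _ _ _ _ _ _ _ (dG s)).
  + by apply: cvg_at_right_filter; exact: cG.
  + by apply: cvg_at_left_filter; exact: cG.
- by move=> s _; rewrite derive1E; exact: (@derive_val _ _ _ _ _ _ _ (dG s)).
Qed.

End exponential_weight.

Lemma le_geometric_eq0 {R : realType} (x : \bar R) (A q : R) : 0 <= q < 1 ->
  (0 <= x)%E -> (forall k, x <= (A * q ^+ k)%:E)%E -> x = 0%E.
Proof.
move=> q01 x0 xA.
have h := @cvge0_geometric R (fun=> x) A q q01 (fun=> x0) xA.
by apply: (@cvg_unique _ (@ereal_hausdorff R) _ _ _ _ _ h); exact: cvg_cst.
Qed.

Section solution.
Context {d : measure_display} {Omega : measurableType d} {R : realType}.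
Variable P : probability Omega R.
Local Notation mu := (@lebesgue_measure R).
Context {l : nat}.
Variable B : R -> Omega -> 'cV[R]_l.
Hypothesis bmB : is_brownian_motion P B.
Variable T : R.
Hypothesis T0 : 0 < T.

Let mB := bm_measurable bmB.

(** Replacing the coefficients by equivalent ones changes neither the
    approximating step processes nor, almost surely, the integral in time. *)
Lemma is_state_eq n (x0 : 'cV[R]_n) t phi phi' (psi psi' : R -> Omega -> 'M[R]_(n, l)) X :
  0 <= t -> L2ad P B 0 t phi -> L2ad P B 0 t phi' -> L2ad P B 0 t psi' ->
  eq_L2 P 0 t phi phi' -> eq_L2 P 0 t psi psi' ->
  is_state P B x0 t phi psi X -> is_state P B x0 t phi' psi' X.
Proof.
move=> t0 [jphi _ phi2] [jphi' _ phi2'] hpsi' ephi epsi [I hI XE].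
exists I.
  case: hI => _ mI [S [hS Spsi SI]]; split; [exact: hpsi'|exact: mI|].
  exists S; split; [exact: hS| |exact: SI].
  have e k : msq P t (psub psi (step_eval (S k))) = msq P t (psub psi' (step_eval (S k))).
    by apply: eq_L2_msq; apply: eq_L2_psub => //; apply: aeW => s _; exact: aeW.
  have Spsi' : msq P t (psub psi' (step_eval (S k))) @[k --> \oo] --> 0%E.
    by under eq_fun do rewrite -e; exact: Spsi.
  exact: Spsi'.
have := time_integral_estimate t0 (lexx t) jphi jphi' phi2 phi2'.
rewrite msq_cutoff_same (msq_subr_eq0 ephi) mule0 => le0.
have /intsq_eq0 h : intsq P setT (fun w => time_integral t phi w - time_integral t phi' w) = 0%E.
  by apply/eqP; rewrite eq_le le0 intsq_ge0.
have mJ := measurable_path_integral jphi; have mJ' := measurable_path_integral jphi'.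
have hae := h measurableT (measurable_mxB measurableT mJ mJ').
apply: (ae_imply2 _ hae XE) => w /(_ Logic.I) /eqP; rewrite subr_eq0 => /eqP e ->.
by rewrite e.
Qed.

(** Completeness of the space of square integrable adapted processes, for
    geometrically fast Cauchy sequences. *)
Lemma L2ad_limit n (Y : nat -> R -> Omega -> 'cV[R]_n) (A q : R) : 0 < q < 1 -> 0 <= A ->
  (forall k, L2ad P B 0 T (Y k)) ->
  (forall k, msq P T (psub (Y k.+1) (Y k)) <= (A * q ^+ k)%:E)%E ->
  exists X A', [/\ L2ad P B 0 T X, 0 <= A' &
    forall k, (msq P T (psub X (Y k)) <= (A' * q ^+ k)%:E)%E].
Proof.
move=> /andP[q0 q1] A0 hY YA.
have jY k : jointly_measurable T (Y k) by case: (hY k).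
pose D : set (measurableTypeR R * Omega)%type := `[0, T]%classic `*` setT.
have mS : measurable D by exact: (measurable_slab (measurable_itv `[0, T])).
pose r := Num.sqrt q; have r2 : r ^+ 2 = q by rewrite sqr_sqrtr // ltW.
have r01 : 0 < r < 1.
  by rewrite sqrtr_gt0 q0 /= -sqrtr1 ltr_sqrt.
pose Z k (p : R * Omega) := Y k p.1 p.2.
have mZ k : measurable_fun D (Z k) by exact: jY.
have ZA k : (intsq (mu \x P)%E D (fun p => Z k.+1 p - Z k p)%R <= (A * r ^+ 2 ^+ k)%:E)%E.
  by rewrite r2; apply: le_trans (YA k); rewrite msq_slab //; exact: jmB.
have [_ lim] := plim_complete mS r01 mZ A0 ZA.
pose X s w := plim Z (s, w).
have jX : jointly_measurable T X.
  rewrite /jointly_measurable; have -> : (fun p : R * Omega => X p.1 p.2) = plim Z.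
    by apply/funext => -[s w].
  exact: measurable_plim.
have XA k : (msq P T (psub X (Y k)) <= (A / (1 - r) ^+ 2 * q ^+ k)%:E)%E.
  rewrite msq_slab; last exact: jmB.
  rewrite -r2; apply: le_trans (lim k); rewrite le_eqVlt; apply/orP; left; apply/eqP.
  by apply: eq_integral => -[s w] _.
exists X, (A / (1 - r) ^+ 2); split => //; last first.
  by rewrite divr_ge0 // sqr_ge0.
split=> //.
  move=> s sT; apply/measurable_wrtP.
  have -> : X s = plim (fun k => Y k s) by [].
  by apply: measurable_plim => // k; apply: L2ad_adapted.
rewrite -[X in (X < _)%E]/(msq P T X).
apply: (@le_lt_trans _ _ (2%:E * msq P T (psub X (Y 0%N)) + 2%:E * msq P T (Y 0%N))%E).
  apply: msq_lin => //; first exact: jmB.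
  by move=> s w _; rewrite -{1}(subrK (Y 0%N s w) (X s w)); exact: sqnormD_le2.
apply: lte_add_pinfty; apply: lte_mul_pinfty => //.
  by apply: le_lt_trans (XA 0%N) _; exact: ltry.
by case: (hY 0%N).
Qed.

Context {n m : nat}.
Variables (K : set 'cV[R]_m) (x0 : 'cV[R]_n).
Hypothesis K0 : K !=set0.
Hypothesis clK : closed K.
Hypothesis cvK : convex_set K.
Variable f : R -> 'cV[R]_n -> 'cV[R]_m -> 'cV[R]_n.
Variable g : R -> 'cV[R]_n -> 'cV[R]_m -> 'M[R]_(n, l).
Variable F : R -> Omega -> 'cV[R]_n -> 'cV[R]_m -> 'cV[R]_m.
Variables (C L_f K_1 K_2 L_g L_F : R).
Hypothesis mf : measurable_fun (`[0, T]%classic `*` [set: 'cV[R]_n] `*` [set: 'cV[R]_m])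
    (fun p : R * 'cV[R]_n * 'cV[R]_m => f p.1.1 p.1.2 p.2).
Hypothesis mg : measurable_fun (`[0, T]%classic `*` [set: 'cV[R]_n] `*` [set: 'cV[R]_m])
    (fun p : R * 'cV[R]_n * 'cV[R]_m => g p.1.1 p.1.2 p.2).
Hypothesis wellF : Ftilde_well_defined P T B K F.
Hypothesis C0 : 0 < C.
Hypothesis CL : C < L_F.
Hypothesis f_growth : forall t x u, t \in `[0, T] ->
    mxnorm2 (f t x u) <= K_1 * (1 + mxnorm2 x + mxnorm2 u).
Hypothesis g_growth : forall t x u, t \in `[0, T] ->
    mxnorm2 (g t x u) <= K_2 * (1 + mxnorm2 x + mxnorm2 u).
Hypothesis f_lipschitz : forall t1 t2 x1 x2 u1 u2, t1 \in `[0, T] -> t2 \in `[0, T] ->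
    mxnorm2 (f t1 x1 u1 - f t2 x2 u2) <=
      L_f * (`|t1 - t2| + mxnorm2 (x1 - x2) + mxnorm2 (u1 - u2)).
Hypothesis g_lipschitz : forall t1 t2 x1 x2 u1 u2, t1 \in `[0, T] -> t2 \in `[0, T] ->
    mxnorm2 (g t1 x1 u1 - g t2 x2 u2) <=
      L_g * (`|t1 - t2| + mxnorm2 (x1 - x2) + mxnorm2 (u1 - u2)).
Hypothesis F_lipschitz :
  forall t (x1 x2 : R -> Omega -> 'cV[R]_n) (u1 u2 : R -> Omega -> 'cV[R]_m),
    t \in `[0, T] ->
    L2ad P B 0 t x1 -> L2ad P B 0 t x2 ->
    Uad P B 0 t K u1 -> Uad P B 0 t K u2 ->
    norm_H P 0 t (psub (Ftilde K F x1 u1) (Ftilde K F x2 u2)) <=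
      L_F * (norm_H P 0 t (psub x1 x2) + norm_H P 0 t (psub u1 u2)).
Hypothesis F_monotone :
  forall t (x : R -> Omega -> 'cV[R]_n) (u1 u2 : R -> Omega -> 'cV[R]_m),
    t \in `[0, T] ->
    L2ad P B 0 t x -> Uad P B 0 t K u1 -> Uad P B 0 t K u2 ->
    C * norm_H P 0 t (psub u1 u2) ^+ 2 <=
      inner_H P 0 t (psub (Ftilde K F x u1) (Ftilde K F x u2)) (psub u1 u2).

Local Notation pair := ((R -> Omega -> 'cV[R]_n) * (R -> Omega -> 'cV[R]_m))%type.
Local Notation update := (is_update P B T K F C L_F).

Definition admissible (p : pair) := L2ad P B 0 T p.1 /\ Uad P B 0 T K p.2.

(** The coefficients are evaluated along the old pair, so that each step only
    integrates given processes. *)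
Definition iteration_step (p p' : pair) :=
  (forall t, t \in `[0, T] ->
    is_state P B x0 t (coef_process f p.1 p.2) (coef_process g p.1 p.2) (p'.1 t)) /\
  update p.1 p.2 p'.2.

Let coef_f p : admissible p -> L2ad P B 0 T (coef_process f p.1 p.2).
Proof. by move=> [h1 [h2 _]]; exact: (coef_L2ad mf f_growth f_lipschitz h1 h2). Qed.

Let coef_g p : admissible p -> L2ad P B 0 T (coef_process g p.1 p.2).
Proof. by move=> [h1 [h2 _]]; exact: (coef_L2ad mg g_growth g_lipschitz h1 h2). Qed.

Lemma iteration_step_exists p : admissible p ->
  exists p', admissible p' /\ iteration_step p p'.
Proof.
move=> hp; have [x hx sx] := state_process bmB x0 T0 (coef_f hp) (coef_g hp).
have [v hv] := update_exists T0 wellF C L_F hp.1 hp.2.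
by exists (x, v); split; split => //; exact: update_Uad hp.2 hv.
Qed.

Let cS : R := @state_constant R l T * (2 * L_f ^+ 2 + 2 * L_g ^+ 2).
Let cS0 : 0 <= cS.
Proof.
apply: mulr_ge0; first by apply: state_constant_ge0; exact: ltW.
by rewrite addr_ge0 // mulr_ge0 ?sqr_ge0.
Qed.

Lemma state_difference p1 p1' p2 p2' t : admissible p1 -> admissible p1' ->
  iteration_step p1 p2 -> iteration_step p1' p2' -> t \in `[0, T] ->
  (intsq P setT (fun w => p2.1 t w - p2'.1 t w)%R <=
   cS%:E * (msq P t (psub p1.1 p1'.1) + msq P t (psub p1.2 p1'.2)))%E.
Proof.
move=> h1 h1' [s2 _] [s2' _] tI; have /andP[t0 tT] : 0 <= t <= T by rewrite in_itv in tI.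
have := state_estimate bmB t0 (lexx t) (L2ad_sub tT (coef_f h1)) (L2ad_sub tT (coef_f h1'))
  (s2 t tI) (s2' t tI).
move=> /le_trans; apply; rewrite !msq_cutoff_same.
have jx : jointly_measurable T p1.1 by case: h1.1.
have ju : jointly_measurable T p1.2 by case: h1.2.1.
have jx' : jointly_measurable T p1'.1 by case: h1'.1.
have ju' : jointly_measurable T p1'.2 by case: h1'.2.1.
have ef := coef_msq_lipschitz P mf f_lipschitz tT jx ju jx' ju'.
have eg := coef_msq_lipschitz P mg g_lipschitz tT jx ju jx' ju'.
move: ef eg; set S := (msq P t (psub p1.1 p1'.1) + msq P t (psub p1.2 p1'.2))%E => ef eg.
have S0 : (0 <= S)%E by apply: adde_ge0; exact: msq_ge0.
have cst0 := @state_constant_ge0 R l t t0.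
apply: (@le_trans _ _ ((@state_constant R l t)%:E * ((2 * L_f ^+ 2 + 2 * L_g ^+ 2)%:E * S))%E).
  apply: lee_wpmul2l; first by rewrite lee_fin.
  rewrite EFinD ge0_muleDl; [exact: leeD|by rewrite lee_fin mulr_ge0 ?sqr_ge0..].
rewrite muleA -EFinM; apply: lee_wpmul2r => //; rewrite lee_fin ler_wpM2r //.
  by rewrite addr_ge0 // mulr_ge0 ?sqr_ge0.
exact: state_constant_mono.
Qed.

(** Pairs are compared by weighted mean squares, allowed to grow exponentially
    in time. The weight [lambda] absorbs the influence of the state on the
    control, and the growth rate [beta] makes the state equation contract, as
    integration in time divides an exponential by its rate. *)
Definition dominated (lambda beta w : R) (p p' : pair) := forall t, t \in `[0, T] ->
  (lambda%:E * msq P t (psub p.1 p'.1) + msq P t (psub p.2 p'.2) <= (w * expR (beta * t))%:E)%E.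

Lemma iteration_contracts : exists lambda beta q, [/\ 1 <= lambda, 0 < beta, 0 < q < 1 &
  forall p1 p1' p2 p2' w, admissible p1 -> admissible p1' ->
    iteration_step p1 p2 -> iteration_step p1' p2' -> 0 <= w ->
    dominated lambda beta w p1 p1' -> dominated lambda beta (q * w) p2 p2'].
Proof.
have [theta [kappa [/andP[th0 th1] k0 contr]]] :=
  update_contraction T0 K0 clK cvK wellF C0 CL F_lipschitz F_monotone.
(* With this weight theta m2 + kappa m1 <= theta (lambda m1 + m2). *)
pose lambda := 1 + kappa / theta; pose q := (1 + theta) / 2.
have la1 : 1 <= lambda by rewrite lerDl divr_ge0 // ltW.
have la0 : 0 < lambda := lt_le_trans ltr01 la1.
(* Integration in time then costs a factor at most (1 - theta) / 2, half of the
   room left by the contraction of the control. *)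
pose beta := 1 + 2 * (lambda * cS) / (1 - theta).
have b0 : 0 < beta.
  rewrite ltr_wpDr // divr_ge0 ?subr_ge0 ?(ltW th1) //.
  by rewrite mulr_ge0 // mulr_ge0 // ltW.
have small : lambda * cS / beta <= (1 - theta) / 2.
  rewrite ler_pdivrMr // /beta mulrDr mulr1.
  have -> : (1 - theta) / 2 * (2 * (lambda * cS) / (1 - theta)) = lambda * cS.
    by field; rewrite subr_eq0 gt_eqF.
  by rewrite lerDr; move: th1; lra.
have q01 : 0 < q < 1 by rewrite /q; move: th0 th1; lra.
exists lambda, beta, q; split => // p1 p1' p2 p2' w h1 h1' s12 s12' w0 dom t tI.
have /andP[t0 tT] : 0 <= t <= T by rewrite in_itv in tI.
have domS s : s \in `[0, T] ->
    (msq P s (psub p1.1 p1'.1) + msq P s (psub p1.2 p1'.2) <= (w * expR (beta * s))%:E)%E.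
  move=> sI; apply: le_trans (dom s sI); apply: leeD => //.
  rewrite -[leLHS]mul1e; apply: lee_wpmul2r; first exact: msq_ge0.
  by rewrite lee_fin.
have state_part : (msq P t (psub p2.1 p2'.1) <= (cS * w * (expR (beta * t) / beta))%:E)%E.
  have cw0 : 0 <= cS * w by rewrite mulr_ge0.
  rewrite msqE; apply: (@le_trans _ _ (\int[mu]_(s in `[0%R, t]) ((cS * w)%:E * (expR (beta * s))%:E))%E).
    apply: ae_ge0_le_integral_any => [s _|s _|]; first exact: intsq_ge0.
      by rewrite -EFinM lee_fin mulr_ge0 // expR_ge0.
    apply: aeW => s; rewrite /= in_itv /= => /andP[s0 st].
    have sI : s \in `[0, T] by rewrite in_itv /= s0 (le_trans st).
    apply: le_trans (state_difference h1 h1' s12 s12' sI) _.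
    rewrite -EFinM -mulrA EFinM; apply: lee_wpmul2l; last exact: domS.
    by rewrite lee_fin.
  have mexp : measurable_fun `[0, t]%classic (fun s : R => (expR (beta * s))%:E).
    apply/measurable_EFinP; apply: measurable_funTS.
    by apply: measurableT_comp => //; exact: mulrl_measurable.
  rewrite ge0_integralZl_EFin //.
  rewrite (EFinM (cS * w)); apply: lee_wpmul2l; first by rewrite lee_fin.
  exact: integral_expR_le.
have control_part : (msq P t (psub p2.2 p2'.2) <= (theta * (w * expR (beta * t)))%:E)%E.
  apply: le_trans (contr _ _ _ _ _ _ h1.1 h1'.1 h1.2 h1'.2 s12.2 s12'.2 t tI) _.
  rewrite EFinM; apply: le_trans (lee_wpmul2l _ (dom t tI)); last by rewrite lee_fin ltW.
  have p1_ge0 := msq_ge0 P t (psub p1.1 p1'.1); have p2_ge0 := msq_ge0 P t (psub p1.2 p1'.2).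
  have lp1_ge0 : (0 <= lambda%:E * msq P t (psub p1.1 p1'.1))%E.
    by apply: mule_ge0 => //; rewrite lee_fin ltW.
  rewrite (ge0_muleDr _ lp1_ge0 p2_ge0) [leRHS]addeC; apply: leeD => //; rewrite muleA -EFinM; apply: lee_wpmul2r => //.
  rewrite lee_fin /lambda mulrDr mulr1 mulrC divfK ?gt_eqF // lerDr; exact: ltW.
apply: (@le_trans _ _ (lambda%:E * (cS * w * (expR (beta * t) / beta))%:E +
    (theta * (w * expR (beta * t)))%:E)%E).
  by apply: leeD => //; apply: lee_wpmul2l => //; rewrite lee_fin ltW.
rewrite -EFinM -EFinD lee_fin.
have -> : lambda * (cS * w * (expR (beta * t) / beta)) =
  lambda * cS / beta * (w * expR (beta * t)) by ring.
have -> : q * w * expR (beta * t) = ((1 - theta) / 2 + theta) * (w * expR (beta * t)).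
  by rewrite /q; field.
by rewrite -mulrDl ler_wpM2r ?lerD2r // mulr_ge0 // expR_ge0.
Qed.

Lemma msq_psub_lty k (a b : R -> Omega -> 'cV[R]_k) : L2ad P B 0 T a -> L2ad P B 0 T b ->
  (msq P T (psub a b) < +oo)%E.
Proof.
move=> [ja _ a2] [jb _ b2]; have mS := measurable_slab (measurable_itv `[0, T]) (T2 := Omega).
by rewrite (msq_slab P (jmB ja jb)); apply: intsqB_lty => //; rewrite -(msq_slab P).
Qed.

(** The exponential weight is at least 1. *)
Lemma dominated_intro lambda beta w p p' : 0 <= lambda -> 0 <= beta -> 0 <= w ->
  (lambda%:E * msq P T (psub p.1 p'.1) + msq P T (psub p.2 p'.2) <= w%:E)%E ->
  dominated lambda beta w p p'.
Proof.
move=> la0 b0 w0 h t; rewrite in_itv /= => /andP[t0 tT].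
apply: (@le_trans _ _ w%:E).
  apply: le_trans h; apply: leeD; last exact: msq_mono.
  by apply: lee_wpmul2l; [rewrite lee_fin|exact: msq_mono].
by rewrite lee_fin ler_peMr // -expR0 ler_expR mulr_ge0.
Qed.

Lemma dominated_exists lambda beta p p' : 0 <= lambda -> 0 <= beta ->
  admissible p -> admissible p' -> exists2 w, 0 <= w & dominated lambda beta w p p'.
Proof.
move=> la0 b0 [h1 [h2 _]] [h1' [h2' _]].
have e1 := msq_ge0 P T (psub p.1 p'.1); have e2 := msq_ge0 P T (psub p.2 p'.2).
have ge0 : (0 <= lambda%:E * msq P T (psub p.1 p'.1) + msq P T (psub p.2 p'.2))%E.
  by apply: adde_ge0 => //; apply: mule_ge0.
have fin : (lambda%:E * msq P T (psub p.1 p'.1) + msq P T (psub p.2 p'.2))%E \is a fin_num.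
  rewrite ge0_fin_numE //; apply: lte_add_pinfty; last exact: msq_psub_lty.
  by apply: lte_mul_pinfty => //; exact: msq_psub_lty.
exists (fine (lambda%:E * msq P T (psub p.1 p'.1) + msq P T (psub p.2 p'.2))%E).
  exact: fine_ge0.
by apply: dominated_intro => //; [exact: fine_ge0|rewrite fineK].
Qed.

Lemma dominated_msq lambda beta w p p' : 1 <= lambda -> dominated lambda beta w p p' ->
  (msq P T (psub p.1 p'.1) <= (w * expR (beta * T))%:E)%E /\
  (msq P T (psub p.2 p'.2) <= (w * expR (beta * T))%:E)%E.
Proof.
move=> la1 /(_ T); rewrite in_itv /= lexx (ltW T0) => /(_ isT) h.
have p1 := msq_ge0 P T (psub p.1 p'.1); have p2 := msq_ge0 P T (psub p.2 p'.2).
have la0 : 0 <= lambda := le_trans ler01 la1.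
split; apply: le_trans h.
  apply: (@le_trans _ _ (lambda%:E * msq P T (psub p.1 p'.1))%E); last by rewrite leeDl.
  by rewrite -[leLHS]mul1e; apply: lee_wpmul2r => //; rewrite lee_fin.
by rewrite leeDr // mule_ge0.
Qed.

Lemma solution_fixed_point x u : caratheodory_solution P T B K f g F x0 x u ->
  admissible (x, u) /\
  exists2 v, iteration_step (x, u) (x, v) & eq_L2 P 0 T v u.
Proof.
move=> [hx sde hu svi]; split=> //.
have [v hv ev] := svi_fixed_point T0 K0 clK cvK wellF C0 CL hx hu svi.
by exists v.
Qed.

(** Two solutions are fixed points, so a bound on their distance may be
    multiplied by the contraction factor any number of times. *)
Lemma solution_unique x u x' u' :
  caratheodory_solution P T B K f g F x0 x u ->
  caratheodory_solution P T B K f g F x0 x' u' ->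
  eq_L2 P 0 T x x' /\ eq_L2 P 0 T u u'.
Proof.
move=> /solution_fixed_point[h [v s ev]] /solution_fixed_point[h' [v' s' ev']].
have [lambda [beta [q [la1 b0 q01 contr]]]] := iteration_contracts.
have la0 : 0 <= lambda := le_trans ler01 la1; have /andP[q0 q1] := q01.
have [w w0 dom0] := dominated_exists la0 (ltW b0) h h'.
have dom k : dominated lambda beta (q ^+ k * w) (x, u) (x', u').
  elim: k => [|k ih]; first by rewrite expr0 mul1r.
  have wk0 : 0 <= q ^+ k * w by rewrite mulr_ge0 // exprn_ge0 // ltW.
  have := contr _ _ _ _ _ h h' s s' wk0 ih; rewrite mulrA -exprS => hd t tI.
  have tT : t <= T by rewrite in_itv in tI; case/andP: tI.
  have := hd t tI; rewrite /= (@eq_L2_msq _ _ _ P t m 1 (psub v v') (psub u u')) //.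
  by apply: eq_L2_psub; exact: eq_L2_sub tT _.
have q01' : 0 <= q < 1 by rewrite ltW.
have bnd k : (q ^+ k * w * expR (beta * T) = w * expR (beta * T) * q ^+ k) by ring.
have [jx jx'] : jointly_measurable T x /\ jointly_measurable T x'.
  by split; [case: h.1|case: h'.1].
have [ju ju'] : jointly_measurable T u /\ jointly_measurable T u'.
  by split; [case: h.2.1|case: h'.2.1].
split; apply: msq_eq0 => //.
  apply: (@le_geometric_eq0 _ _ (w * expR (beta * T)) q q01') => [|k]; first exact: msq_ge0.
  by have [+ _] := dominated_msq la1 (dom k); rewrite bnd; apply.
apply: (@le_geometric_eq0 _ _ (w * expR (beta * T)) q q01') => [|k]; first exact: msq_ge0.
by have [_] := dominated_msq la1 (dom k); rewrite bnd; apply.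
Qed.

(** The set of controls is closed under mean square limits, because projecting
    onto K does not increase distances. *)
Lemma control_limit (Y : nat -> R -> Omega -> 'cV[R]_m) (U : R -> Omega -> 'cV[R]_m) (A q : R) :
  0 <= q < 1 -> (forall k, L2ad P B 0 T (Y k)) -> (forall k s w, K (Y k s w)) ->
  L2ad P B 0 T U -> (forall k, msq P T (psub U (Y k)) <= (A * q ^+ k)%:E)%E ->
  Uad P B 0 T K U.
Proof.
move=> q01 hY YK hU UA; split => //.
have jU : jointly_measurable T U by case: hU.
pose V s w := nearest K (U s w).
have jV : jointly_measurable T V.
  exact: (measurableT_comp (measurable_nearest K0 clK cvK) jU).
have /(msq_eq0 jV jU) h : msq P T (psub V U) = 0%E.
  apply: (@le_geometric_eq0 _ _ (4 * A) q q01) => [|k]; first exact: msq_ge0.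
  have jY : jointly_measurable T (Y k) by case: (hY k).
  apply: (@le_trans _ _ (2%:E * msq P T (psub U (Y k)) + 2%:E * msq P T (psub U (Y k)))%E).
    apply: msq_lin => //; try exact: jmB.
    move=> s w _; apply: le_trans (sqnorm_triangle2 (Y k s w) _ _) _.
    rewrite [sqnorm (Y k s w - _)]sqnormBC lerD2r ler_pM2l //.
    by rewrite -{1}(nearest_id K0 clK cvK (YK k s w)); exact: nearest_nonexpansive.
  apply: (@le_trans _ _ (2%:E * (A * q ^+ k)%:E + 2%:E * (A * q ^+ k)%:E)%E).
    by apply: leeD; apply: lee_wpmul2l.
  by rewrite -!EFinM -EFinD lee_fin le_eqVlt; apply/orP; left; apply/eqP; ring.
apply: (ae_imply _ h) => s + sI => /(_ sI) {}h.
by apply: (ae_imply _ h) => w <-; exact: nearest_in.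
Qed.

(** The limit [(X, U)] of the iteration only solves the equation up to
    equivalence, whereas the state equation is required at every time. One more
    step from the limit gives a pair [(y, v)] equivalent to it, whose state
    satisfies the equation at every time. *)
Lemma solution_exists : exists x u, caratheodory_solution P T B K f g F x0 x u.
Proof.
have [lambda [beta [q [la1 b0 q01 contr]]]] := iteration_contracts.
have la0 : 0 <= lambda := le_trans ler01 la1; have /andP[q0 q1] := q01.
have q01' : 0 <= q < 1 by rewrite ltW.
pose p0 : pair := (fun _ _ => 0, fun _ _ => nearest K 0).
have adm0 : admissible p0.
  split; first exact: L2ad0.
  split; first exact: L2ad_cst.
  by apply: aeW => s _; apply: aeW => w; exact: nearest_in.
have /choice[next hnext] (p : pair) : exists p', admissible p -> admissible p' /\ iteration_step p p'.
  have [h|h] := pselect (admissible p); last by exists p.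
  by have [p' hp'] := iteration_step_exists h; exists p'.
pose it k := iter k next p0.
have adm k : admissible (it k).
  by elim: k => [|k ih] //=; have [] := hnext _ ih.
have stp k : iteration_step (it k) (it k.+1) by have [] := hnext _ (adm k).
have itK k s w : K ((it k).2 s w).
  case: k => [|k]; first exact: nearest_in.
  exact: (update_in K0 clK cvK (stp k).2).
have [w w0 dom0] := dominated_exists la0 (ltW b0) (adm 1%N) (adm 0%N).
have dom k : dominated lambda beta (q ^+ k * w) (it k.+1) (it k).
  elim: k => [|k ih]; first by rewrite expr0 mul1r.
  rewrite exprS -mulrA; apply: contr ih => //.
  by rewrite mulr_ge0 // exprn_ge0 // ltW.
pose A := w * expR (beta * T).
have A0 : 0 <= A by rewrite mulr_ge0 // expR_ge0.
have bnd k : q ^+ k * w * expR (beta * T) = A * q ^+ k by rewrite /A; ring.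
have [X [A1 [hX A10 XA]]] : exists X A', [/\ L2ad P B 0 T X, 0 <= A' &
    forall k, (msq P T (psub X (it k).1) <= (A' * q ^+ k)%:E)%E].
  apply: (L2ad_limit q01 A0) => k; first exact: (adm k).1.
  by have [+ _] := dominated_msq la1 (dom k); rewrite bnd; apply.
have [U [A2 [hU A20 UA]]] : exists U A', [/\ L2ad P B 0 T U, 0 <= A' &
    forall k, (msq P T (psub U (it k).2) <= (A' * q ^+ k)%:E)%E].
  apply: (L2ad_limit q01 A0) => k; first exact: (adm k).2.1.
  by have [_] := dominated_msq la1 (dom k); rewrite bnd; apply.
have admXU : admissible (X, U).
  split => //; apply: (control_limit q01' _ _ hU UA) => // k; exact: (adm k).2.1.
have [[y v] [admyv stepyv]] := iteration_step_exists admXU.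
have domL k : dominated lambda beta ((lambda * A1 + A2) * q ^+ k) (X, U) (it k).
  apply: dominated_intro => //; first exact: ltW.
    by rewrite mulr_ge0 ?exprn_ge0 ?(ltW q0) // addr_ge0 // mulr_ge0.
  rewrite mulrDl -mulrA EFinD EFinM; apply: leeD => //.
  by apply: lee_wpmul2l.
have domyv k : dominated lambda beta (q * ((lambda * A1 + A2) * q ^+ k)) (y, v) (it k.+1).
  apply: (contr _ _ _ _ _ admXU (adm k) stepyv (stp k)) => //.
  by rewrite mulr_ge0 ?exprn_ge0 ?(ltW q0) // addr_ge0 // mulr_ge0.
pose D := q * (lambda * A1 + A2) * expR (beta * T).
have Dk k : q * ((lambda * A1 + A2) * q ^+ k) * expR (beta * T) = D * q ^+ k.
  by rewrite /D; ring.
have close j (a b : R -> Omega -> 'cV[R]_j) (c : nat -> R -> Omega -> 'cV[R]_j) (A' : R) :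
    0 <= A' -> L2ad P B 0 T a -> L2ad P B 0 T b -> (forall k, L2ad P B 0 T (c k)) ->
    (forall k, msq P T (psub a (c k.+1)) <= (D * q ^+ k)%:E)%E ->
    (forall k, msq P T (psub b (c k)) <= (A' * q ^+ k)%:E)%E -> eq_L2 P 0 T a b.
  move=> A'0 [ja _ _] [jb _ _] hc ac bc; apply: msq_eq0 => //.
  apply: (@le_geometric_eq0 _ _ (2 * D + 2 * (A' * q)) q q01') => [|k]; first exact: msq_ge0.
  have jc : jointly_measurable T (c k.+1) by case: (hc k.+1).
  apply: le_trans (msq_triangle2 P ja jc jb) _.
  apply: (@le_trans _ _ (2%:E * (D * q ^+ k)%:E + 2%:E * (A' * q ^+ k.+1)%:E)%E).
    by rewrite (msq_subC P T (c k.+1) b); apply: leeD; apply: lee_wpmul2l.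
  by rewrite -!EFinM -EFinD lee_fin exprS le_eqVlt; apply/orP; left; apply/eqP; ring.
have eyX : eq_L2 P 0 T y X.
  apply: (close _ _ _ (fun k => (it k).1) A1 A10 admyv.1 hX) => // k; first exact: (adm k).1.
  by have [+ _] := dominated_msq la1 (domyv k); rewrite Dk; apply.
have evU : eq_L2 P 0 T v U.
  apply: (close _ _ _ (fun k => (it k).2) A2 A20 admyv.2.1 hU) => // k; first exact: (adm k).2.1.
  by have [_] := dominated_msq la1 (domyv k); rewrite Dk; apply.
exists y, v; split.
- exact: admyv.1.
- move=> t tI; have /andP[t0 tT] : 0 <= t <= T by rewrite in_itv in tI.
  have ecoef a b (h : R -> 'cV[R]_n -> 'cV[R]_m -> 'M[R]_(a, b)) :
      eq_L2 P 0 t (coef_process h X U) (coef_process h y v).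
    apply: eq_L2_sub tT _; apply: (ae_imply2 _ eyX evU) => s h1 h2 sI.
    by apply: (ae_imply2 _ (h1 sI) (h2 sI)) => w'; rewrite /coef_process => -> ->.
  have := is_state_eq t0 (L2ad_sub tT (coef_f admXU)) (L2ad_sub tT (coef_f admyv))
    (L2ad_sub tT (coef_g admyv)) (ecoef _ _ f) (ecoef _ _ g) (stepyv.1 t tI).
  by [].
- exact: admyv.2.
- exact: (fixed_point_svi K0 clK cvK C0 CL admXU.2 stepyv.2 eyX evU).
Qed.

End solution.

(** * The theorem *)

Theorem theorem3p1 (d : measure_display) (Omega : measurableType d)
  (R : realType) (P : probability Omega R) (l n m : nat) (T : R)
  (B : R -> Omega -> 'cV[R]_l) (K : set 'cV[R]_m) (x0 : 'cV[R]_n)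
  (f : R -> 'cV[R]_n -> 'cV[R]_m -> 'cV[R]_n)
  (g : R -> 'cV[R]_n -> 'cV[R]_m -> 'M[R]_(n, l))
  (F : R -> Omega -> 'cV[R]_n -> 'cV[R]_m -> 'cV[R]_m)
  (C L_f K_1 K_2 L_g L_F : R) :
  0 < T ->
  is_brownian_motion P B ->
  K !=set0 -> closed K -> convex_set K ->
  measurable_fun (`[0, T]%classic `*` [set: 'cV[R]_n] `*` [set: 'cV[R]_m])
    (fun p : R * 'cV[R]_n * 'cV[R]_m => f p.1.1 p.1.2 p.2) ->
  measurable_fun (`[0, T]%classic `*` [set: 'cV[R]_n] `*` [set: 'cV[R]_m])
    (fun p : R * 'cV[R]_n * 'cV[R]_m => g p.1.1 p.1.2 p.2) ->
  measurable_fun (`[0, T]%classic `*` [set: Omega] `*` [set: 'cV[R]_n] `*` K)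
    (fun p : R * Omega * 'cV[R]_n * 'cV[R]_m =>
       F p.1.1.1 p.1.1.2 p.1.2 p.2) ->
  Ftilde_well_defined P T B K F ->
  0 < C -> 0 < L_f -> 0 < K_1 -> 0 < K_2 -> 0 < L_g -> 0 < L_F -> C < L_F ->
  (forall t x u, t \in `[0, T] ->
    mxnorm2 (f t x u) <= K_1 * (1 + mxnorm2 x + mxnorm2 u)) ->
  (forall t x u, t \in `[0, T] ->
    mxnorm2 (g t x u) <= K_2 * (1 + mxnorm2 x + mxnorm2 u)) ->
  (forall t1 t2 x1 x2 u1 u2, t1 \in `[0, T] -> t2 \in `[0, T] ->
    mxnorm2 (f t1 x1 u1 - f t2 x2 u2) <=
      L_f * (`|t1 - t2| + mxnorm2 (x1 - x2) + mxnorm2 (u1 - u2))) ->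
  (forall t1 t2 x1 x2 u1 u2, t1 \in `[0, T] -> t2 \in `[0, T] ->
    mxnorm2 (g t1 x1 u1 - g t2 x2 u2) <=
      L_g * (`|t1 - t2| + mxnorm2 (x1 - x2) + mxnorm2 (u1 - u2))) ->
  (forall t (x1 x2 : process n 1) (u1 u2 : process m 1), t \in `[0, T] ->
    L2ad P B 0 t x1 -> L2ad P B 0 t x2 ->
    Uad P B 0 t K u1 -> Uad P B 0 t K u2 ->
    norm_H P 0 t (psub (Ftilde K F x1 u1) (Ftilde K F x2 u2)) <=
      L_F * (norm_H P 0 t (psub x1 x2) + norm_H P 0 t (psub u1 u2))) ->
  (forall t (x : process n 1) (u1 u2 : process m 1), t \in `[0, T] ->
    L2ad P B 0 t x -> Uad P B 0 t K u1 -> Uad P B 0 t K u2 ->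
    C * norm_H P 0 t (psub u1 u2) ^+ 2 <=
      inner_H P 0 t (psub (Ftilde K F x u1) (Ftilde K F x u2))
        (psub u1 u2)) ->
  exists (x : process n 1) (u : process m 1),
    caratheodory_solution P T B K f g F x0 x u /\
    forall (x' : process n 1) (u' : process m 1),
      caratheodory_solution P T B K f g F x0 x' u' ->
      eq_L2 P 0 T x x' /\ eq_L2 P 0 T u u'.
Proof.
move=> T0 bmB K0 clK cvK mf mg _ wellF C0 _ _ _ _ _ CL f1 g1 f2 g2 FL FM.
have [x [u sol]] := solution_exists bmB T0 x0 K0 clK cvK mf mg wellF C0 CL f1 g1 f2 g2 FL FM.
exists x, u; split => // x' u' sol'.
exact: (solution_unique bmB T0 K0 clK cvK mf mg wellF C0 CL f1 f2 g2 FL FM sol sol').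
Qed.
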